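(* Let $\beta>0$. The operator $\mathcal A$ generates a unitary $C_0$-group $\{S(t)\}_{t\in\mathbb R}=\{e^{t\mathcal A}\}_{t\in\mathbb R}$ on $\mathcal H$. Consequently, for every $Z_0=(h_0,u_0)\in\mathcal H$, the system $Z_t=\mathcal AZ$, $Z(0)=Z_0$, admits a unique mild solution $Z(t)=S(t)Z_0\in C(\mathbb R;\mathcal H)$, and $\|Z(t)\|_{\mathcal H}=\|Z_0\|_{\mathcal H}$ for all $t\in\mathbb R$. If, in addition, $Z_0\in D(\mathcal A)$, then $Z\in C(\mathbb R;D(\mathcal A))\cap C^1(\mathbb R;\mathcal H)$, and $Z$ is the unique classical solution of this system.
   Context: $\mathbb T=\mathbb R/(2\pi\mathbb Z)$; functions are complex valued. Fourier convention: $\widehat v(k)=\frac1{2\pi}\int_{\mathbb T}v(x)e^{-ikx}dx$, $k\in\mathbb Z$. $\langle k\rangle=(1+k^2)^{1/2}$ and $\|v\|_{H^s}^2=2\pi\sum_k\langle k\rangle^{2s}|\widehat v(k)|^2$. Fourier multipliers: $\widehat{T_\beta v}(k)=-im_\beta(k)\widehat v(k)$ with $m_\beta(k)=\tanh(\beta k)/\beta$; $\widehat{P_\beta v}(k)=p_\beta(k)\widehat v(k)$ with $p_\beta(k)=\frac{\tanh(\beta k)}{\beta k}$ for $k\ne0$ and $p_\beta(0)=1$. Energy space: $\mathcal H=L^2(\mathbb T)\times H^{-1/2}(\mathbb T)$ with inner product $\langle(h,u),(\varphi,\psi)\rangle_{\mathcal H}=\langle h,\varphi\rangle_{L^2}+\langle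 P_\beta u,\psi\rangle_{H^{1/2},H^{-1/2}}=2\pi\sum_k\widehat h(k)\overline{\widehat\varphi(k)}+2\pi\sum_kp_\beta(k)\widehat u(k)\overline{\widehat\psi(k)}$. Conservative operator: $\mathcal A(h,u)=(T_\beta u,-h_x)$ with domain $D(\mathcal A)=H^{1/2}(\mathbb T)\times L^2(\mathbb T)$ (equipped with the graph norm). *)

(* Defs.v *)
From HB Require Import structures.
From mathcomp Require Import all_boot all_order all_algebra.
From mathcomp Require Import complex ring.
From mathcomp Require Import all_classical all_reals all_analysis.
Set Implicit Arguments.
Unset Strict Implicit.
Unset Printing Implicit Defensive.
Import Order.TTheory GRing.Theory Num.Theory.
Import numFieldNormedType.Exports.
Local Open Scope classical_set_scope.
Local Open Scope ring_scope.

(* Functions on the torus R/(2 pi Z) are 2 pi-periodic functions on R, and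
   H^s(T) is realized inside the space D'(T) of periodic distributions, i.e.
   continuous linear functionals on the test space C^oo(T; C). *)

Section Smooth.
Variable R : realType.
Implicit Types (f g : R -> R) (phi psi : R -> R[i]^o).

Definition re_fun phi : R -> R := fun x => complex.Re (phi x).
Definition im_fun phi : R -> R := fun x => complex.Im (phi x).

Definition smooth_fun f := forall n x, derivable (derive1n n f) x 1.

Definition periodic_fun (V : Type) (f : R -> V) :=
  forall x, f (x + 2 * pi) = f x.

Definition smooth_periodic : {pred R -> R[i]^o} :=
  fun phi => `[< [/\ periodic_fun phi, smooth_fun (re_fun phi)
                   & smooth_fun (im_fun phi)] >].

Lemma derive1n_lin (a b : R) f g n : smooth_fun f -> smooth_fun g ->
  derive1n n (fun x => a * f x + b * g x) =
  (fun x => a * derive1n n f x + b * derive1n n g x).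
Proof.
move=> sf sg; elim: n => [//|n IH]; rewrite !derive1nS IH; apply/funext => x.
rewrite derive1E deriveD; last 2 first.
- exact: derivableM.
- exact: derivableM.
rewrite !deriveM//.
by rewrite !derive_cst !scaler0 !addr0 !derive1E.
Qed.

Lemma smooth_lin (a b : R) f g : smooth_fun f -> smooth_fun g ->
  smooth_fun (fun x => a * f x + b * g x).
Proof.
move=> sf sg n x; rewrite derive1n_lin//.
by apply: derivableD; apply: derivableM => //.
Qed.

Lemma smooth_derive1 f : smooth_fun f -> smooth_fun (derive1 f).
Proof. by move=> sf n x; rewrite -derive1Sn; exact: (sf n.+1 x). Qed.

Lemma periodic_derive1 f : periodic_fun f -> periodic_fun (derive1 f).
Proof.
move=> pf x; rewrite /derive1; apply: (congr1 (fun g : R -> R => lim (g @ 0^'))).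
by apply/funext => h; rewrite addrA !pf.
Qed.

Lemma smooth_cst (c : R) : smooth_fun (cst c).
Proof.
have H n : exists d : R, derive1n n (cst c) = cst d.
  elim: n => [|n [d IH]]; first by exists c.
  by exists 0; rewrite derive1nS IH; apply/funext => x; rewrite derive1_cst.
by move=> n x; have [d ->] := H n.
Qed.

Lemma Re_lin (a z w : R[i]) : complex.Re (a * z + w) =
  complex.Re a * complex.Re z - complex.Im a * complex.Im z + complex.Re w.
Proof. by case: a z w => [? ?] [? ?] [? ?]. Qed.

Lemma Im_lin (a z w : R[i]) : complex.Im (a * z + w) =
  complex.Re a * complex.Im z + complex.Im a * complex.Re z + complex.Im w.
Proof. by case: a z w => [? ?] [? ?] [? ?]. Qed.

Lemma smooth_periodic_submod : submod_closed smooth_periodic.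
Proof.
split.
  apply/asboolP; split=> //; exact: smooth_cst.
move=> a phi psi /asboolP[p1 r1 i1] /asboolP[p2 r2 i2]; apply/asboolP.
have hR : re_fun (a *: phi + psi) = fun x =>
    1 * (complex.Re a * re_fun phi x + - complex.Im a * im_fun phi x)
      + 1 * re_fun psi x.
  apply/funext => x; rewrite !mul1r mulNr /re_fun /im_fun.
  change (complex.Re (a * phi x + psi x) = complex.Re a * complex.Re (phi x)
    - complex.Im a * complex.Im (phi x) + complex.Re (psi x)).
  exact: Re_lin.
have hI : im_fun (a *: phi + psi) = fun x =>
    1 * (complex.Re a * im_fun phi x + complex.Im a * re_fun phi x)
      + 1 * im_fun psi x.
  apply/funext => x; rewrite !mul1r /re_fun /im_fun.
  change (complex.Im (a * phi x + psi x) = complex.Re a * complex.Im (phi x)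
    + complex.Im a * complex.Re (phi x) + complex.Im (psi x)).
  exact: Im_lin.
split.
- move=> x; change (a * phi (x + 2 * pi) + psi (x + 2 * pi)
                    = a * phi x + psi x).
  by rewrite p1 p2.
- by rewrite hR; apply: smooth_lin => //; exact: smooth_lin.
- by rewrite hI; apply: smooth_lin => //; exact: smooth_lin.
Qed.

HB.instance Definition _ :=
  GRing.isSubmodClosed.Build R[i] (R -> R[i]^o) smooth_periodic
    smooth_periodic_submod.

End Smooth.

Record test_fun (R : realType) := TestFun {
  test_val :> R -> R[i]^o ;
  test_valP : test_val \in @smooth_periodic R }.

HB.instance Definition _ (R : realType) := [isSub for @test_val R].
HB.instance Definition _ (R : realType) := [Choice of test_fun R by <:].
HB.instance Definition _ (R : realType) :=
  [SubChoice_isSubLmodule of test_fun R by <:].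

Section Derivative.
Variable R : realType.

Lemma derive_testP (phi : test_fun R) :
  (fun x => Complex (derive1 (re_fun phi) x) (derive1 (im_fun phi) x))
    \in @smooth_periodic R.
Proof.
have /asboolP[p r i] := test_valP phi; apply/asboolP; split.
- move=> x /=; rewrite !periodic_derive1// => y; first by rewrite /im_fun /= p.
  by rewrite /re_fun /= p.
- exact: smooth_derive1.
- exact: smooth_derive1.
Qed.

Definition derive_test (phi : test_fun R) : test_fun R :=
  TestFun (derive_testP phi).

Lemma derive1n_trig (w a b : R) n : exists c d : R,
  derive1n n (fun x => a * cos (w * x) + b * sin (w * x)) =
  (fun x => c * cos (w * x) + d * sin (w * x)).
Proof.
elim: n => [|n [c [d IH]]]; first by exists a, b.
exists (d * w), (- (c * w)); rewrite derive1nS IH; apply/funext => x.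
by rewrite derive1E; apply: derive_val; apply: is_derive_eq; rewrite /GRing.scale/=; ring.
Qed.

Lemma smooth_trig (w a b : R) :
  smooth_fun (fun x => a * cos (w * x) + b * sin (w * x)).
Proof.
move=> n x; have [c [d ->]] := derive1n_trig w a b n.
exact: ex_derive.
Qed.

Lemma trig_periodic (k : int) (x : R) :
  cos (k%:~R * (x + 2 * pi)) = cos (k%:~R * x) /\
  sin (k%:~R * (x + 2 * pi)) = sin (k%:~R * x).
Proof.
have P (n : nat) (y : R) :
    cos (y + n%:R * (2 * pi)) = cos y /\ sin (y + n%:R * (2 * pi)) = sin y.
  elim: n y => [|n IH] y; first by rewrite mul0r addr0.
  have [c s] := IH (y + 2 * pi).
  have -> : y + n.+1%:R * (2 * pi) = y + 2 * pi + n%:R * (2 * pi) :> R.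
    by rewrite -natr1; ring.
  by rewrite c s mulr_natl cosD2pi sinD2pi.
case: k => n.
  rewrite -pmulrn mulrDr; exact: P.
have [c s] := P n.+1 (- n.+1%:R * (x + 2 * pi)).
by rewrite NegzE mulrNz -pmulrn -c -s; split; congr (_ _); ring.
Qed.

Lemma expiP (k : int) :
  (fun x : R => Complex (cos (k%:~R * x)) (sin (k%:~R * x)))
    \in @smooth_periodic R.
Proof.
apply/asboolP; split.
- by move=> x; have [-> ->] := trig_periodic k x.
- have -> : re_fun (fun x : R => Complex (cos (k%:~R * x)) (sin (k%:~R * x)))
      = fun x => 1 * cos (k%:~R * x) + 0 * sin (k%:~R * x).
    by apply/funext => x; rewrite mul1r mul0r addr0.
  exact: smooth_trig.
- have -> : im_fun (fun x : R => Complex (cos (k%:~R * x)) (sin (k%:~R * x)))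
      = fun x => 0 * cos (k%:~R * x) + 1 * sin (k%:~R * x).
    by apply/funext => x; rewrite mul1r mul0r add0r.
  exact: smooth_trig.
Qed.

(* x |-> e^{ikx} *)
Definition expi (k : int) : test_fun R := TestFun (expiP k).

End Derivative.

Section Spaces.
Variable R : realType.

Definition functional := test_fun R -> R[i]^o.

Implicit Types (u v w : functional) (phi psi : test_fun R).

(* Periodic distributions: linear functionals on the test functions that are
   continuous for the Frechet topology given by the sup norms of derivatives. *)
Definition is_distr v := linear v /\
  exists (N : nat) (K : R), forall phi (M : R),
    (forall n x, (n <= N)%N ->
       Normc.normc (Complex (derive1n n (re_fun phi) x)
                            (derive1n n (im_fun phi) x)) <= M) ->
    Normc.normc (v phi) <= K * M.

(* For a function v this is (2 pi)^-1 \int_0^{2 pi} v(x) e^{-ikx} dx. *)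
Definition fcoef v (k : int) : R[i] := ((2 * pi)^-1)%:C%C * v (expi R (- k)).

Definition cintegral (D : set R) (f : R -> R[i]) : R[i] :=
  Complex (\int[lebesgue_measure]_(x in D) complex.Re (f x))
          (\int[lebesgue_measure]_(x in D) complex.Im (f x)).

Definition regular_distr (f : R -> R[i]) : functional :=
  fun phi => cintegral `[0, 2 * pi] (fun x => f x * phi x).

Definition square_integrable (f : R -> R[i]) :=
  [/\ measurable_fun `[0, 2 * pi] (fun x => complex.Re (f x)),
      measurable_fun `[0, 2 * pi] (fun x => complex.Im (f x)) &
      (\int[lebesgue_measure]_(x in `[0%R, (2 * pi)%R])
         (Normc.normc (f x) ^+ 2)%:E < +oo)%E].

(* An element of L^2(T), i.e. an a.e. class of functions, is identified with
   the regular distribution it defines. *)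
Definition L2T : set functional :=
  [set v | exists2 f, square_integrable f & v = regular_distr f].

(* The Japanese bracket (1 + k^2)^(1/2). *)
Definition jap (k : int) : R := Num.sqrt (1 + k%:~R ^+ 2).

Definition HsT (s : R) : set functional :=
  [set v | is_distr v /\
    (\esum_(k in [set: int])
       (jap k `^ (2 * s) * Normc.normc (fcoef v k) ^+ 2)%:E < +oo)%E].

(* The unique distribution whose k-th Fourier coefficient is m(k) v^(k). *)
Definition fourier_multiplier (m : int -> R[i]) v : functional :=
  xget 0 [set w | is_distr w /\ forall k, fcoef w k = m k * fcoef v k].

Definition distr_derive v : functional := fun phi => - v (derive_test phi).

(* Sums over Z of absolutely summable families. *)
Definition zsum (a : int -> R) : R :=
  fine (\esum_(k in [set: int]) (Num.max (a k) 0)%:E)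
  - fine (\esum_(k in [set: int]) (Num.max (- a k) 0)%:E).

Definition zsumc (a : int -> R[i]) : R[i] :=
  Complex (zsum (fun k => complex.Re (a k))) (zsum (fun k => complex.Im (a k))).

End Spaces.

Section Operator.
Variables (R : realType) (beta : R).

Definition state := (functional R * functional R)%type.

Implicit Types (Y Z W : state) (t : R).

Definition tanh (x : R) : R := (expR x - expR (- x)) / (expR x + expR (- x)).

Definition m_mult (k : int) : R := tanh (beta * k%:~R) / beta.

Definition p_mult (k : int) : R :=
  if k == 0 then 1 else tanh (beta * k%:~R) / (beta * k%:~R).

Definition T_op (u : functional R) : functional R :=
  fourier_multiplier (fun k => - 'i%C * (m_mult k)%:C%C) u.

Definition energy_space : set state :=
  [set Z | L2T Z.1 /\ HsT (- 2^-1) Z.2].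

(* <h, phi>_{L^2} + <P_beta u, psi>_{H^(1/2), H^(-1/2)} on the Fourier side,
   where P_beta is the multiplier of symbol p_mult. *)
Definition energy_ip Z W : R[i] :=
  (2 * pi)%:C%C * zsumc (fun k => fcoef Z.1 k * (fcoef W.1 k)^*%C)
  + (2 * pi)%:C%C *
    zsumc (fun k => (p_mult k)%:C%C * fcoef Z.2 k * (fcoef W.2 k)^*%C).

Definition energy_norm Z : R := Num.sqrt (complex.Re (energy_ip Z Z)).

Definition A_op Z : state := (T_op Z.2, - distr_derive Z.1).

Definition A_dom : set state := [set Z | HsT 2^-1 Z.1 /\ L2T Z.2].

Definition graph_norm Z : R := energy_norm Z + energy_norm (A_op Z).

Definition continuous_curve (X : set state) (nrm : state -> R) (Z : R -> state) :=
  (forall t, X (Z t)) /\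
  forall t0, nrm (Z t - Z t0) @[t --> t0] --> (0 : R).

Definition C_energy := continuous_curve energy_space energy_norm.

Definition C_dom := continuous_curve A_dom graph_norm.

Definition has_derivative (Z : R -> state) t W :=
  energy_space W /\
  energy_norm ((s^-1)%:C%C *: (Z (t + s) - Z t) - W) @[s --> 0^'] --> (0 : R).

Definition C1_energy (Z : R -> state) := (forall t, energy_space (Z t)) /\
  exists2 Z', C_energy Z' & forall t, has_derivative Z t (Z' t).

Record C0_group (S : R -> state -> state) : Prop := {
  C0_group_space : forall t Z, energy_space Z -> energy_space (S t Z) ;
  C0_group_linear : forall t (a : R[i]) Z W, energy_space Z -> energy_space W ->
    S t (a *: Z + W) = a *: S t Z + S t W ;
  C0_group_bounded : forall t, exists K : R, forall Z, energy_space Z ->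
    energy_norm (S t Z) <= K * energy_norm Z ;
  C0_group0 : forall Z, energy_space Z -> S 0 Z = Z ;
  C0_groupD : forall s t Z, energy_space Z -> S (s + t) Z = S s (S t Z) ;
  C0_group_continuous : forall Z, energy_space Z -> C_energy (fun t => S t Z) }.

Definition unitary_on_energy (U : state -> state) :=
  [/\ forall Z, energy_space Z -> energy_space (U Z),
      forall W, energy_space W -> exists2 Z, energy_space Z & U Z = W &
      forall Z W, energy_space Z -> energy_space W ->
        energy_ip (U Z) (U W) = energy_ip Z W].

(* A_op with domain A_dom is the generator of S: its domain is the set of Z
   such that (S t Z - Z) / t converges in the energy space as t -> 0, and its
   value at Z is the limit. *)
Definition generates (S : R -> state -> state) :=
  let generator_rel Z W := energy_space W /\
    energy_norm ((t^-1)%:C%C *: (S t Z - Z) - W) @[t --> 0^'] --> (0 : R) in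
  (forall Z, A_dom Z <->
     energy_space Z /\ exists W, generator_rel Z W) /\
  forall Z, A_dom Z -> generator_rel Z (A_op Z).

Definition oriented_cintegral (a b : R) (f : R -> R[i]) : R[i] :=
  if a <= b then cintegral `[a, b] f else - cintegral `[b, a] f.

(* W is the integral from a to b of the curve Z, an element of the energy
   space characterized by duality; for the continuous curves to which it is
   applied it is the Riemann (or Bochner) integral. *)
Definition is_curve_integral (a b : R) (Z : R -> state) W :=
  energy_space W /\
  forall X, energy_space X ->
    energy_ip W X = oriented_cintegral a b (fun s => energy_ip (Z s) X).

(* Z in C(R; H), and Z(t) = Z0 + A \int_0^t Z(s) ds for all t, where the
   integral belongs to the domain of A. *)
Definition mild_solution (Z0 : state) (Z : R -> state) :=
  C_energy Z /\
  forall t, exists W,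
    [/\ is_curve_integral 0 t Z W, A_dom W & Z t = Z0 + A_op W].

Definition classical_solution (Z0 : state) (Z : R -> state) :=
  [/\ C1_energy Z, forall t, A_dom (Z t),
      forall t, has_derivative Z t (A_op (Z t)) & Z 0 = Z0].

End Operator.

(* Main.v *)
Require Import Defs.
From mathcomp Require Import all_boot all_order all_algebra.
From mathcomp Require Import complex ring lra.
From mathcomp Require Import all_classical all_reals all_analysis.
From mathcomp Require Import measurable_realfun.
Import Order.TTheory GRing.Theory Num.Theory.
Import numFieldNormedType.Exports.
Local Open Scope classical_set_scope.
Local Open Scope ring_scope.
Set Implicit Arguments.
Unset Strict Implicit.

(** In Fourier coefficients the system splits into the modes
      h' = - i k p u,    u' = - i k h        (p = p_k, since m_k = k p_k),
    and each mode preserves |h|^2 + p |u|^2: it is a rotation with frequency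
    w = k sqrt p between h and - i sqrt p u (rot_h, rot_u, mode_energy_lin). The norm of the
    energy space is, up to 2 pi, the square root of the sum of these mode energies
    (normE), so the family of all the rotations acts on the energy space by unitary maps,
    which form the group (wave_group).

    Everything else is a statement about sums over the modes. The state S(t) Z - S(s) Z,
    its image under the operator, and the error of a difference quotient of the orbit all
    have in mode k the energy of Z in mode k multiplied by an
    explicit trigonometric factor. These factors tend to 0 for each k and are dominated by a
    constant or by a multiple of w_k^2, and Z belongs to the domain exactly when the
    sum of w_k^2 times its mode energies is finite (A_domP). Dominated convergence for sums
    (norm_cvg0_dominated) then gives strong continuity, differentiability of the orbits
    starting in the domain, and their continuity for the graph norm. Conversely, a
    derivative of an orbit at 0 has in mode k the coefficients of the image under the
    operator, so that image has finite energy and Z is in the domain (generator_dom).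

    For uniqueness, the coefficients of a state are inner products with fixed vectors
    (mode_vectors), so along a classical solution they are differentiable and solve the
    systems of the modes; along a mild solution they do so because its integrals
    have differentiable coefficients (mild_ode). The energy of the difference of two solutions
    of the same mode is constant (mode_ode_uniq). That the orbits are mild
    solutions is seen by writing Z as P + A V, where P is the zero mode of Z and
    V is in the domain; then S(t) Z = P + A S(t) V, and the integral of the orbit from 0
    to t is t P + S(t) V - V (wave_group_mild).

    Sequences of coefficients stand for distributions for the following reasons. A distribution is
    determined by its coefficients (distr_eq0), because the Fourier series of a test function
    converges to it with all its derivatives; pointwise convergence comes from
    a telescoping argument (fourier_pointwise) and uniform convergence from the decay of the
    coefficients. Square-summable sequences are the coefficients of square-integrable functions
    (riesz_fischer), and the sequences of the energy space in its second component
    are coefficients of a constant plus the derivative of such a function (distr_of_coef).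
    Finally, p_k is bounded above and below by multiples of (1 + k^2)^(-1/2)
    (p_mult_bounds), which identifies the weighted sums with the Sobolev norms
    that define the energy space and the domain. *)
Local Notation Re := complex.Re.
Local Notation Im := complex.Im.
Local Notation normc := Normc.normc.

(** * Sums over the integers *)

(** The windows {- K, ..., K - 1} exhaust the integers; they pair the constructors of
    int with the same argument, Negz j being - j - 1. *)
Definition winsum (V : nmodType) (a : int -> V) (K : nat) : V :=
  \sum_(j < K) (a (Posz j) + a (Negz j)).

Section Sums.
Variable R : realType.
Implicit Types a b : int -> R.

Lemma winsumS (V : nmodType) (a : int -> V) K :
  winsum a K.+1 = winsum a K + (a (Posz K) + a (Negz K)).
Proof. by rewrite /winsum big_ord_recr. Qed.

Lemma winsumD (V : nmodType) (a b : int -> V) K :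
  winsum (fun k => a k + b k) K = winsum a K + winsum b K.
Proof. by rewrite /winsum -big_split; apply: eq_bigr => i _; rewrite addrACA. Qed.

Lemma winsumB a b K : winsum (fun k => a k - b k) K = winsum a K - winsum b K.
Proof.
rewrite /winsum -sumrB; apply: eq_bigr => i _.
by rewrite opprD addrACA.
Qed.

Lemma winsumZ (A : pzRingType) (c : A) (a : int -> A) K :
  winsum (fun k => c * a k) K = c * winsum a K.
Proof. by rewrite /winsum mulr_sumr; apply: eq_bigr => i _; rewrite mulrDr. Qed.

Lemma winsum_ge0 a K : (forall k, 0 <= a k) -> 0 <= winsum a K.
Proof. by move=> a0; apply: sumr_ge0 => i _; rewrite addr_ge0. Qed.

Lemma le_winsum a b K : (forall k, a k <= b k) -> winsum a K <= winsum b K.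
Proof. by move=> ab; apply: ler_sum => i _; rewrite lerD. Qed.

Lemma winsum_nd a K L : (forall k, 0 <= a k) -> (K <= L)%N -> winsum a K <= winsum a L.
Proof.
move=> a0 /subnK <-; elim: (L - K)%N => [//|n IH].
by rewrite addSn winsumS (le_trans IH)// lerDl addr_ge0.
Qed.

Lemma winsum_tail a b K L : (forall k, a k <= b k) -> (K <= L)%N ->
  winsum a L - winsum a K <= winsum b L - winsum b K.
Proof.
move=> ab KL; have : winsum (fun k => b k - a k) K <= winsum (fun k => b k - a k) L.
  by apply: winsum_nd => // k; rewrite subr_ge0.
by rewrite !winsumB; lra.
Qed.

Lemma norm_winsum a K : `|winsum a K| <= winsum (fun k => `|a k|) K.
Proof.
apply: (le_trans (ler_norm_sum _ _ _)); apply: ler_sum => i _.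
exact: ler_normD.
Qed.

(** Bounded window sums of the absolute values are what estimates provide; esum_lty
    identifies the condition with the finiteness of the unordered sum. *)
Definition zsummable a := exists M, forall K, winsum (fun k => `|a k|) K <= M.

Lemma zsummable_le a b : (forall k, `|a k| <= b k) -> zsummable b -> zsummable a.
Proof.
move=> ab [M bM]; exists M => K; apply: (le_trans _ (bM K)).
by apply: le_winsum => k; rewrite (le_trans (ab k))// ler_norm.
Qed.

Lemma zsummableD a b : zsummable a -> zsummable b -> zsummable (fun k => a k + b k).
Proof.
move=> [M aM] [N bN]; exists (M + N) => K.
apply: (le_trans _ (lerD (aM K) (bN K))); rewrite -winsumD.
by apply: le_winsum => k; exact: ler_normD.
Qed.

Lemma zsummableZ c a : zsummable a -> zsummable (fun k => c * a k).
Proof.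
move=> [M aM]; exists (`|c| * M) => K.
have -> : (fun k => `|c * a k|) = (fun k => `|c| * `|a k|).
  by apply/funext => k; rewrite normrM.
by rewrite winsumZ ler_wpM2l.
Qed.

Lemma esum_int (a : int -> \bar R) : (forall k, (0 <= a k)%E) ->
  (\esum_(k in [set: int]) a k = \sum_(0 <= j <oo) (a (Posz j) + a (Negz j)))%E.
Proof.
move=> a0.
have inj1 : set_inj setT Posz by move=> x y _ _ [].
have inj2 : set_inj setT Negz by move=> x y _ _ [].
rewrite (esumID (range Posz))//.
rewrite !setTI.
have -> : ~` range Posz = range Negz.
  apply/seteqP; split => [[n|n]|[n|n]] /=.
  - by move=> H; exfalso; apply: H; exists n.
  - by move=> _; exists n.
  - by move=> [m].
  - by move=> _ [m].
rewrite !esum_image//.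
rewrite -!nneseries_esumT//.
by rewrite nneseriesD.
Qed.

Lemma esum_winsum a : (forall k, 0 <= a k) ->
  (fun K => (winsum a K)%:E) @ \oo --> (\esum_(k in [set: int]) (a k)%:E)%E.
Proof.
move=> a0; rewrite esum_int; last by move=> k; rewrite lee_fin.
have -> : (fun K => (winsum a K)%:E) = (fun n => \sum_(0 <= j < n) ((a (Posz j))%:E + (a (Negz j))%:E))%E.
  apply/funext => K; rewrite big_mkord -sumEFin.
  by apply: eq_bigr => i _; rewrite EFinD.
by apply: is_cvg_nneseries => n _; rewrite adde_ge0 ?lee_fin.
Qed.

Lemma esum_lty a : (forall k, 0 <= a k) ->
  (\esum_(k in [set: int]) (a k)%:E < +oo)%E <-> zsummable a.
Proof.
move=> a0; have aa : (fun k => `|a k|) = a by apply/funext => k; rewrite ger0_norm.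
split=> [|[M]].
  move=> lt; exists (fine (\esum_(k in [set: int]) (a k)%:E)) => K.
  rewrite aa -lee_fin fineK; last first.
    rewrite ge0_fin_numE//; apply: esum_ge0 => k _; by rewrite lee_fin.
  rewrite -(cvg_lim _ (esum_winsum a0))//.
  apply: lime_ge; first by apply/cvg_ex; eexists; exact: esum_winsum.
  by exists K => // L /= KL; rewrite lee_fin winsum_nd.
rewrite aa => aM; apply: (@le_lt_trans _ _ M%:E); last by rewrite ltry.
rewrite -(cvg_lim _ (esum_winsum a0))//.
apply: lime_le; first by apply/cvg_ex; eexists; exact: esum_winsum.
by apply: nearW => K; rewrite lee_fin.
Qed.

Lemma winsum_cvg_esum a : (forall k, 0 <= a k) -> zsummable a ->
  winsum a K @[K --> \oo] --> fine (\esum_(k in [set: int]) (a k)%:E)%E.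
Proof.
move=> a0 sa; have fi : (\esum_(k in [set: int]) (a k)%:E)%E \is a fin_num.
  rewrite ge0_fin_numE; first exact/esum_lty.
  by apply: esum_ge0 => k _; rewrite lee_fin.
by have := esum_winsum a0; rewrite -[X in _ --> X -> _](fineK fi) => /fine_cvg.
Qed.

(** The positive and the negative part of a summable family have finite sums, so
    their difference is the limit of the window sums. The rules for zsum below are the
    rules for limits. *)
Lemma zsum_cvg a : zsummable a -> winsum a K @[K --> \oo] --> zsum a.
Proof.
move=> sa.
have [p0 n0] : (forall k, 0 <= Num.max (a k) 0) /\ (forall k, 0 <= Num.max (- a k) 0).
  by split=> k; rewrite le_max lexx orbT.
have sp : zsummable (fun k => Num.max (a k) 0).
  have [M aM] := sa; apply: (@zsummable_le _ (fun k => `|a k|)); last first.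
    by exists M => K; under eq_fun do rewrite normr_id.
  by move=> k; rewrite ger0_norm// ge_max ler_norm normr_ge0.
have sn : zsummable (fun k => Num.max (- a k) 0).
  have [M aM] := sa; apply: (@zsummable_le _ (fun k => `|a k|)); last first.
    by exists M => K; under eq_fun do rewrite normr_id.
  by move=> k; rewrite ger0_norm// ge_max -normrN ler_norm normr_ge0.
have -> : winsum a = (fun K => winsum (fun k => Num.max (a k) 0) K - winsum (fun k => Num.max (- a k) 0) K).
  apply/funext => K; rewrite -winsumB; congr winsum; apply/funext => k.
  have [h|h] := leP 0 (a k).
    by rewrite max_r ?subr0// oppr_le0.
  by rewrite max_l ?opprK ?add0r// oppr_ge0 ltW.
by apply: cvgB; exact: winsum_cvg_esum.
Qed.

Lemma zsum_uniq a l : zsummable a -> winsum a K @[K --> \oo] --> l -> zsum a = l.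
Proof. by move=> sa al; exact: (cvg_unique _ (zsum_cvg sa) al). Qed.

Lemma zsumD a b : zsummable a -> zsummable b -> zsum (fun k => a k + b k) = zsum a + zsum b.
Proof.
move=> sa sb; apply: zsum_uniq; first exact: zsummableD.
under eq_fun do rewrite winsumD; by apply: cvgD; exact: zsum_cvg.
Qed.

Lemma zsumZ c a : zsummable a -> zsum (fun k => c * a k) = c * zsum a.
Proof.
move=> sa; apply: zsum_uniq; first exact: zsummableZ.
under eq_fun do rewrite winsumZ; by apply: cvgMr; exact: zsum_cvg.
Qed.

Lemma winsum_le_zsum a K : (forall k, 0 <= a k) -> zsummable a -> winsum a K <= zsum a.
Proof.
move=> a0 sa; apply: (ler_cvg_to (cvg_cst (winsum a K)) (zsum_cvg sa)).
by exists K => // L /= KL; exact: winsum_nd.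
Qed.

Lemma zsum_ge0 a : (forall k, 0 <= a k) -> zsummable a -> 0 <= zsum a.
Proof. by move=> a0 sa; apply: le_trans (winsum_le_zsum 0 a0 sa); exact: winsum_ge0. Qed.

Lemma norm_zsum a b : zsummable b -> (forall k, `|a k| <= b k) -> `|zsum a| <= zsum b.
Proof.
move=> sb ab; have sa := zsummable_le ab sb.
apply: (ler_cvg_to (cvg_norm (zsum_cvg sa)) (zsum_cvg sb)).
by apply: nearW => K; apply: (le_trans (norm_winsum _ _)); exact: le_winsum.
Qed.

(** Dominated convergence for the counting measure on the integers: outside a
    finite window the dominating family is small, inside there are finitely many terms. *)
Lemma zsum_dominated (T : Type) (F : set_system T) {FF : Filter F}
    (f : T -> int -> R) (g : int -> R) :
  (forall s k, 0 <= f s k) -> (forall s k, f s k <= g k) -> zsummable g ->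
  (forall k, f s k @[s --> F] --> (0 : R)) -> zsum (f s) @[s --> F] --> (0 : R).
Proof.
move=> f0 fg sg fc; apply/cvgrPdist_lt => e e0.
have sf s : zsummable (f s).
  by apply: zsummable_le sg => k; rewrite ger0_norm.
have [K KP] : exists K, zsum g - winsum g K < e / 2.
  have := zsum_cvg sg; move/cvgrPdist_lt => /(_ (e / 2)) -[|K _ KP]; first by rewrite divr_gt0.
  exists K; apply: le_lt_trans (KP K _) => //=; exact: ler_norm.
have pc : winsum (f s) K @[s --> F] --> (0 : R).
  elim: {KP} K => [|K IH].
    by under eq_fun do rewrite /winsum big_ord0; exact: cvg_cst.
  under eq_fun do rewrite winsumS.
  have := cvgD IH (cvgD (fc (Posz K)) (fc (Negz K))); rewrite !addr0; exact.
move/cvgrPdist_lt: pc => /(_ (e / 2)); rewrite divr_gt0// => /(_ isT).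
apply: filterS => s; rewrite !sub0r !normrN (ger0_norm (zsum_ge0 _ _))//.
rewrite ger0_norm; last exact: winsum_ge0.
move=> h; have : zsum (f s) - winsum (f s) K <= zsum g - winsum g K.
  apply: (ler_cvg_to (cvgB (zsum_cvg (sf s)) (cvg_cst _)) (cvgB (zsum_cvg sg) (cvg_cst _))).
  by exists K => // L /= KL; exact: winsum_tail.
by move: KP h; lra.
Qed.

End Sums.

(** * Square-integrable functions *)
Section SquareIntegrable.
Context d (T : measurableType d) (R : realType).
Variables (mu : {measure set T -> \bar R}) (D : set T).
Hypotheses (mD : measurable D) (fD : (mu D < +oo)%E).

Implicit Types f g : T -> R.

Lemma EFin_Rintegral f : mu.-integrable D (EFin \o f) ->
  (\int[mu]_(t in D) (f t)%:E = (\int[mu]_(t in D) f t)%:E)%E.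
Proof.
move=> fi; rewrite /Rintegral fineK; first by [].
exact: (integrable_fin_num mD fi).
Qed.

Lemma integrable_bound (M : R) : mu.-integrable D (EFin \o cst M).
Proof.
apply: (measurable_bounded_integrable mD fD); first exact: measurable_cst.
by exists `|M|; split=> [|N MN]; rewrite ?num_real// => t _ /=; exact: ltW.
Qed.

Lemma integrable_le (f g : T -> R) : measurable_fun D f ->
  (forall t, D t -> `|f t| <= g t) -> mu.-integrable D (EFin \o g) ->
  mu.-integrable D (EFin \o f).
Proof.
move=> mf fg ig; apply: le_integrable ig => //; first exact/measurable_EFinP.
move=> t Dt /=; rewrite lee_fin; apply: (le_trans (fg t Dt)); exact: ler_norm.
Qed.

Definition Lsq (f : T -> R) :=
  measurable_fun D f /\ (\int[mu]_(t in D) (f t ^+ 2)%:E < +oo)%E.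

Lemma Lsq_sqr f : Lsq f -> mu.-integrable D (EFin \o (fun t => f t ^+ 2)).
Proof.
move=> [mf lf]; apply/integrableP; split.
  by apply/measurable_EFinP; exact: measurable_funX.
by under eq_integral do rewrite /= ger0_norm ?sqr_ge0//.
Qed.

Lemma sqr_Lsq f : measurable_fun D f ->
  mu.-integrable D (EFin \o (fun t => f t ^+ 2)) -> Lsq f.
Proof.
move=> mf /integrableP[_]; split=> //; apply: le_lt_trans b.
by apply: ge0_le_integral => //=; [move=> t _; rewrite lee_fin sqr_ge0
  |apply/measurable_EFinP; exact: measurable_funX
  |apply/measurable_EFinP; apply: measurableT_comp => //; exact: measurable_funX
  |move=> t _; rewrite lee_fin ler_norm].
Qed.

Lemma LsqM_integrable f g : Lsq f -> Lsq g ->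
  mu.-integrable D (EFin \o (fun t => f t * g t)).
Proof.
move=> lf lg; apply: (@integrable_le _ (fun t => f t ^+ 2 + g t ^+ 2)).
- by apply: measurable_funM; [case: lf|case: lg].
- move=> t _; rewrite ler_norml; apply/andP; split.
  + by have := sqr_ge0 (f t + g t); have := sqr_ge0 (f t); have := sqr_ge0 (g t); rewrite sqrrD; nra.
  + by have := sqr_ge0 (f t - g t); have := sqr_ge0 (f t); have := sqr_ge0 (g t); rewrite sqrrB; nra.
- by have := integrableD mD (Lsq_sqr lf) (Lsq_sqr lg).
Qed.

(** The multipliers against which limits in mean square are tested below. *)
Definition bounded_meas (f : T -> R) :=
  measurable_fun D f /\ exists M, forall t, D t -> `|f t| <= M.

Lemma bounded_meas_integrable f : bounded_meas f -> mu.-integrable D (EFin \o f).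
Proof. by move=> [mf [M fM]]; exact: integrable_le mf fM (integrable_bound M). Qed.

Lemma bounded_measD f g : bounded_meas f -> bounded_meas g -> bounded_meas (fun t => f t + g t).
Proof.
move=> [mf [M fM]] [mg [N gN]]; split; first exact: measurable_funD.
exists (M + N) => t Dt; apply: (le_trans (ler_normD _ _)).
by rewrite lerD ?fM ?gN.
Qed.

Lemma bounded_measM f g : bounded_meas f -> bounded_meas g -> bounded_meas (fun t => f t * g t).
Proof.
move=> [mf [M fM]] [mg [N gN]]; split; first exact: measurable_funM.
by exists (M * N) => t Dt; rewrite normrM ler_pM ?fM ?gN.
Qed.

Lemma bounded_meas_cst (c : R) : bounded_meas (cst c).
Proof. by split; [exact: measurable_cst|exists `|c|]. Qed.

Lemma bounded_measZ c f : bounded_meas f -> bounded_meas (fun t => c * f t).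
Proof. by move=> bf; apply: bounded_measM => //; exact: bounded_meas_cst. Qed.

Lemma bounded_measN f : bounded_meas f -> bounded_meas (fun t => - f t).
Proof. by move=> /(bounded_measZ (-1)); under eq_fun do rewrite mulN1r. Qed.

Lemma bounded_meas_Lsq f : bounded_meas f -> Lsq f.
Proof.
move=> bf; apply: sqr_Lsq; first by case: bf.
by apply: bounded_meas_integrable; under eq_fun do rewrite expr2; exact: bounded_measM.
Qed.

Lemma Lsq_integrable f : Lsq f -> mu.-integrable D (EFin \o f).
Proof.
move=> lf; have := LsqM_integrable lf (bounded_meas_Lsq (bounded_meas_cst 1)).
by under eq_fun do rewrite mulr1.
Qed.

(** Completeness, for rapidly Cauchy sequences. By |u| <= (2^n u^2 + 2^-n) / 2 the
    integral of the absolute value of the n-th increment is at most a multiple of 2^-n, hence the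
    sum G of the absolute increments is integrable. The sequence converges where G is finite,
    dominated by |x_0| + G; the limit is square integrable by Fatou's lemma, and
    integrals against bounded functions converge by dominated convergence. *)
Lemma Lsq_complete (x_ : nat -> T -> R) M :
  (forall n, Lsq (x_ n)) ->
  (forall n, \int[mu]_(t in D) (x_ n.+1 t - x_ n t) ^+ 2 <= 4^-1 ^+ n) ->
  (forall n, \int[mu]_(t in D) (x_ n t) ^+ 2 <= M) ->
  exists2 f, Lsq f & forall g, bounded_meas g ->
    \int[mu]_(t in D) (x_ n t * g t) @[n --> \oo] --> \int[mu]_(t in D) (f t * g t).
Proof.
move=> lx dx xM.
have mx n : measurable_fun D (x_ n) by case: (lx n).
pose y n t := `|x_ n.+1 t - x_ n t|.
have ly n : Lsq (fun t => x_ n.+1 t - x_ n t).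
  apply: sqr_Lsq; first exact: measurable_funB.
  apply: (@integrable_le _ (fun t => 2 * (x_ n.+1 t ^+ 2 + x_ n t ^+ 2))).
  - by apply: measurable_funX; exact: measurable_funB.
  - move=> t _; rewrite ger0_norm ?sqr_ge0//.
    by have := sqr_ge0 (x_ n.+1 t + x_ n t); rewrite sqrrD sqrrB; nra.
  - have := integrableZl mD 2 (integrableD mD (Lsq_sqr (lx n.+1)) (Lsq_sqr (lx n))).
    exact.
have iy n : mu.-integrable D (EFin \o y n).
  by apply: (@integrable_norm _ _ _ mu D (fun t => x_ n.+1 t - x_ n t)); exact: Lsq_integrable.
have my n : measurable_fun D (fun t => (y n t)%:E) by case/integrableP : (iy n).
pose C := (1 + fine (mu D)) / 2.
have C0 : 0 <= C by rewrite divr_ge0// addr_ge0// fine_ge0.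
have yC n : (\int[mu]_(t in D) (y n t)%:E <= (C * 2^-1 ^+ n)%:E)%E.
  rewrite EFin_Rintegral// lee_fin.
  pose h t := 2^-1 * 2 ^+ n * (x_ n.+1 t - x_ n t) ^+ 2 + 2^-1 * 2^-1 ^+ n.
  have i1 : mu.-integrable D (EFin \o (fun t => 2^-1 * 2 ^+ n * (x_ n.+1 t - x_ n t) ^+ 2)).
    by have := integrableZl mD (2^-1 * 2 ^+ n) (Lsq_sqr (ly n)).
  have i2 := integrable_bound (2^-1 * 2^-1 ^+ n).
  have ih : mu.-integrable D (EFin \o h) by have := integrableD mD i1 i2.
  apply: (@le_trans _ _ (\int[mu]_(t in D) h t)).
    apply: le_Rintegral => // t Dt; rewrite /h /y.
    set u := x_ n.+1 t - x_ n t.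
    have p0 : 0 < 2 ^+ n :> R by rewrite exprn_gt0.
    rewrite -[u ^+ 2]real_normK ?num_real// exprVn.
    have := sqr_ge0 (2 ^+ n * `|u| - 1); set v := `|u|; set a := 2 ^+ n in p0 *.
    move=> q; rewrite -(ler_pM2l p0).
    have -> : a * (2^-1 * a * v ^+ 2 + 2^-1 * a^-1) = 2^-1 * (a * v) ^+ 2 + 2^-1.
      by field; rewrite gt_eqF.
    by move: q; rewrite sqrrB mulr1 expr1n; lra.
  rewrite /h RintegralD// RintegralZl//; last exact: Lsq_sqr.
  rewrite Rintegral_cst//.
  have p0 : 0 < 2 ^+ n :> R by rewrite exprn_gt0.
  have h1 := ler_wpM2l (ltW p0) (dx n).
  have e4 : (2 : R) ^+ n * 4^-1 ^+ n = 2^-1 ^+ n.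
    by rewrite -exprMn; congr (_ ^+ _); field.
  rewrite e4 in h1; rewrite /C; move: h1.
  set I := Rintegral _ _ _; set a := 2 ^+ n; set b := 2^-1 ^+ n; set m := fine _.
  by lra.
pose G t := (\sum_(0 <= n <oo) (y n t)%:E)%E.
have y0 n t : (0 <= (y n t)%:E)%E by rewrite lee_fin normr_ge0.
have G0 t : (0 <= G t)%E by apply: nneseries_ge0.
have mG : measurable_fun D G.
  by apply: ge0_emeasurable_sum => [n t _ _|n _]; [exact: y0|exact: my].
have iG : mu.-integrable D G.
  apply/integrableP; split=> //.
  under eq_integral do rewrite gee0_abs//.
  rewrite integral_nneseries//.
  apply: (@le_lt_trans _ _ (2 * C)%:E); last by rewrite ltry.
  apply: lime_le; first by apply: is_cvg_nneseries => n _ _; apply: integral_ge0.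
  apply: nearW => N.
  apply: (@le_trans _ _ (2 * C - 2 * C * 2^-1 ^+ N)%:E); last first.
    by rewrite lee_fin lerBlDr lerDl !mulr_ge0.
  elim: N => [|N IH]; first by rewrite big_geq// expr0 mulr1 subrr.
  rewrite big_nat_recr//=; apply: (le_trans (leeD IH (yC N))).
  by rewrite -EFinD lee_fin exprS; lra.
have tel t N : x_ N t = x_ 0%N t + \sum_(0 <= n < N) (x_ n.+1 t - x_ n t).
  by rewrite telescope_sumr// addrC subrK.
have part t N : ((\sum_(0 <= n < N) y n t)%:E <= G t)%E.
  rewrite -sumEFin; by apply: nneseries_lim_ge => n _ _; exact: y0.
have xG t N : (`|(x_ N t)%:E| <= `|x_ 0%N t|%:E + G t)%E.
  rewrite tel /=; apply: (@le_trans _ _ (`|x_ 0%N t| + \sum_(0 <= n < N) y n t)%:E).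
    rewrite lee_fin; apply: (le_trans (ler_normD _ _)); rewrite lerD2l.
    exact: ler_norm_sum.
  by rewrite EFinD leeD2l.
pose f t := fine (limn_esup (fun n => (x_ n t)%:E)).
have mf : measurable_fun D f.
  have -> : f = fine \o (fun t => limn_esup (fun n => (x_ n t)%:E)) by [].
  apply: measurableT_comp => //.
  by apply: measurable_fun_limn_esup => n; exact/measurable_EFinP.
have cf t : G t \is a fin_num -> (x_ n t) @[n --> \oo] --> f t.
  move=> Gf.
  have cs : cvgn (series (fun n => x_ n.+1 t - x_ n t : R^o)).
    apply: normed_cvg; apply: nondecreasing_is_cvgn.
      apply/nondecreasing_seqP => n; rewrite /normed_series_of [leRHS]big_nat_recr//= lerDl//.
    exists (fine (G t)) => _ [N _ <-]; rewrite -lee_fin fineK//.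
    exact: part.
  have cx : cvgn (fun n => x_ n t).
    have -> : (fun n => x_ n t) = (fun n => x_ 0%N t + series (fun n => x_ n.+1 t - x_ n t : R^o) n).
      by apply/funext => n; rewrite /series/= -tel.
    by apply: is_cvgD => //; exact: is_cvg_cst.
  have ce : (x_ n t)%:E @[n --> \oo] --> (limn (fun n => x_ n t))%:E.
    by apply: cvg_EFin => //; exact: nearW.
  by rewrite /f (cvg_limn_einf_sup ce).2.
have aeG : {ae mu, forall t, D t -> G t \is a fin_num} by exact: integrable_ae.
have ix0 := integrable_norm (Lsq_integrable (lx 0%N)).
have dom := integrableD mD ix0 iG.
have lf : Lsq f.
  split=> //.
  have c2 t : G t \is a fin_num -> (x_ n t ^+ 2)%:E @[n --> \oo] --> (f t ^+ 2)%:E.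
    move=> Gf; apply: cvg_EFin; first exact: nearW.
    by rewrite expr2; exact: (cvgM (cf t Gf) (cf t Gf)).
  have mx2 n : measurable_fun D (fun t => (x_ n t ^+ 2)%:E).
    by apply/measurable_EFinP; exact: measurable_funX.
  have F := @fatou _ _ _ mu D mD (fun n t => (x_ n t ^+ 2)%:E) mx2
    (fun n t _ => ltac:(rewrite lee_fin; exact: sqr_ge0)).
  have E : (\int[mu]_(t in D) (f t ^+ 2)%:E
       = \int[mu]_(t in D) limn_einf (fun n => (x_ n t ^+ 2)%:E))%E.
    apply: ae_eq_integral => //.
    - by apply/measurable_EFinP; exact: measurable_funX.
    - have -> : (fun t => limn_einf (fun n => (x_ n t ^+ 2)%:E))
          = (fun t => - limn_esup (fun n => - (x_ n t ^+ 2)%:E))%E.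
        apply/funext => t; rewrite -[LHS]oppeK; congr (- _)%E.
        by rewrite -limn_esupN.
      apply: measurableT_comp => //; apply: measurable_fun_limn_esup => n.
      exact: measurableT_comp.
    - apply: filterS aeG => t Gt Dt.
      by rewrite (cvg_limn_einf_sup (c2 t (Gt Dt))).1.
  rewrite E; apply: (le_lt_trans F).
  apply: (@le_lt_trans _ _ M%:E); last by rewrite ltry.
  rewrite limn_einf_lim; apply: lime_le; first exact: is_cvg_einfs.
  apply: nearW => n; apply: (@le_trans _ _ (\int[mu]_(t in D) (x_ n t ^+ 2)%:E)%E).
    by apply: ereal_inf_lbound; exists n => //=.
  by rewrite EFin_Rintegral ?lee_fin//; exact: Lsq_sqr.
exists f => // g [mg [N gN]].
have bg : bounded_meas g by split=> //; exists N.
have N0 : 0 <= Num.max N 0 by rewrite le_max lexx orbT.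
have lg := bounded_meas_Lsq bg.
have m1 n : measurable_fun D (fun t => (x_ n t * g t)%:E).
  by apply/measurable_EFinP; exact: measurable_funM.
have m2 : measurable_fun D (fun t => (f t * g t)%:E).
  by apply/measurable_EFinP; exact: measurable_funM.
have ae1 : {ae mu, forall t, D t -> (x_ n t * g t)%:E @[n --> \oo] --> (f t * g t)%:E}.
  apply: filterS aeG => t Gt Dt; apply: cvg_EFin; first exact: nearW.
  exact: (cvgM (cf t (Gt Dt)) (cvg_cst (g t))).
have idom := integrableZl mD (Num.max N 0) dom.
have ae2 : {ae mu, forall t n, D t ->
    (`|(x_ n t * g t)%:E| <= (Num.max N 0)%:E * (`|x_ 0%N t|%:E + G t))%E}.
  apply: aeW => t n Dt; rewrite EFinM abseM muleC; apply: lee_pmul => //.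
  by rewrite lee_fin (le_trans (gN t Dt))// le_max lexx.
have [_ _] := dominated_convergence mD m1 m2 ae1 idom ae2.
rewrite /= EFin_Rintegral; last exact: LsqM_integrable.
under eq_fun do rewrite EFin_Rintegral ?LsqM_integrable//.
exact: fine_cvg.
Qed.

End SquareIntegrable.

(** * Complex-valued functions on a period *)
Lemma complex_ext (R : realType) (z w : R[i]) : Re z = Re w -> Im z = Im w -> z = w.
Proof. by case: z w => [? ?] [? ?] /= -> ->. Qed.

Section RealParts.
Variable R : realType.
Implicit Types (z w : R[i]) (a : R).

Lemma cReD z w : Re (z + w) = Re z + Re w. Proof. by case: z w => [? ?] []. Qed.
Lemma cImD z w : Im (z + w) = Im z + Im w. Proof. by case: z w => [? ?] []. Qed.
Lemma cReN z : Re (- z) = - Re z. Proof. by case: z. Qed.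
Lemma cImN z : Im (- z) = - Im z. Proof. by case: z. Qed.
Lemma cReM z w : Re (z * w) = Re z * Re w - Im z * Im w.
Proof. by case: z w => [? ?] []. Qed.
Lemma cImM z w : Im (z * w) = Re z * Im w + Im z * Re w.
Proof. by case: z w => [? ?] []. Qed.
Lemma cReJ z : Re (z^*%C) = Re z. Proof. by case: z. Qed.
Lemma cImJ z : Im (z^*%C) = - Im z. Proof. by case: z. Qed.
Lemma cRe_real a : Re (a%:C%C) = a. Proof. by []. Qed.
Lemma cIm_real a : Im (a%:C%C) = 0. Proof. by []. Qed.

Lemma cRe_scale a z : Re (a%:C%C * z) = a * Re z.
Proof. by rewrite cReM /= mul0r subr0. Qed.
Lemma cIm_scale a z : Im (a%:C%C * z) = a * Im z.
Proof. by rewrite cImM /= mul0r addr0. Qed.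
Lemma cRe_imag a z : Re (Complex 0 (- a) * z) = a * Im z.
Proof. by rewrite cReM /=; ring. Qed.
Lemma cIm_imag a z : Im (Complex 0 (- a) * z) = - a * Re z.
Proof. by rewrite cImM /=; ring. Qed.

End RealParts.

(** Identities between complex expressions are checked on real and imaginary parts,
    where they are identities in a real field. *)
Definition cpartE := (@cReD, @cImD, @cReN, @cImN, @cReM, @cImM, @cReJ, @cImJ).

Section SquaredModulus.
Variable R : realType.
Implicit Types z w : R[i].

(** The squared modulus without square roots, so that ring decides identities. *)
Definition normc2 z : R := Re z ^+ 2 + Im z ^+ 2.

Lemma normc2_ge0 z : 0 <= normc2 z.
Proof. by rewrite addr_ge0 ?sqr_ge0. Qed.

Lemma normc_sqr z : normc z ^+ 2 = normc2 z.
Proof. by case: z => a b; rewrite sqr_sqrtr// addr_ge0 ?sqr_ge0. Qed.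

Lemma normc_ge0 z : 0 <= normc z.
Proof. by case: z => a b; exact: sqrtr_ge0. Qed.

Lemma normcE z : normc z = Num.sqrt (normc2 z).
Proof. by case: z. Qed.

Lemma normc2M z w : normc2 (z * w) = normc2 z * normc2 w.
Proof. by rewrite /normc2 !cpartE; ring. Qed.

Lemma normc2N z : normc2 (- z) = normc2 z.
Proof. by rewrite /normc2 !cpartE; ring. Qed.

Lemma normc2J z : normc2 (z^*%C) = normc2 z.
Proof. by rewrite /normc2 !cpartE; ring. Qed.

Lemma normc2_real (a : R) : normc2 a%:C%C = a ^+ 2.
Proof. by rewrite /normc2 /= expr0n/= addr0. Qed.

Lemma normc2_imag (a : R) : normc2 (Complex 0 a) = a ^+ 2.
Proof. by rewrite /normc2 /= expr0n add0r. Qed.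
Lemma normc20 : normc2 0 = 0.
Proof. by rewrite /normc2 /= expr0n/= addr0. Qed.

Lemma normc2D_le z w : normc2 (z + w) <= 2 * (normc2 z + normc2 w).
Proof.
rewrite /normc2 !cpartE.
have := sqr_ge0 (Re z - Re w); have := sqr_ge0 (Im z - Im w).
by rewrite !sqrrB !sqrrD; lra.
Qed.

Lemma normc2B_le z w : normc2 (z - w) <= 2 * (normc2 z + normc2 w).
Proof. by have := normc2D_le z (- w); rewrite normc2N. Qed.

Lemma normc2_eq0 z : normc2 z = 0 -> z = 0.
Proof.
move=> h; apply: Normc.eq0_normc; rewrite normcE h; exact: sqrtr0.
Qed.

Lemma normcD z w : normc (z + w) <= normc z + normc w.
Proof. exact: (@le_normcD R z w). Qed.

Lemma Re_le_normc z : `|Re z| <= normc z.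
Proof.
by rewrite normcE -sqrtr_sqr ler_wsqrtr// lerDl sqr_ge0.
Qed.

Lemma Im_le_normc z : `|Im z| <= normc z.
Proof.
by rewrite normcE -sqrtr_sqr ler_wsqrtr// lerDr sqr_ge0.
Qed.

Lemma normc_le z : normc z <= `|Re z| + `|Im z|.
Proof.
rewrite normcE -[leRHS]ger0_norm ?addr_ge0// -sqrtr_sqr ler_wsqrtr//.
rewrite sqrrD !real_normK ?num_real// /normc2 addrAC lerDl mulrn_wge0//.
Qed.

Lemma RefD (T : Type) (f g : T -> R[i]) :
  (fun x => Re (f x + g x)) = (fun x => Re (f x) + Re (g x)).
Proof. by apply/funext => x; exact: cReD. Qed.

Lemma ImfD (T : Type) (f g : T -> R[i]) :
  (fun x => Im (f x + g x)) = (fun x => Im (f x) + Im (g x)).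
Proof. by apply/funext => x; exact: cImD. Qed.

Lemma RefM (T : Type) (f g : T -> R[i]) :
  (fun x => Re (f x * g x)) = (fun x => Re (f x) * Re (g x) - Im (f x) * Im (g x)).
Proof. by apply/funext => x; exact: cReM. Qed.

Lemma ImfM (T : Type) (f g : T -> R[i]) :
  (fun x => Im (f x * g x)) = (fun x => Re (f x) * Im (g x) + Im (f x) * Re (g x)).
Proof. by apply/funext => x; exact: cImM. Qed.

Lemma RefJ (T : Type) (f : T -> R[i]) :
  (fun x => Re ((f x)^*)%C) = (fun x => Re (f x)).
Proof. by apply/funext => x; exact: cReJ. Qed.

Lemma ImfJ (T : Type) (f : T -> R[i]) :
  (fun x => Im ((f x)^*)%C) = (fun x => - Im (f x)).
Proof. by apply/funext => x; exact: cImJ. Qed.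

Lemma Re_winsum (a : int -> R[i]) K : Re (winsum a K) = winsum (fun k => Re (a k)) K.
Proof.
elim: K => [|K IH]; first by rewrite /winsum !big_ord0.
by rewrite !winsumS !cReD IH.
Qed.

Lemma conj_winsum (a : int -> R[i]) K :
  ((winsum a K)^*)%C = winsum (fun k => ((a k)^*)%C) K.
Proof.
elim: K => [|K IH]; first by rewrite /winsum !big_ord0 conjc0.
by rewrite !winsumS !rmorphD /= IH.
Qed.

End SquaredModulus.

Lemma winsum_fun0 (V : nmodType) T (f : int -> T -> V) :
  (fun x => winsum (f^~ x) 0) = cst 0.
Proof. by apply/funext => x; rewrite /winsum big_ord0. Qed.

Lemma winsum_funS (V : nmodType) T (f : int -> T -> V) K :
  (fun x => winsum (f^~ x) K.+1) =
  (fun x => winsum (f^~ x) K + (f (Posz K) x + f (Negz K) x)).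
Proof. by apply/funext => x; rewrite winsumS. Qed.

Section ComplexIntegral.
Variable R : realType.
Implicit Types f g : R -> R[i].

Local Notation D := (`[0, 2 * (pi : R)]%classic).
Local Notation mu := (@lebesgue_measure R).
Local Notation cint := (cintegral D).

Lemma measurable_period : measurable (D : set (measurableTypeR R)).
Proof. exact: measurable_itv. Qed.

Lemma twopi_gt0 : 0 < 2 * pi :> R.
Proof. by rewrite mulr_gt0// pi_gt0. Qed.

Lemma measure_period : mu D = (2 * pi)%:E.
Proof. by rewrite lebesgue_measure_itv/= lte_fin twopi_gt0 oppr0 adde0. Qed.

Lemma measure_period_lty : (mu D < +oo)%E.
Proof. by rewrite measure_period ltry. Qed.

Let mD := measurable_period.
Let fD := measure_period_lty.

Definition cintegrable f :=
  mu.-integrable D (EFin \o (fun x => Re (f x))) /\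
  mu.-integrable D (EFin \o (fun x => Im (f x))).

Definition cLsq f := Lsq mu D (fun x => Re (f x)) /\ Lsq mu D (fun x => Im (f x)).

Definition cbounded_meas f :=
  bounded_meas D (fun x => Re (f x)) /\ bounded_meas D (fun x => Im (f x)).

Lemma integrable_addf (f1 f2 : R -> R) : mu.-integrable D (EFin \o f1) ->
  mu.-integrable D (EFin \o f2) -> mu.-integrable D (EFin \o (fun x => f1 x + f2 x)).
Proof. by move=> h1 h2; have := integrableD mD h1 h2. Qed.

Lemma integrable_scalef (c : R) (f1 : R -> R) : mu.-integrable D (EFin \o f1) ->
  mu.-integrable D (EFin \o (fun x => c * f1 x)).
Proof. by move=> h1; have := integrableZl mD c h1. Qed.

Lemma integrable_subf (f1 f2 : R -> R) : mu.-integrable D (EFin \o f1) ->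
  mu.-integrable D (EFin \o f2) -> mu.-integrable D (EFin \o (fun x => f1 x - f2 x)).
Proof. by move=> h1 h2; have := integrableB mD h1 h2. Qed.

Lemma cintegrableD f g : cintegrable f -> cintegrable g ->
  cintegrable (fun x => f x + g x).
Proof.
move=> [rf jf] [rg jg]; split.
  by rewrite RefD; exact: integrable_addf.
by rewrite ImfD; exact: integrable_addf.
Qed.

Lemma cintegrableZ c f : cintegrable f -> cintegrable (fun x => c * f x).
Proof.
move=> [rf jf]; split.
  by rewrite (RefM (cst c)); apply: integrable_subf; exact: integrable_scalef.
rewrite (ImfM (cst c)); apply: integrable_addf; exact: integrable_scalef.
Qed.

Lemma cintegrable_winsum (f : int -> R -> R[i]) K : (forall k, cintegrable (f k)) ->
  cintegrable (fun x => winsum (f^~ x) K).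
Proof.
move=> fi; elim: K => [|K IH].
  rewrite winsum_fun0.
  by split; exact: (integrable_bound mD fD 0).
rewrite winsum_funS; apply: cintegrableD => //.
exact: cintegrableD.
Qed.

Lemma cintD f g : cintegrable f -> cintegrable g ->
  cint (fun x => f x + g x) = cint f + cint g.
Proof.
move=> [rf jf] [rg jg]; apply: complex_ext; rewrite ?cReD ?cImD /=.
  by rewrite RefD RintegralD.
by rewrite ImfD RintegralD.
Qed.

Lemma cintZ c f : cintegrable f -> cint (fun x => c * f x) = c * cint f.
Proof.
move=> [rf jf]; apply: complex_ext; rewrite ?cReM ?cImM /=.
  by rewrite (RefM (cst c)) /= RintegralB ?RintegralZl//; exact: integrable_scalef.
rewrite (ImfM (cst c)) /=.
by rewrite RintegralD ?RintegralZl//; exact: integrable_scalef.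
Qed.

Lemma cint_winsum (f : int -> R -> R[i]) K : (forall k, cintegrable (f k)) ->
  cint (fun x => winsum (f^~ x) K) = winsum (fun k => cint (f k)) K.
Proof.
move=> fi; elim: K => [|K IH].
  rewrite winsum_fun0 /winsum big_ord0.
  by apply: complex_ext; rewrite /= Rintegral_cst// mul0r.
have fK : cintegrable (fun x => winsum (f^~ x) K) by exact: cintegrable_winsum.
rewrite winsum_funS.
rewrite [RHS]winsumS cintD//; last exact: cintegrableD.
by rewrite cintD// IH.
Qed.

Lemma cLsqM f g : cLsq f -> cLsq g -> cintegrable (fun x => f x * g x).
Proof.
move=> [rf jf] [rg jg]; split.
  by rewrite RefM; apply: integrable_subf; exact: LsqM_integrable.
rewrite ImfM; apply: integrable_addf; exact: LsqM_integrable.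
Qed.

Lemma cbounded_meas_cLsq f : cbounded_meas f -> cLsq f.
Proof. by move=> [rf jf]; split; exact: bounded_meas_Lsq. Qed.

Lemma cbounded_measD f g : cbounded_meas f -> cbounded_meas g -> cbounded_meas (fun x => f x + g x).
Proof.
move=> [rf jf] [rg jg]; split.
  by rewrite RefD; exact: bounded_measD.
by rewrite ImfD; exact: bounded_measD.
Qed.

Lemma cbounded_measM f g : cbounded_meas f -> cbounded_meas g -> cbounded_meas (fun x => f x * g x).
Proof.
move=> [rf jf] [rg jg]; split.
  rewrite RefM; apply: bounded_measD; first exact: bounded_measM.
  by apply: bounded_measN; exact: bounded_measM.
rewrite ImfM; apply: bounded_measD; exact: bounded_measM.
Qed.

Lemma cbounded_meas_cst c : cbounded_meas (cst c).
Proof. by split; exact: bounded_meas_cst. Qed.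

Lemma cbounded_measJ f : cbounded_meas f -> cbounded_meas (fun x => ((f x)^*)%C).
Proof.
move=> [rf jf]; split; first by rewrite RefJ.
by rewrite ImfJ; exact: bounded_measN.
Qed.

Lemma cbounded_meas_integrable f : cbounded_meas f -> cintegrable f.
Proof. by move=> [rf jf]; split; exact: bounded_meas_integrable. Qed.

Lemma cLsqJ f : cLsq f -> cLsq (fun x => ((f x)^*)%C).
Proof.
move=> [rf [mj jf]]; split; first by rewrite RefJ.
split; first by rewrite ImfJ; exact: measurable_funN.
by under eq_integral do rewrite cImJ sqrrN.
Qed.

Lemma square_integrableP f : square_integrable f <-> cLsq f.
Proof.
split=> [[mr mj fi]|[lr lj]].
  have ms : measurable_fun D (fun x => (Normc.normc (f x) ^+ 2)%:E).
    have -> : (fun x => (normc (f x) ^+ 2)%:E) = (fun x => (normc2 (f x))%:E).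
      by apply/funext => x; rewrite normc_sqr.
    by apply/measurable_EFinP; apply: measurable_funD; exact: measurable_funX.
  split; split=> //; apply: le_lt_trans fi; apply: ge0_le_integral => //.
  - by move=> x _; rewrite lee_fin sqr_ge0.
  - by apply/measurable_EFinP; exact: measurable_funX.
  - by move=> x _; rewrite lee_fin normc_sqr lerDl sqr_ge0.
  - by move=> x _; rewrite lee_fin sqr_ge0.
  - by apply/measurable_EFinP; exact: measurable_funX.
  - by move=> x _; rewrite lee_fin normc_sqr lerDr sqr_ge0.
split; [by case: lr|by case: lj|].
under eq_integral do rewrite normc_sqr /normc2 EFinD.
have := integrable_lty mD (integrableD mD (Lsq_sqr lr) (Lsq_sqr lj)).
exact.
Qed.

Lemma normc2_integrable f : cLsq f -> mu.-integrable D (EFin \o (fun x => normc2 (f x))).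
Proof. by move=> [lr lj]; apply: integrable_addf; exact: Lsq_sqr. Qed.

(** The two parts of the integral are estimated separately, whence the factor 2. *)
Lemma normc_cint f M : cintegrable f -> (forall x, D x -> normc (f x) <= M) ->
  normc (cint f) <= 2 * (2 * pi) * M.
Proof.
move=> [rf jf] fM; apply: (le_trans (normc_le _)) => /=.
have b (h : R -> R) : mu.-integrable D (EFin \o h) -> (forall x, D x -> `|h x| <= M) ->
    `|\int[mu]_(x in D) h x| <= 2 * pi * M.
  move=> hi hM; apply: (le_trans (le_normr_Rintegral mD hi)).
  have -> : 2 * pi * M = \int[mu]_(x in D) (cst M x).
    rewrite Rintegral_cst//; transitivity (M * fine (mu D)); last by [].
    by rewrite measure_period mulrC.
  apply: le_Rintegral => //; first exact: integrable_norm.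
  exact: integrable_bound.
have -> : 2 * (2 * pi) * M = 2 * pi * M + 2 * pi * M by ring.
apply: lerD.
  exact: b _ rf (fun x Dx => le_trans (Re_le_normc (f x)) (fM x Dx)).
exact: b _ jf (fun x Dx => le_trans (Im_le_normc (f x)) (fM x Dx)).
Qed.

Lemma eq_cint f g : (forall x, D x -> f x = g x) -> cint f = cint g.
Proof.
move=> fg; apply: complex_ext => /=; apply: eq_Rintegral => x;
  by rewrite inE => Dx; rewrite fg.
Qed.

End ComplexIntegral.

(** * Test functions *)
Section TestFunctions.
Variable R : realType.
Implicit Types (phi psi : test_fun R) (k : int) (x : R).

Local Notation D := (`[0, 2 * (pi : R)]%classic).
Local Notation mu := (@lebesgue_measure R).
Local Notation cint := (cintegral D).

(** Evaluation with values in the field of complex numbers itself, so that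
    products of values are products of complex numbers. *)
Definition ev phi x : R[i] := phi x.

Lemma expiD j k x : ev (expi R (j + k)) x = ev (expi R j) x * ev (expi R k) x.
Proof.
apply: complex_ext; rewrite ?cReM ?cImM /= intrD mulrDl ?cosD ?sinD//.
by rewrite addrC.
Qed.

Lemma expiN k x : ev (expi R (- k)) x = ((ev (expi R k) x)^*)%C.
Proof.
by apply: complex_ext; rewrite ?cReJ ?cImJ /= mulrNz mulNr ?cosN ?sinN.
Qed.

Lemma expi0 x : ev (expi R 0) x = 1.
Proof. by apply: complex_ext; rewrite /= mul0r ?cos0 ?sin0. Qed.

Lemma normc2_expi k x : normc2 (ev (expi R k) x) = 1.
Proof. by rewrite /normc2 /= cos2Dsin2. Qed.

Lemma test_funD phi psi x : ev (phi + psi) x = ev phi x + ev psi x.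
Proof. by []. Qed.

Lemma test_funZ (a : R[i]) phi x : ev (a *: phi) x = a * ev phi x.
Proof. by []. Qed.

Lemma test_funN phi x : ev (- phi) x = - ev phi x.
Proof. by []. Qed.

Lemma test_fun_ext phi psi : (forall x, ev phi x = ev psi x) -> phi = psi.
Proof. by move=> h; apply: val_inj; apply/funext. Qed.

Lemma test_is_derive phi x :
  is_derive x 1 (re_fun phi) (re_fun (derive_test phi) x) /\
  is_derive x 1 (im_fun phi) (im_fun (derive_test phi) x).
Proof.
have /asboolP[_ r i] := test_valP phi.
by split; rewrite /re_fun /im_fun /= derive1E; apply: DeriveDef => //; [exact: (r 0%N)|exact: (i 0%N)].
Qed.

Lemma test_continuous phi : continuous (re_fun phi) /\ continuous (im_fun phi).
Proof.
have /asboolP[_ r i] := test_valP phi.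
split=> x; apply: differentiable_continuous; apply/derivable1_diffP;
  [exact: (r 0%N)|exact: (i 0%N)].
Qed.

Lemma continuous_bounded_meas (f : R -> R) : continuous f -> bounded_meas D f.
Proof.
move=> cf; split.
  by apply: measurable_funTS; exact: continuous_measurable_fun.
have cn : {within D, continuous (fun x => `|f x|)}.
  apply: continuous_subspaceT => x.
  by apply: cvg_norm; exact: cf.
have [c _ cM] := EVT_max (ltW (twopi_gt0 R)) cn.
by exists `|f c| => x Dx; exact: cM.
Qed.

Lemma cbounded_meas_test phi : cbounded_meas phi.
Proof. by have [cr ci] := test_continuous phi; split; exact: continuous_bounded_meas. Qed.

Lemma int_period_derive (F G : R -> R) : (forall x, is_derive x 1 F (G x)) ->
  continuous G -> F (2 * pi) = F 0 -> \int[mu]_(x in D) G x = 0.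
Proof.
move=> FG cG per; rewrite /Rintegral (@continuous_FTC2 _ G F)//.
- by rewrite per -EFinD subrr.
- exact: twopi_gt0.
- exact: continuous_subspaceT.
- have cF : continuous F.
    by move=> x; apply: differentiable_continuous; apply/derivable1_diffP; exact: (@ex_derive _ _ _ _ _ _ _ (FG x)).
  split.
  + by move=> x _; exact: (@ex_derive _ _ _ _ _ _ _ (FG x)).
  + by apply: cvg_at_right_filter; exact: cF.
  + by apply: cvg_at_left_filter; exact: cF.
- by move=> x _; rewrite derive1E; exact: (@derive_val _ _ _ _ _ _ _ (FG x)).
Qed.

Lemma test_periodic phi x : ev phi (x + 2 * pi) = ev phi x.
Proof. by have /asboolP[p _ _] := test_valP phi; exact: p. Qed.

(** The k-th Fourier coefficient, multiplied by 2 pi. *)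
Definition test_coef phi k : R[i] := cint (fun x => ev phi x * ev (expi R (- k)) x).

Lemma cos_der k x : is_derive x 1 (fun x => cos (k%:~R * x)) (- k%:~R * sin (k%:~R * x)).
Proof. by apply: is_derive_eq; rewrite /GRing.scale/=; ring. Qed.

Lemma sin_der k x : is_derive x 1 (fun x => sin (k%:~R * x)) (k%:~R * cos (k%:~R * x)).
Proof. by apply: is_derive_eq; rewrite /GRing.scale/=; ring. Qed.

(** The symbol of the derivative. *)
Definition ik k : R[i] := Complex (0 : R) k%:~R.

Lemma derive_expi k : derive_test (expi R k) = ik k *: expi R k.
Proof.
apply: test_fun_ext => x; rewrite test_funZ.
apply: complex_ext; rewrite ?cReM ?cImM /= derive1E.
  by have [_ e] := cos_der k x; rewrite [LHS]e; ring.
by have [_ e] := sin_der k x; rewrite [LHS]e; ring.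
Qed.

Lemma cbounded_meas_test_coef phi k : cbounded_meas (fun x => ev phi x * ev (expi R (- k)) x).
Proof. by apply: cbounded_measM; exact: cbounded_meas_test. Qed.

Lemma test_coefD phi psi k : test_coef (phi + psi) k = test_coef phi k + test_coef psi k.
Proof.
rewrite /test_coef -cintD; [|exact/cbounded_meas_integrable/cbounded_meas_test_coef..].
by apply: eq_cint => x _; rewrite test_funD mulrDl.
Qed.

Lemma test_coefZ (a : R[i]) phi k : test_coef (a *: phi) k = a * test_coef phi k.
Proof.
rewrite /test_coef -cintZ; last exact/cbounded_meas_integrable/cbounded_meas_test_coef.
by apply: eq_cint => x _; rewrite test_funZ mulrA.
Qed.

Lemma prod_continuous phi psi : continuous (fun x => Re (ev phi x * ev psi x)) /\
  continuous (fun x => Im (ev phi x * ev psi x)).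
Proof.
have [r1 i1] := test_continuous phi; have [r2 i2] := test_continuous psi.
rewrite RefM ImfM; split=> x.
  exact: (cvgB (cvgM (r1 x) (r2 x)) (cvgM (i1 x) (i2 x))).
exact: (cvgD (cvgM (r1 x) (i2 x)) (cvgM (i1 x) (r2 x))).
Qed.

(** Integration by parts: with e the exponential of frequency - k, the derivative of
    phi e is (phi' - i k phi) e, and its integral over a period vanishes. *)
Lemma test_coef_derive phi k : test_coef (derive_test phi) k = ik k * test_coef phi k.
Proof.
have [psi psiE] : exists psi, psi = derive_test phi + (- ik k) *: phi.
  by eexists.
have psix x : ev psi x = ev (derive_test phi) x - ik k * ev phi x.
  by rewrite psiE test_funD test_funZ mulNr.
have [cr ci] := prod_continuous psi (expi R (- k)).
have per : ev phi (2 * pi) * ev (expi R (- k)) (2 * pi) = ev phi 0 * ev (expi R (- k)) 0.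
  by rewrite -[2 * pi]add0r !test_periodic.
have psi0 : test_coef psi k = 0.
  apply: complex_ext => /=.
  - apply: (@int_period_derive (fun x => Re (ev phi x * ev (expi R (- k)) x))) => //; last by rewrite per.
    move=> x; rewrite RefM; have [dr di] := test_is_derive phi x.
    rewrite /re_fun /im_fun in dr di.
    have d1 := cos_der (- k) x; have d2 := sin_der (- k) x.
    have := is_deriveB (is_deriveM dr d1) (is_deriveM di d2).
    move=> h; refine (is_derive_eq h _).
    by rewrite psix !cpartE /= /GRing.scale /= !mulrNz; ring.
  - apply: (@int_period_derive (fun x => Im (ev phi x * ev (expi R (- k)) x))) => //; last by rewrite per.
    move=> x; rewrite ImfM; have [dr di] := test_is_derive phi x.
    rewrite /re_fun /im_fun in dr di.
    have d1 := cos_der (- k) x; have d2 := sin_der (- k) x.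
    have := is_deriveD (is_deriveM dr d2) (is_deriveM di d1).
    move=> h; refine (is_derive_eq h _).
    by rewrite psix !cpartE /= /GRing.scale /= !mulrNz; ring.
move: psi0; rewrite psiE test_coefD test_coefZ => /eqP.
by rewrite mulNr subr_eq0 => /eqP.
Qed.

End TestFunctions.

(** * Parseval, Bessel and Riesz-Fischer *)
Definition in_window (k : int) (K : nat) : bool :=
  match k with Posz n => (n < K)%N | Negz n => (n < K)%N end.

Section Window.
Variable R : realType.

Lemma eq_winsum (V : nmodType) (a b : int -> V) K :
  (forall k, in_window k K -> a k = b k) -> winsum a K = winsum b K.
Proof.
by move=> ab; apply: eq_bigr => i _; rewrite !ab /in_window.
Qed.

Lemma winsum_delta (V : nmodType) (a : int -> V) k K :
  winsum (fun j => if j == k then a j else 0) K = if in_window k K then a k else 0.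
Proof.
elim: K => [|K IH]; first by rewrite /winsum big_ord0; case: k.
rewrite winsumS {}IH; case: k => n /=.
  rewrite addr0 (_ : (Posz K == Posz n) = (K == n))// ltnS [(n <= K)%N]leq_eqVlt eq_sym.
  by case: (ltngtP n K) => [nk|nk|->] /=; rewrite ?addr0 ?add0r.
rewrite add0r (_ : (Negz K == Negz n) = (K == n))// ltnS [(n <= K)%N]leq_eqVlt eq_sym.
by case: (ltngtP n K) => [nk|nk|->] /=; rewrite ?addr0 ?add0r.
Qed.

Lemma winsum_trunc (V : zmodType) (a : int -> V) K L : (K <= L)%N ->
  winsum (fun k => if in_window k K then 0 else a k) L = winsum a L - winsum a K.
Proof.
move=> /subnK <-; elim: (L - K)%N => [|n IH].
  rewrite add0n subrr (_ : winsum _ _ = winsum (fun=> 0) K); last first.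
    by apply: eq_winsum => k ->.
  by rewrite /winsum big1// => i _; rewrite addr0.
rewrite addSn !winsumS IH /= ltnNge leq_addl /= addrAC//.
Qed.

End Window.

Section Fourier.
Variable R : realType.
Implicit Types (phi psi : test_fun R) (k : int) (x : R) (c : int -> R[i])
  (f g : R -> R[i]).

Local Notation D := (`[0, 2 * (pi : R)]%classic).
Local Notation mu := (@lebesgue_measure R).
Local Notation cint := (cintegral D).
Let mD := @measurable_period R.
Let fD := @measure_period_lty R.

(** The exponentials are eigenvectors of the derivative, so test_coef_derive makes
    i (j - k) times the coefficient vanish. *)
Lemma test_coef_expi j k : test_coef (expi R j) k = if j == k then (2 * pi)%:C%C else 0.
Proof.
case: eqP => [->|/eqP jk].
  rewrite /test_coef (@eq_cint _ _ (cst 1)) => [|x _]; last by rewrite -expiD subrr expi0.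
  apply: complex_ext; rewrite /= Rintegral_cst// ?mul0r// mul1r.
  transitivity (fine (mu D)); first by [].
  by rewrite measure_period.
have := test_coef_derive (expi R j) k; rewrite derive_expi test_coefZ => /eqP.
rewrite -subr_eq0 -mulrBl mulf_eq0 => /orP[|/eqP//].
have -> : ik R j - ik R k = Complex (0 : R) (j - k)%:~R.
  by apply: complex_ext; rewrite ?cpartE /= ?subr0// intrD mulrNz.
rewrite eq_complex /= => /andP[_]; rewrite intr_eq0 subr_eq0.
by rewrite (negbTE jk).
Qed.

Definition trig_poly c K : test_fun R := winsum (fun k => c k *: expi R k) K.

Lemma test_coef0 k : test_coef (0 : test_fun R) k = 0.
Proof. by rewrite -(scale0r (0 : test_fun R)) test_coefZ mul0r. Qed.

Lemma test_coef_winsum (F : int -> test_fun R) k K :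
  test_coef (winsum F K) k = winsum (fun j => test_coef (F j) k) K.
Proof.
elim: K => [|K IH]; first by rewrite /winsum !big_ord0 test_coef0.
by rewrite !winsumS !test_coefD IH.
Qed.

Lemma ev_winsum (F : int -> test_fun R) x K :
  ev (winsum F K) x = winsum (fun j => ev (F j) x) K.
Proof.
elim: K => [|K IH]; first by rewrite /winsum !big_ord0.
by rewrite !winsumS !test_funD IH.
Qed.

Lemma ev_trig c K x : ev (trig_poly c K) x = winsum (fun k => c k * ev (expi R k) x) K.
Proof. exact: ev_winsum. Qed.

Lemma test_coef_trig c K k :
  test_coef (trig_poly c K) k = if in_window k K then (2 * pi)%:C%C * c k else 0.
Proof.
rewrite test_coef_winsum -(winsum_delta (fun j => (2 * pi)%:C%C * c j)).
apply: eq_winsum => j _; rewrite test_coefZ test_coef_expi mulrC.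
by case: ifP => _; rewrite ?mul0r.
Qed.

(** The k-th Fourier coefficient, multiplied by 2 pi. *)
Definition fun_coef f k : R[i] := cint (fun x => f x * ev (expi R (- k)) x).

Lemma cint_conj_trig f c K : cLsq f ->
  cint (fun x => f x * ((ev (trig_poly c K) x)^*)%C) =
  winsum (fun k => ((c k)^*)%C * fun_coef f k) K.
Proof.
move=> lf; have ci k : cintegrable (fun x => f x * ev (expi R (- k)) x).
  by apply: cLsqM => //; exact/cbounded_meas_cLsq/cbounded_meas_test.
transitivity (cint (fun x => winsum (fun k => ((c k)^*)%C * (f x * ev (expi R (- k)) x)) K)).
  apply: eq_cint => x _; rewrite ev_trig conj_winsum -winsumZ.
  by apply: eq_winsum => k _; rewrite rmorphM expiN mulrCA.
rewrite (cint_winsum (f := fun k x => ((c k)^*)%C * (f x * ev (expi R (- k)) x))).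
  by apply: eq_winsum => k _; rewrite cintZ.
by move=> k; exact: cintegrableZ.
Qed.

Lemma int_normc2 f : \int[mu]_(x in D) normc2 (f x) = Re (cint (fun x => f x * ((f x)^*)%C)).
Proof.
rewrite /=; apply: eq_Rintegral => x _.
by rewrite /normc2 !cpartE; ring.
Qed.

Lemma parseval_trig c K :
  \int[mu]_(x in D) normc2 (ev (trig_poly c K) x) = 2 * pi * winsum (fun k => normc2 (c k)) K.
Proof.
rewrite int_normc2 cint_conj_trig; last exact/cbounded_meas_cLsq/cbounded_meas_test.
rewrite -winsumZ Re_winsum; apply: eq_winsum => k kK.
have -> : fun_coef (ev (trig_poly c K)) k = (2 * pi)%:C%C * c k.
  by rewrite /fun_coef -/(test_coef (trig_poly c K) k) test_coef_trig kK.
by rewrite /normc2 !cpartE /=; ring.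
Qed.

(** The integral of |f - S|^2 is nonnegative for the partial sum S of the Fourier series
    of f. *)
Lemma bessel f K : cLsq f ->
  winsum (fun k => normc2 (fun_coef f k)) K <= 2 * pi * \int[mu]_(x in D) normc2 (f x).
Proof.
move=> lf; pose c k := ((2 * pi)^-1)%:C%C * fun_coef f k.
have p0 : 2 * pi != 0 :> R by rewrite gt_eqF// twopi_gt0.
have lc k : fun_coef f k = (2 * pi)%:C%C * c k.
  by rewrite /c mulrA -rmorphM /= divff// mul1r.
pose S := ev (trig_poly c K).
have lS : cLsq S by apply: cbounded_meas_cLsq; exact: cbounded_meas_test.
have E : winsum (fun k => normc2 (fun_coef f k)) K = (2 * pi) ^+ 2 * winsum (fun k => normc2 (c k)) K.
  by rewrite -winsumZ; apply: eq_winsum => k _; rewrite lc normc2M normc2_real.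
have iS := normc2_integrable lS; have iF := normc2_integrable lf.
have [iX _] := cLsqM lf (cLsqJ lS).
have X : \int[mu]_(x in D) Re (f x * ((S x)^*)%C) = 2 * pi * winsum (fun k => normc2 (c k)) K.
  transitivity (Re (cint (fun x => f x * ((S x)^*)%C))); first by [].
  rewrite cint_conj_trig// Re_winsum -winsumZ; apply: eq_winsum => k _.
  by rewrite lc /normc2 !cpartE /=; ring.
have : 0 <= \int[mu]_(x in D) (normc2 (f x) + normc2 (S x) - 2 * Re (f x * ((S x)^*)%C)).
  apply: Rintegral_ge0 => x _.
  have -> : normc2 (f x) + normc2 (S x) - 2 * Re (f x * ((S x)^*)%C) = normc2 (f x - S x).
    by rewrite /normc2 !cpartE; ring.
  exact: normc2_ge0.
rewrite RintegralB//; last 2 first.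
- exact: integrable_addf.
- exact: integrable_scalef.
rewrite RintegralD// RintegralZl// X parseval_trig E.
set I := Rintegral _ _ _; set Q := winsum _ _ => h.
have {}h : 2 * pi * Q <= I by move: h; clear; move: I => I; set q := 2 * pi * Q; lra.
by rewrite expr2 -mulrA ler_pM2l// twopi_gt0.
Qed.

Lemma fun_coef_zsummable f : cLsq f -> zsummable (fun k => normc2 (fun_coef f k)).
Proof.
move=> lf; exists (2 * pi * \int[mu]_(x in D) normc2 (f x)) => K.
have -> : (fun k => `|normc2 (fun_coef f k)|) = (fun k => normc2 (fun_coef f k)).
  by apply/funext => k; rewrite ger0_norm// normc2_ge0.
exact: bessel.
Qed.

(** Riesz-Fischer: along a subsequence of partial sums whose increments are
    geometrically small in mean square, the limit exists and is square integrable. *)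
Lemma riesz_fischer c : zsummable (fun k => normc2 (c k)) ->
  exists2 f, cLsq f & forall k, fun_coef f k = (2 * pi)%:C%C * c k.
Proof.
move=> sc; pose q k := normc2 (c k); have q0 k : 0 <= q k by exact: normc2_ge0.
have cq := zsum_cvg sc.
have tp := twopi_gt0 R.
have exN j : exists N, zsum q - winsum q N <= (2 * pi)^-1 * 4^-1 ^+ j.
  have e0 : 0 < (2 * pi)^-1 * 4^-1 ^+ j :> R by rewrite mulr_gt0 ?invr_gt0// exprn_gt0.
  move/cvgrPdist_le : cq => /(_ _ e0) -[N _ NP]; exists N.
  by apply: le_trans (NP N _) => //=; exact: ler_norm.
pose N j := projT1 (cid (exN j)).
(* increasing window sizes, beyond which the sum of q is at most 4^-j / (2 pi) *)
pose K := fix K j := match j with 0%N => N 0%N | j'.+1 => maxn (maxn (K j') (N j)) j end.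
have KN j : (N j <= K j)%N by case: j => [//|j] /=; rewrite leq_max leq_max leqnn orbT.
have Kj j : (j <= K j)%N by case: j => [//|j] /=; rewrite leq_max leqnn orbT.
have KS j : (K j <= K j.+1)%N by rewrite /= leq_max leq_max leqnn.
have Ktail j : winsum q (K j.+1) - winsum q (K j) <= (2 * pi)^-1 * 4^-1 ^+ j.
  apply: le_trans (projT2 (cid (exN j))); rewrite lerB//.
    exact: winsum_le_zsum.
  by apply: winsum_nd => //; exact: KN.
pose S j := ev (trig_poly c (K j)).
have lS j : cLsq (S j) by apply: cbounded_meas_cLsq; exact: cbounded_meas_test.
have SB j : \int[mu]_(x in D) normc2 (S j.+1 x - S j x) <= 4^-1 ^+ j.
  pose b k := if in_window k (K j) then 0 else c k.
  have -> : \int[mu]_(x in D) normc2 (S j.+1 x - S j x)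
      = \int[mu]_(x in D) normc2 (ev (trig_poly b (K j.+1)) x).
    apply: eq_Rintegral => x _; congr normc2; rewrite /S !ev_trig -winsum_trunc//.
    by apply: eq_winsum => k _; rewrite /b; case: ifP => _; rewrite ?mul0r.
  rewrite parseval_trig.
  have -> : winsum (fun k => normc2 (b k)) (K j.+1) = winsum q (K j.+1) - winsum q (K j).
    rewrite -winsum_trunc//; apply: eq_winsum => k _; rewrite /b /q.
    by case: ifP => _ //; rewrite normc20.
  by rewrite -ler_pdivlMl.
have SM j : \int[mu]_(x in D) normc2 (S j x) <= 2 * pi * zsum q.
  by rewrite parseval_trig ler_pM2l// winsum_le_zsum.
have lSB j : cLsq (fun x => S j.+1 x - S j x).
  apply: cbounded_meas_cLsq.
  have -> : (fun x => S j.+1 x - S j x) = (fun x => S j.+1 x + ev (-1 *: trig_poly c (K j)) x).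
    by apply/funext => x; rewrite test_funZ mulN1r.
  by apply: cbounded_measD; exact: cbounded_meas_test.
have [fr lr cr] : exists2 fr : R -> R, Lsq mu D fr & forall g : R -> R, bounded_meas D g ->
    \int[mu]_(x in D) (Re (S j x) * g x) @[j --> \oo] --> \int[mu]_(x in D) (fr x * g x).
  apply: (@Lsq_complete _ _ _ mu D mD fD (fun j x => Re (S j x)) (2 * pi * zsum q)).
  - by move=> j; case: (lS j).
  - move=> j; apply: le_trans (SB j); apply: le_Rintegral => //.
    + have [h _] := lSB j; have := Lsq_sqr h; congr (_.-integrable _ _).
      by apply/funext => x /=; rewrite cReD cReN.
    + exact: normc2_integrable.
    + by move=> x _; rewrite /normc2 cReD cReN lerDl sqr_ge0.
  - move=> j; apply: le_trans (SM j); apply: le_Rintegral => //.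
    + by have [h _] := lS j; exact: Lsq_sqr.
    + exact: normc2_integrable.
    + by move=> x _; rewrite /normc2 lerDl sqr_ge0.
have [fi li ci] : exists2 fi : R -> R, Lsq mu D fi & forall g : R -> R, bounded_meas D g ->
    \int[mu]_(x in D) (Im (S j x) * g x) @[j --> \oo] --> \int[mu]_(x in D) (fi x * g x).
  apply: (@Lsq_complete _ _ _ mu D mD fD (fun j x => Im (S j x)) (2 * pi * zsum q)).
  - by move=> j; case: (lS j).
  - move=> j; apply: le_trans (SB j); apply: le_Rintegral => //.
    + have [_ h] := lSB j; have := Lsq_sqr h; congr (_.-integrable _ _).
      by apply/funext => x /=; rewrite cImD cImN.
    + exact: normc2_integrable.
    + by move=> x _; rewrite /normc2 cImD cImN lerDr sqr_ge0.
  - move=> j; apply: le_trans (SM j); apply: le_Rintegral => //.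
    + by have [_ h] := lS j; exact: Lsq_sqr.
    + exact: normc2_integrable.
    + by move=> x _; rewrite /normc2 lerDr sqr_ge0.
pose f x := Complex (fr x) (fi x).
have lf : cLsq f by [].
exists f => // k.
have [br bi] : cbounded_meas (ev (expi R (- k))) by exact: cbounded_meas_test.
have lc j : (`|k| < K j)%N -> fun_coef (S j) k = (2 * pi)%:C%C * c k.
  move=> kj; rewrite /fun_coef -/(test_coef (trig_poly c (K j)) k) test_coef_trig.
  case: (k) kj => n /= kj; first by rewrite kj.
  by rewrite (ltn_trans _ kj).
have Mi h1 h2 : Lsq mu D h1 -> bounded_meas D h2 -> mu.-integrable D (EFin \o (fun x => h1 x * h2 x)).
  by move=> l1 b2; apply: LsqM_integrable => //; exact: bounded_meas_Lsq.
have ReL g : cLsq g -> Re (fun_coef g k) =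
   \int[mu]_(x in D) (Re (g x) * Re (ev (expi R (- k)) x))
   - \int[mu]_(x in D) (Im (g x) * Im (ev (expi R (- k)) x)).
  by move=> [l1 l2]; rewrite /fun_coef /cintegral RefM RintegralB//; exact: Mi.
have ImL g : cLsq g -> Im (fun_coef g k) =
   \int[mu]_(x in D) (Re (g x) * Im (ev (expi R (- k)) x))
   + \int[mu]_(x in D) (Im (g x) * Re (ev (expi R (- k)) x)).
  by move=> [l1 l2]; rewrite /fun_coef /cintegral ImfM RintegralD//; exact: Mi.
have near_eq (P : R[i] -> R) : P (fun_coef (S j) k) @[j --> \oo] --> P ((2 * pi)%:C%C * c k).
  apply: cvg_near_cst; exists `|k|%N.+1 => // j /= kj; rewrite lc//.
  exact: leq_trans kj (Kj j).
apply: complex_ext.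
- have h : Re (fun_coef (S j) k) @[j --> \oo] --> Re (fun_coef f k).
    by rewrite ReL//; under eq_fun do rewrite ReL//; apply: cvgB; [exact: cr|exact: ci].
  exact: (cvg_unique _ h (near_eq (@complex.Re R))).
- have h : Im (fun_coef (S j) k) @[j --> \oo] --> Im (fun_coef f k).
    by rewrite ImL//; under eq_fun do rewrite ImL//; apply: cvgD; [exact: cr|exact: ci].
  exact: (cvg_unique _ h (near_eq (@complex.Im R))).
Qed.

End Fourier.

(** * Pointwise convergence of the Fourier series of a test function *)
Section QuotientBound.
Variable R : realType.
Implicit Types (phi psi : test_fun R) (k : int) (x : R).

Local Notation D := (`[0, 2 * (pi : R)]%classic).

Lemma mean_value (f df : R -> R) (a b : R) : (forall x, is_derive x 1 f (df x)) ->
  a <= b -> exists2 c, a <= c <= b & f b - f a = df c * (b - a).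
Proof.
move=> fd ab; have [|c] := @MVT_segment R f df a b ab (fun x _ => fd x).
  apply: continuous_subspaceT => x; apply: differentiable_continuous.
  by apply/derivable1_diffP; exact: (@ex_derive _ _ _ _ _ _ _ (fd x)).
by rewrite in_itv /= => cab e; exists c.
Qed.

(** As 1 - cos y = 2 sin^2 (|y| / 2), it suffices to bound sin z below by a multiple of
    z on [0, pi/2]. On [0, 1] the factor cos 1 works by the mean value theorem; since
    pi/2 < 2 and sin increases up to pi/2, half of it works on [0, pi/2]. *)
Lemma one_minus_cos : exists2 a : R, 0 < a & forall y : R, `|y| <= pi -> a * y ^+ 2 <= 1 - cos y.
Proof.
pose c : R := cos 1; have c0 : 0 < c by exact: cos1_gt0.
have ph1 := @pihalf_ge1 R; have ph2 := @pihalf_lt2 R.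
have s1 (z : R) : 0 <= z <= 1 -> c * z <= sin z.
  move=> /andP[z0 z1].
  have [t /andP[t0 tz]] := @mean_value (@sin R) cos 0 z (fun x => is_derive_sin x) z0.
  rewrite sin0 !subr0 => ->; apply: ler_wpM2r => //.
  have [u /andP[tu u1]] := @mean_value (@cos R) (fun x => - sin x) t 1
    (fun x => is_derive_cos x) (le_trans tz z1).
  have : 0 <= sin u * (1 - t).
    apply: mulr_ge0; last by rewrite subr_ge0 (le_trans tz).
    by apply: sin_ge0_pi; apply/andP; split; lra.
  by rewrite /c; lra.
have s2 (z : R) : 0 <= z <= pi / 2 -> c / 2 * z <= sin z.
  move=> /andP[z0 z2]; have [z1|z1] := leP z 1.
    by apply: le_trans (s1 z _); [rewrite ler_wpM2r//; lra|rewrite z0].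
  have [t /andP[t0 tz]] := @mean_value (@sin R) cos 1 z (fun x => is_derive_sin x) (ltW z1).
  have : 0 <= cos t * (z - 1).
    apply: mulr_ge0; last by lra.
    by apply: cos_ge0_pihalf; apply/andP; split; lra.
  have := s1 1; rewrite lexx ler01 => /(_ isT).
  have : c * z <= c * 2 by rewrite ler_wpM2l ?ltW//; lra.
  lra.
exists (c ^+ 2 / 8); first by rewrite divr_gt0// exprn_gt0.
move=> y yp.
have -> : 1 - cos y = 2 * sin (`|y| / 2) ^+ 2.
  rewrite -(cos_norm y) {1}(_ : `|y| = (`|y| / 2) *+ 2); last by rewrite mulr2n; lra.
  by rewrite cos_mulr2n cos2sin2 mulr2n; lra.
have := s2 (`|y| / 2); rewrite divr_ge0//= => /(_ _) h.
have {}h : c / 2 * (`|y| / 2) <= sin (`|y| / 2) by apply: h; rewrite ler_pM2r.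
have h0 : 0 <= c / 2 * (`|y| / 2) by rewrite mulr_ge0 ?divr_ge0// ltW.
have := lerXn2r 2 h0 (le_trans h0 h) h.
rewrite -[y ^+ 2]real_normK ?num_real//.
have -> : (c / 2 * (`|y| / 2)) ^+ 2 = c ^+ 2 / 8 * `|y| ^+ 2 / 2 by field.
by move=> hh; lra.
Qed.

Lemma smooth_lipschitz (f df : R -> R) (a b : R) : a <= b ->
  (forall x, is_derive x 1 f (df x)) -> continuous df ->
  exists2 B, 0 <= B & forall x y, a <= x <= b -> a <= y <= b -> `|f x - f y| <= B * `|x - y|.
Proof.
move=> ab fd cdf.
have cn : {within `[a, b], continuous (fun x => `|df x|)}.
  by apply: continuous_subspaceT => x; apply: cvg_norm; exact: cdf.
have [c _ cM] := EVT_max ab cn.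
exists `|df c| => //.
have H x y : a <= x <= b -> a <= y <= b -> x <= y -> `|f x - f y| <= `|df c| * `|x - y|.
  move=> /andP[ax xb] /andP[ay yb] xy; have [t /andP[xt ty]] := mean_value fd xy.
  rewrite distrC => ->; rewrite normrM distrC ler_wpM2r//; apply: cM.
  by rewrite in_itv /= (le_trans ax xt) (le_trans ty yb).
move=> x y hx hy; have [xy|/ltW yx] := leP x y; first exact: H.
by rewrite distrC [`|x - y|]distrC; exact: H.
Qed.

(** Moving x by a period brings it within pi of x0, without changing either side.
    Then phi is Lipschitz between them, and |exp (i x) - exp (i x0)|^2 = 2 (1 - cos (x - x0))
    controls (x - x0)^2. *)
Lemma test_quotient_bound phi : exists2 L, 0 <= L & forall x x0, D x -> D x0 ->
  normc2 (ev phi x - ev phi x0) <= L * normc2 (ev (expi R 1) x - ev (expi R 1) x0).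
Proof.
have p0 := @pi_gt0 R.
have ab : - (2 * pi) <= 4 * pi :> R by lra.
have [cr ci] := test_continuous (derive_test phi).
have [B B0 BP] := smooth_lipschitz ab (fun x => proj1 (test_is_derive phi x)) cr.
have [C C0 CP] := smooth_lipschitz ab (fun x => proj2 (test_is_derive phi x)) ci.
have [a a0 aP] := one_minus_cos.
exists ((B ^+ 2 + C ^+ 2) / a).
  by rewrite divr_ge0 ?addr_ge0 ?sqr_ge0// ltW.
move=> x x0; rewrite /= !in_itv /= => /andP[x1 x2] /andP[y1 y2].
have nw : normc2 (ev (expi R 1) x - ev (expi R 1) x0) = 2 * (1 - cos (x - x0)).
  rewrite /normc2 !cpartE /= !mul1r cosB.
  have := cos2Dsin2 x; have := cos2Dsin2 x0; set u := cos x; set v := sin x; set u' := cos x0; set v' := sin x0.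
  by move=> h1 h2; rewrite -[2]/(1 + 1) mulrDl mul1r -{1}h1 -h2; ring.
(* z is the representative of x modulo 2 pi that lies within pi of x0 *)
suff [z [xz zx0 cz zlo]] : exists z, [/\ ev phi z = ev phi x, `|z - x0| <= pi,
    cos (z - x0) = cos (x - x0) & - (2 * pi) <= z <= 4 * pi].
  rewrite nw -cz -xz.
  have hx0 : - (2 * pi) <= x0 <= 4 * pi by apply/andP; split; lra.
  have h1 := BP z x0 zlo hx0; have h2 := CP z x0 zlo hx0.
  have h3 := aP _ zx0.
  have e1 : normc2 (ev phi z - ev phi x0) <= (B ^+ 2 + C ^+ 2) * (z - x0) ^+ 2.
    rewrite /normc2 !cpartE mulrDl; apply: lerD.
      rewrite -(real_normK (num_real (Re _ - _))) -(real_normK (num_real (z - x0))) -exprMn.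
      by rewrite lerXn2r// nnegrE ?mulr_ge0.
    rewrite -(real_normK (num_real (Im _ - _))) -(real_normK (num_real (z - x0))) -exprMn.
    by rewrite lerXn2r// nnegrE ?mulr_ge0.
  apply: (le_trans e1); rewrite -mulrA ler_wpM2l ?addr_ge0 ?sqr_ge0//.
  rewrite ler_pdivlMl//; apply: (le_trans h3).
  have := cos_le1 (z - x0); lra.
have [h|h] := leP (x - x0) pi.
  have [h'|h'] := leP (- pi) (x - x0).
    exists x; split=> //; first by rewrite ler_norml h h'.
    by apply/andP; split; lra.
  exists (x + 2 * pi); split.
  - exact: test_periodic.
  - by rewrite ler_norml; apply/andP; split; lra.
  - by rewrite addrAC mulr_natl cosD2pi.
  - by apply/andP; split; lra.
exists (x - 2 * pi); split.
- by rewrite -[in RHS](subrK (2 * pi) x) test_periodic.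
- by rewrite ler_norml; apply/andP; split; lra.
- by rewrite -[in RHS](subrK (2 * pi) x) [in RHS]addrAC mulr_natl cosD2pi addrAC.
- by apply/andP; split; lra.
Qed.

End QuotientBound.

Section Convergence.
Variable R : realType.
Implicit Types (phi psi : test_fun R) (k : int) (x : R).

Local Notation D := (`[0, 2 * (pi : R)]%classic).
Let mD := @measurable_period R.
Let fD := @measure_period_lty R.

Lemma zsummable_cvg0 (a : int -> R) : (forall k, 0 <= a k) -> zsummable a ->
  a (Posz n) @[n --> \oo] --> (0 : R) /\ a (Negz n) @[n --> \oo] --> (0 : R).
Proof.
move=> a0 sa; have c1 := zsum_cvg sa.
have c2 : winsum a n.+1 @[n --> \oo] --> zsum a by have := c1; rewrite -cvg_shiftS.
have c3 := cvgB c2 c1; rewrite subrr in c3.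
have c4 : a (Posz n) + a (Negz n) @[n --> \oo] --> (0 : R).
  have -> : (fun n => a (Posz n) + a (Negz n)) = (fun n => winsum a n.+1 - winsum a n).
    by apply/funext => n; rewrite winsumS [in RHS]addrC addKr.
  exact: c3.
split; apply: (squeeze_cvgr _ (cvg_cst (0 : R)) c4); apply: nearW => n.
  by rewrite a0/= lerDl.
by rewrite a0/= lerDr.
Qed.

(** Let e be the first exponential and g = (phi - phi x0) / (e - e x0), which is bounded by
    test_quotient_bound. Taking the k-th coefficient of phi = phi x0 + g (e - e x0)
    shows that, for k nonzero, the k-th term of the Fourier series at x0 is the difference of
    two consecutive terms of a sequence whose moduli are those of the coefficients of g. The
    partial sums telescope, and by Bessel's inequality the boundary terms tend to 0. *)
Lemma fourier_pointwise phi x0 : D x0 ->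
  normc2 (winsum (fun k => test_coef phi k * ev (expi R k) x0) K.+1
       - (2 * pi)%:C%C * ev phi x0) @[K --> \oo] --> (0 : R).
Proof.
move=> Dx0; have [L L0 LP] := test_quotient_bound phi.
pose w x : R[i] := ev (expi R 1) x - ev (expi R 1) x0.
pose p x : R[i] := ev phi x - ev phi x0.
pose g x : R[i] := p x * ((w x)^*)%C * ((normc2 (w x))^-1)%:C%C.
have bw : cbounded_meas w by apply: (cbounded_measD (cbounded_meas_test _) (cbounded_meas_cst _)).
have bp : cbounded_meas p by apply: (cbounded_measD (cbounded_meas_test _) (cbounded_meas_cst _)).
have gw x : D x -> g x * w x = p x.
  move=> Dx; have := LP x x0 Dx Dx0; rewrite -/(w x) -/(p x) => h.
  have [w0|w0] := eqVneq (normc2 (w x)) 0.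
    have p0 : p x = 0.
      apply: normc2_eq0; apply: le_anti; rewrite normc2_ge0 andbT; move: h; by rewrite w0 mulr0.
    by rewrite /g p0 !mul0r.
  have e : ((w x)^*)%C * w x = (normc2 (w x))%:C%C.
    by apply: complex_ext; rewrite !cpartE /normc2 /=; ring.
  have -> : g x * w x = p x * ((((w x)^*)%C * w x) * ((normc2 (w x))^-1)%:C%C).
    by rewrite /g; ring.
  by rewrite e -rmorphM /= divff// mulr1.
have mi : measurable_fun D (fun x => (normc2 (w x))^-1).
  have -> : (fun x => (normc2 (w x))^-1) = (fun y : R => y `^ (-1)) \o (fun x => normc2 (w x)).
    by apply/funext => x /=; rewrite powR_inv1// normc2_ge0.
  apply: measurableT_comp; first exact: measurable_powR.
  have [[mr _] [mj _]] := bw.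
  by apply: measurable_funD; exact: measurable_funX.
have gL x : D x -> normc2 (g x) <= L.
  move=> Dx; have := LP x x0 Dx Dx0; rewrite -/(w x) -/(p x) => h.
  rewrite /g !normc2M normc2_real normc2J.
  have [->|w0] := eqVneq (normc2 (w x)) 0; first by rewrite mulr0 mul0r.
  have w1 : 0 < normc2 (w x) by rewrite lt_def w0 normc2_ge0.
  have -> : normc2 (p x) * normc2 (w x) * (normc2 (w x))^-1 ^+ 2 = normc2 (p x) / normc2 (w x) by field.
  by rewrite ler_pdivrMr.
have [[mr _] [mj _]] := cbounded_measM bp (cbounded_measJ bw).
have lg : cLsq g.
  have reg x : Re (g x) = Re (p x * ((w x)^*)%C) * (normc2 (w x))^-1.
    by rewrite /g [LHS]cReM (cIm_real (normc2 (w x))^-1) (cRe_real (normc2 (w x))^-1) mulr0 subr0.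
  have img x : Im (g x) = Im (p x * ((w x)^*)%C) * (normc2 (w x))^-1.
    by rewrite /g [LHS]cImM (cIm_real (normc2 (w x))^-1) (cRe_real (normc2 (w x))^-1) mulr0 add0r.
  have bound (y z : R) : y ^+ 2 + z ^+ 2 <= L -> `|y| <= 1 + L.
    move=> h; have := sqr_ge0 (1 - `|y|); have := sqr_ge0 z.
    by rewrite sqrrB real_normK ?num_real// => *; have := normr_ge0 y; nra.
  split; apply: (bounded_meas_Lsq mD fD); split.
  - have -> : (fun x => Re (g x)) = _ := funext reg; exact: measurable_funM.
  - by exists (1 + L) => x Dx; apply: (@bound _ (Im (g x))); exact: gL.
  - have -> : (fun x => Im (g x)) = _ := funext img; exact: measurable_funM.
  - by exists (1 + L) => x Dx; apply: (@bound _ (Re (g x))); rewrite addrC; exact: gL.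
pose G k := fun_coef g k.
pose b k := G (k - 1) * ev (expi R k) x0.
have tE k : test_coef phi k * ev (expi R k) x0 =
    (if k == 0 then (2 * pi)%:C%C * ev phi x0 else 0) + (b k - b (k + 1)).
  have -> : test_coef phi k = ev phi x0 * test_coef (expi R 0) k
      + (G (k - 1) + (- ev (expi R 1) x0) * G k).
    have i0 j : cintegrable (fun x => g x * ev (expi R (- j)) x).
      by apply: cLsqM => //; exact/cbounded_meas_cLsq/cbounded_meas_test.
    have i1 := cbounded_meas_integrable (cbounded_meas_test_coef (expi R 0) k).
    have i2 := cintegrableZ (- ev (expi R 1) x0) (i0 k).
    rewrite /G /fun_coef /test_coef -(cintZ (ev phi x0) i1) -(cintZ _ (i0 k)).
    rewrite -(cintD (i0 (k - 1)) i2).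
    rewrite -(cintD (cintegrableZ _ i1) (cintegrableD (i0 (k - 1)) i2)).
    apply: eq_cint => x Dx.
    have -> : ev phi x = ev phi x0 + g x * w x by rewrite gw// /p addrC subrK.
    have -> : - (k - 1) = 1 + - k :> int by rewrite opprB.
    by rewrite expi0 expiD /w; ring.
  rewrite test_coef_expi /b addrK expiD eq_sym.
  have [->|_] := eqVneq k 0; last by ring.
  by rewrite expi0; ring.
have tel K : winsum (fun k => b k - b (k + 1)) K = b (- K%:Z) - b K.
  elim: K => [|K IH]; first by rewrite /winsum big_ord0 oppr0 subrr.
  rewrite winsumS IH NegzE.
  have -> : - (Posz K.+1) + 1 = - Posz K by rewrite -addn1 PoszD opprD addrNK.
  have -> : Posz K + 1 = Posz K.+1 by rewrite -addn1.
  by ring.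
have S K : winsum (fun k => test_coef phi k * ev (expi R k) x0) K.+1 - (2 * pi)%:C%C * ev phi x0
    = b (- K.+1%:Z) - b K.+1.
  under eq_fun do rewrite tE.
  rewrite winsumD tel (winsum_delta (fun=> (2 * pi)%:C%C * ev phi x0) 0) /=.
  by ring.
have [c1 c2] := zsummable_cvg0 (fun k => normc2_ge0 (G k)) (fun_coef_zsummable lg).
have c3 : normc2 (G (Negz n.+1)) @[n --> \oo] --> (0 : R) by move: c2; rewrite -cvg_shiftS.
have c4 : 2 * (normc2 (G (Negz n.+1)) + normc2 (G (Posz n))) @[n --> \oo] --> (0 : R).
  have -> : (0 : R) = 2 * (0 + 0) by rewrite addr0 mulr0.
  by apply: cvgMr; exact: cvgD.
apply: (squeeze_cvgr _ (cvg_cst (0 : R)) c4); apply: nearW => n.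
rewrite normc2_ge0 /= S; apply: (le_trans (normc2B_le _ _)).
rewrite /b !normc2M !normc2_expi !mulr1.
have -> : - Posz n.+1 - 1 = Negz n.+1 by rewrite NegzE -[in RHS]addn1 PoszD opprD.
by have -> : Posz n.+1 - 1 = Posz n by rewrite -addn1 PoszD addrK.
Qed.

(** * Uniqueness of Fourier coefficients *)

(** Two integrations by parts. *)
Lemma test_coef_decay phi : exists2 C, 0 <= C &
  forall k, k%:~R ^+ 2 * normc (test_coef phi k) <= C.
Proof.
have [[_ [M1 h1]] [_ [M2 h2]]] := cbounded_meas_test (derive_test (derive_test phi)).
exists (2 * (2 * pi) * (`|M1| + `|M2|)).
  apply: mulr_ge0; last exact: addr_ge0.
  by apply: mulr_ge0 => //; apply: ltW; exact: twopi_gt0.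
move=> k.
have -> : k%:~R ^+ 2 * normc (test_coef phi k) = normc (test_coef (derive_test (derive_test phi)) k).
  rewrite !test_coef_derive !Normc.normcM mulrA; congr (_ * _).
  by rewrite -expr2 normc_sqr /normc2 /= expr0n add0r.
apply: normc_cint; first exact/cbounded_meas_integrable/cbounded_meas_test_coef.
move=> x Dx; rewrite Normc.normcM (_ : normc (ev (expi R (- k)) x) = 1); last first.
  by rewrite normcE normc2_expi sqrtr1.
rewrite mulr1; apply: (le_trans (normc_le _)); apply: lerD.
  by apply: (le_trans (h1 x Dx)); exact: ler_norm.
by apply: (le_trans (h2 x Dx)); exact: ler_norm.
Qed.

(** The bound 2 C / n^2 for the pair of terms of index n is compared with the telescoping
    sequence 4 C / n - 4 C / (n + 1). *)
Lemma test_coef_zsummable phi : zsummable (fun k => normc (test_coef phi k)).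
Proof.
have [C C0 CP] := test_coef_decay phi; pose a k := normc (test_coef phi k).
have a0 k : 0 <= a k by exact: normc_ge0.
exists (winsum a 1 + 4 * C) => K.
have -> : (fun k => `|a k|) = a by apply/funext => k; rewrite ger0_norm.
have H n : winsum a n.+1 <= winsum a 1 + 4 * C - 4 * C * n.+1%:R^-1.
  elim: n => [|n IH]; first by rewrite invr1 mulr1 addrK.
  rewrite winsumS.
  have m0 : 0 < n.+1%:R :> R by rewrite ltr0n.
  have h1 : a (Posz n.+1) <= C / n.+1%:R ^+ 2.
    by rewrite ler_pdivlMr ?exprn_gt0// mulrC; exact: (CP (Posz n.+1)).
  have h2 : a (Negz n.+1) <= C / n.+1%:R ^+ 2.
    rewrite ler_pdivlMr ?exprn_gt0// mulrC.
    apply: le_trans (CP (Negz n.+1)); rewrite ler_wpM2r// NegzE mulrNz sqrrN.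
    by rewrite lerXn2r// ?nnegrE// ler_nat.
  have h3 : 2 * (C / n.+1%:R ^+ 2) <= 4 * C * n.+1%:R^-1 - 4 * C * n.+2%:R^-1.
    have -> : n.+2%:R = n.+1%:R + 1 :> R by rewrite -natr1.
    set m := n.+1%:R in m0 *; have m1 : 1 <= m by rewrite /m ler1n.
    have -> : 4 * C * m^-1 - 4 * C * (m + 1)^-1 = 4 * C / (m * (m + 1)).
      by field; rewrite !gt_eqF//; lra.
    have -> : 2 * (C / m ^+ 2) = 2 * C / m ^+ 2 by rewrite mulrA.
    rewrite ler_pdivlMr ?mulr_gt0//; last by lra.
    rewrite mulrAC ler_pdivrMr ?exprn_gt0//.
    have : 0 <= C * m * (m - 1).
      by apply: mulr_ge0; [apply: mulr_ge0 => //; exact: ltW|rewrite subr_ge0].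
    have -> : C * m * (m - 1) = C * m * m - C * m by ring.
    have -> : 2 * C * (m * (m + 1)) = 2 * (C * m * m) + 2 * (C * m) by ring.
    have -> : 4 * C * m ^+ 2 = 4 * (C * m * m) by ring.
    by set u := C * m * m; set v := C * m; clear; lra.
  move: IH h1 h2 h3; set u := winsum a n.+1; set v := winsum a 1.
  set X := C / _; set Y := 4 * C * _; set Z := 4 * C * _.
  by move: (a _) (a _) u v X Y Z => *; lra.
case: K => [|K].
  by rewrite {1}/winsum big_ord0 addr_ge0 ?winsum_ge0// mulr_ge0.
apply: (le_trans (H K)); rewrite lerBlDr lerDl mulr_ge0 ?mulr_ge0//.
Qed.

(** The factor 2 pi compensates the normalization of test_coef. *)
Definition remainder K phi : test_fun R :=
  (2 * pi)%:C%C *: phi - winsum (fun k => test_coef phi k *: expi R k) K.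

Lemma normc_winsum (z : int -> R[i]) K : normc (winsum z K) <= winsum (fun k => normc (z k)) K.
Proof.
elim: K => [|K IH]; first by rewrite /winsum !big_ord0 Normc.normc0.
rewrite !winsumS; apply: (le_trans (normcD _ _)); rewrite lerD//.
exact: normcD.
Qed.

Lemma ev_remainder K phi x : ev (remainder K phi) x =
  (2 * pi)%:C%C * ev phi x - winsum (fun k => test_coef phi k * ev (expi R k) x) K.
Proof. by rewrite /remainder test_funD test_funN ev_winsum. Qed.

Lemma period_reduction x : exists2 y, D y & forall phi, ev phi x = ev phi y.
Proof.
have tp := twopi_gt0 R.
pose n := Num.floor (x / (2 * pi)); exists (x - n%:~R * (2 * pi)).
  have := Num.Theory.floor_itv (x / (2 * pi)).
  rewrite -/n ler_pdivlMr// ltr_pdivrMr// intrD => /andP[h1 h2].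
  by rewrite /= in_itv /=; apply/andP; split; lra.
move=> phi.
have P (m : nat) y : ev phi (y + m%:R * (2 * pi)) = ev phi y.
  elim: m y => [|m IH] y; first by rewrite mul0r addr0.
  by rewrite -natr1 mulrDl mul1r addrA test_periodic.
case: n => m.
  by rewrite -[in LHS](subrK (m%:~R * (2 * pi)) x) -[in X in _ + X]pmulrn P.
by rewrite NegzE mulrNz mulNr opprK -pmulrn P.
Qed.

(** By pointwise convergence the remainder is the sum of the tail of the series, which is
    absolutely convergent, uniformly in x. *)
Lemma remainder_le K phi x :
  normc (ev (remainder K phi) x) <=
  zsum (fun k => normc (test_coef phi k)) - winsum (fun k => normc (test_coef phi k)) K.
Proof.
have [y Dy ->] := period_reduction x; move: y Dy {x} => x Dx.
set a := fun k => normc (test_coef phi k).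
have a0 k : 0 <= a k by exact: normc_ge0.
have sa : zsummable a by exact: test_coef_zsummable.
have c1 := fourier_pointwise phi Dx.
have E n : normc (ev (remainder n.+1 phi) x) = Num.sqrt (normc2
    (winsum (fun k => test_coef phi k * ev (expi R k) x) n.+1 - (2 * pi)%:C%C * ev phi x)).
  by rewrite normcE ev_remainder -normc2N opprB.
have c2 : normc (ev (remainder n.+1 phi) x) @[n --> \oo] --> (0 : R).
  rewrite -(sqrtr0 R); have -> : (fun n => normc (ev (remainder n.+1 phi) x)) = _ := funext E.
  exact: (cvg_comp _ _ c1 (@sqrt_continuous R 0)).
have c3 : normc (ev (remainder n.+1 phi) x) + (zsum a - winsum a K) @[n --> \oo]
    --> 0 + (zsum a - winsum a K).
  by apply: cvgD => //; exact: cvg_cst.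
rewrite add0r in c3.
apply: (ler_cvg_to (cvg_cst (normc (ev (remainder K phi) x))) c3); exists K => // n Kn.
have KL : (K <= n.+1)%N by apply: leqW.
have -> : ev (remainder K phi) x = ev (remainder n.+1 phi) x +
    winsum (fun k => if in_window k K then 0 else test_coef phi k * ev (expi R k) x) n.+1.
  by rewrite !ev_remainder winsum_trunc// addrA subrK.
apply: (le_trans (normcD _ _)); rewrite lerD2l.
apply: (le_trans (normc_winsum _ _)).
apply: (@le_trans _ _ (winsum (fun k => if in_window k K then 0 else a k) n.+1)).
  apply: le_winsum => k; case: ifP => _; first by rewrite Normc.normc0.
  by rewrite Normc.normcM (normcE (ev _ _)) normc2_expi sqrtr1 mulr1.
by rewrite winsum_trunc// lerB// winsum_le_zsum.
Qed.

Lemma derive_testD phi psi : derive_test (phi + psi) = derive_test phi + derive_test psi.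
Proof.
apply: test_fun_ext => x; rewrite test_funD.
have [r1 i1] := test_is_derive phi x; have [r2 i2] := test_is_derive psi x.
have [[_ r] [_ i]] := test_is_derive (phi + psi) x.
have E1 : re_fun (phi + psi) = re_fun phi + re_fun psi.
  by apply/funext => y; exact: (cReD (ev phi y) (ev psi y)).
have E2 : im_fun (phi + psi) = im_fun phi + im_fun psi.
  by apply/funext => y; exact: (cImD (ev phi y) (ev psi y)).
rewrite E1 in r; rewrite E2 in i.
have [_ er] := is_deriveD r1 r2; have [_ ei] := is_deriveD i1 i2.
apply: complex_ext.
  by rewrite cReD; exact: etrans (esym r) er.
by rewrite cImD; exact: etrans (esym i) ei.
Qed.

Lemma derive_testZ (a : R[i]) phi : derive_test (a *: phi) = a *: derive_test phi.
Proof.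
apply: test_fun_ext => x; rewrite test_funZ.
have [r1 i1] := test_is_derive phi x.
have [[_ r] [_ i]] := test_is_derive (a *: phi) x.
have E1 : re_fun (a *: phi) = Re a \*: re_fun phi - Im a \*: im_fun phi.
  by apply/funext => y; exact: (cReM a (ev phi y)).
have E2 : im_fun (a *: phi) = Re a \*: im_fun phi + Im a \*: re_fun phi.
  by apply/funext => y; exact: (cImM a (ev phi y)).
rewrite E1 in r; rewrite E2 in i.
have [_ er] := is_deriveB (is_deriveZ (Re a) r1) (is_deriveZ (Im a) i1).
have [_ ei] := is_deriveD (is_deriveZ (Re a) i1) (is_deriveZ (Im a) r1).
apply: complex_ext.
  by rewrite cReM; exact: etrans (esym r) er.
by rewrite cImM; exact: etrans (esym i) ei.
Qed.

Lemma derive_test_winsum (F : int -> test_fun R) K :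
  derive_test (winsum F K) = winsum (fun k => derive_test (F k)) K.
Proof.
elim: K => [|K IH]; last by rewrite !winsumS !derive_testD IH.
have := derive_testZ 0 (0 : test_fun R); rewrite !scale0r => e.
by rewrite /winsum !big_ord0.
Qed.

(** Hence remainder_le applies to all the derivatives of a remainder, that is, to the
    seminorms for which distributions are continuous. *)
Lemma derive_remainder K phi :
  derive_test (remainder K phi) = remainder K (derive_test phi).
Proof.
rewrite /remainder -scaleN1r derive_testD !derive_testZ scaleN1r derive_test_winsum.
congr (_ - _); apply: eq_winsum => k _.
by rewrite derive_testZ derive_expi test_coef_derive scalerA mulrC.
Qed.

Lemma derive1n_test n phi :
  derive1n n (re_fun phi) = re_fun (iter n (@derive_test R) phi) /\
  derive1n n (im_fun phi) = im_fun (iter n (@derive_test R) phi).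
Proof.
elim: n => [//|n [r i]]; rewrite !derive1nS r i /=; split; exact/funext.
Qed.

Section Linear.
Variables (v : functional R) (lv : linear v).

Lemma flin0 : v 0 = 0.
Proof. by have := lv (-1) 0 0; rewrite scaler0 addr0 scaleN1r addNr. Qed.

Lemma flinZ (a : R[i]) phi : v (a *: phi) = a * v phi.
Proof. by have := lv a phi 0; rewrite addr0 flin0 addr0. Qed.

Lemma flinD phi psi : v (phi + psi) = v phi + v psi.
Proof. by have := lv 1 phi psi; rewrite !scale1r. Qed.

Lemma flin_winsum (F : int -> test_fun R) K : v (winsum F K) = winsum (fun k => v (F k)) K.
Proof.
elim: K => [|K IH]; first by rewrite /winsum !big_ord0 flin0.
by rewrite !winsumS !flinD IH.
Qed.

End Linear.

(** Such a functional vanishes on the partial sums of the Fourier series of phi, and by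
    continuity it is small on the remainders; so v phi, which up to the factor 2 pi is
    its value on every remainder, is 0. *)
Lemma distr_eq0 (v : functional R) : is_distr v -> (forall k, v (expi R k) = 0) ->
  forall phi, v phi = 0.
Proof.
move=> [lv [N [C vC]]] v0 phi.
pose tail n j := zsum (fun k => normc (test_coef (iter n (@derive_test R) phi) k))
   - winsum (fun k => normc (test_coef (iter n (@derive_test R) phi) k)) j.
have tail0 n j : 0 <= tail n j.
  by apply: le_trans (remainder_le j (iter n (@derive_test R) phi) 0); exact: normc_ge0.
pose M j := \sum_(n < N.+1) tail n j.
have iterE n j : iter n (@derive_test R) (remainder j phi) =
    remainder j (iter n (@derive_test R) phi).
  by elim: n => [//|n IH] /=; rewrite IH derive_remainder.
have vr j : v (remainder j phi) = (2 * pi)%:C%C * v phi.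
  rewrite /remainder -scaleN1r flinD// !flinZ// flin_winsum//.
  rewrite (_ : winsum _ _ = 0) ?mulr0 ?addr0//.
  by apply: big1 => i _; rewrite !flinZ// !v0 !mulr0 addr0.
have bound j : normc ((2 * pi)%:C%C * v phi) <= C * M j.
  rewrite -(vr j); apply: vC => n x nN.
  have [-> ->] := derive1n_test n (remainder j phi); rewrite iterE.
  set P := remainder j _.
  have -> : Complex (re_fun P x) (im_fun P x) = ev P x by apply: complex_ext.
  apply: (le_trans (remainder_le j _ x)); rewrite -/(tail n j) /M.
  rewrite (bigD1 (Ordinal (nN : (n < N.+1)%N)))//= lerDl.
  by apply: sumr_ge0 => i _; exact: tail0.
have Mc : M j @[j --> \oo] --> (0 : R).
  rewrite /M; elim: (N.+1) => [|n IH].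
    by under eq_fun do rewrite big_ord0; exact: cvg_cst.
  have tc : tail n j @[j --> \oo] --> (0 : R).
    rewrite -(subrr (zsum (fun k => normc (test_coef (iter n (@derive_test R) phi) k)))).
    by apply: cvgB; [exact: cvg_cst|exact/zsum_cvg/test_coef_zsummable].
  have h : (\sum_(i < n) tail i j) + tail n j @[j --> \oo] --> (0 + 0 : R) by exact: cvgD.
  by rewrite addr0 in h; under eq_fun do rewrite big_ord_recr.
have : normc ((2 * pi)%:C%C * v phi) <= 0.
  have c : C * M j @[j --> \oo] --> C * 0 by exact: cvgMr.
  rewrite mulr0 in c.
  by apply: (ler_cvg_to (cvg_cst (normc ((2 * pi)%:C%C * v phi))) c); exact: nearW.
move=> h; have /Normc.eq0_normc/eqP : normc ((2 * pi)%:C%C * v phi) = 0.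
  by apply: le_anti; rewrite h normc_ge0.
rewrite mulf_eq0 => /orP[|/eqP//].
by rewrite eq_complex /= gt_eqF// twopi_gt0.
Qed.

End Convergence.

(** * Distributions and their Fourier coefficients *)
Section Distributions.
Variable R : realType.
Implicit Types (phi psi : test_fun R) (k : int) (x : R) (v w : functional R).

Local Notation D := (`[0, 2 * (pi : R)]%classic).
Local Notation mu := (@lebesgue_measure R).
Let mD := @measurable_period R.
Let fD := @measure_period_lty R.

Lemma fcoef_lin (a : R[i]) v w k : fcoef (a *: v + w) k = a * fcoef v k + fcoef w k.
Proof.
rewrite /fcoef; change ((a *: v + w) (expi R (- k))) with
  (a * v (expi R (- k)) + w (expi R (- k)) : R[i]); rewrite mulrDr mulrCA.
by [].
Qed.

Lemma fcoefD v w k : fcoef (v + w) k = fcoef v k + fcoef w k.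
Proof. by rewrite -[v]scale1r fcoef_lin scale1r mul1r. Qed.

Lemma fcoefZ (a : R[i]) v k : fcoef (a *: v) k = a * fcoef v k.
Proof.
have z : fcoef (0 : functional R) k = 0.
  by have := fcoef_lin (-1) 0 0 k; rewrite scaler0 addr0 mulN1r addNr.
by rewrite -[a *: v]addr0 fcoef_lin z addr0.
Qed.

Lemma fcoefN v k : fcoef (- v) k = - fcoef v k.
Proof. by rewrite -scaleN1r fcoefZ mulN1r. Qed.

Lemma fcoefB v w k : fcoef (v - w) k = fcoef v k - fcoef w k.
Proof. by rewrite fcoefD fcoefN. Qed.

Lemma is_distr_lin (a : R[i]) v w : is_distr v -> is_distr w -> is_distr (a *: v + w).
Proof.
move=> [lv [N [K vK]]] [lw [N' [K' wK]]]; split.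
  move=> b phi psi.
  change (a * v (b *: phi + psi) + w (b *: phi + psi) =
    b * (a * v phi + w phi) + (a * v psi + w psi)).
  rewrite !flinD// !flinZ//; ring.
exists (maxn N N'), (normc a * K + K') => phi M phiM.
change (normc (a * v phi + w phi) <= (normc a * K + K') * M).
apply: (le_trans (normcD _ _)); rewrite mulrDl -mulrA Normc.normcM lerD//.
  apply: ler_wpM2l; first exact: normc_ge0.
  by apply: vK => n x nN; apply: phiM; rewrite leq_max nN.
by apply: wK => n x nN; apply: phiM; rewrite leq_max nN orbT.
Qed.

Lemma is_distr0 : is_distr (0 : functional R).
Proof.
split; first by move=> b phi psi; rewrite [RHS]addr0 scaler0.
by exists 0%N, 0 => phi M _; rewrite mul0r Normc.normc0.
Qed.

Lemma is_distrD v w : is_distr v -> is_distr w -> is_distr (v + w).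
Proof. by move=> dv dw; rewrite -[v]scale1r; exact: is_distr_lin. Qed.

Lemma is_distrZ (a : R[i]) v : is_distr v -> is_distr (a *: v).
Proof. by move=> dv; rewrite -[a *: v]addr0; apply: is_distr_lin => //; exact: is_distr0. Qed.

Lemma is_distrN v : is_distr v -> is_distr (- v).
Proof. by rewrite -scaleN1r; exact: is_distrZ. Qed.

Lemma is_distrB v w : is_distr v -> is_distr w -> is_distr (v - w).
Proof. by move=> dv dw; apply: is_distrD => //; exact: is_distrN. Qed.

Lemma twopiVC : (2 * pi : R)%:C%C * ((2 * pi : R)^-1)%:C%C = 1 :> R[i].
Proof. by rewrite -rmorphM /= divff// gt_eqF// twopi_gt0. Qed.

Lemma distr_ext v w : is_distr v -> is_distr w ->
  (forall k, fcoef v k = fcoef w k) -> v = w.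
Proof.
move=> dv dw vw; apply/subr0_eq/funext => phi.
apply: distr_eq0 => [|k]; first exact: is_distrB.
have : fcoef (v - w) (- k) = 0 by rewrite fcoefB vw subrr.
rewrite /fcoef opprK => /(congr1 (fun z => (2 * pi)%:C%C * z)).
by rewrite mulrA twopiVC mul1r mulr0.
Qed.

Lemma is_distr_derive v : is_distr v -> is_distr (distr_derive v).
Proof.
move=> [lv [N [K vK]]]; split.
  move=> b phi psi; rewrite /distr_derive derive_testD derive_testZ.
  change (- v (b *: derive_test phi + derive_test psi) =
    b * - v (derive_test phi) - v (derive_test psi)).
  by rewrite !flinD// !flinZ// opprD mulrN.
exists N.+1, K => phi M phiM.
rewrite /distr_derive; change (normc (- v (derive_test phi) : R[i]) <= K * M).
rewrite (_ : normc _ = normc (v (derive_test phi))); last first.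
  by rewrite !normcE; congr Num.sqrt; exact: normc2N.
apply: vK => n x nN; have := phiM n.+1 x nN.
have [-> ->] := derive1n_test n (derive_test phi).
by have [-> ->] := derive1n_test n.+1 phi; rewrite iterSr.
Qed.

Lemma fcoef_derive v k : is_distr v -> fcoef (distr_derive v) k = ik R k * fcoef v k.
Proof.
move=> [lv _]; rewrite /fcoef /distr_derive derive_expi flinZ//.
have -> : ik R (- k) = - ik R k.
  by apply: complex_ext; rewrite !cpartE /= ?oppr0// mulrNz.
by rewrite mulNr opprK mulrCA.
Qed.

Lemma regular_distrE (f : R -> R[i]) phi :
  regular_distr f phi = cintegral D (fun x => f x * ev phi x).
Proof. by []. Qed.

Lemma fcoef_regular (f : R -> R[i]) k :
  fcoef (regular_distr f) k = ((2 * pi)^-1)%:C%C * fun_coef f k.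
Proof. by []. Qed.

Lemma is_distr_regular (f : R -> R[i]) : cLsq f -> is_distr (regular_distr f).
Proof.
move=> lf; have ci phi : cintegrable (fun x => f x * ev phi x).
  by apply: cLsqM => //; exact/cbounded_meas_cLsq/cbounded_meas_test.
split.
  move=> b phi psi; rewrite !regular_distrE.
  rewrite -[RHS]/(b * cintegral D (fun x => f x * ev phi x) + cintegral D (fun x => f x * ev psi x)).
  rewrite -cintZ// -cintD//; last exact: cintegrableZ.
  by apply: eq_cint => x _; rewrite test_funD test_funZ; ring.
have [lr li] := lf.
have ir := integrable_norm (Lsq_integrable mD fD lr).
have ii := integrable_norm (Lsq_integrable mD fD li).
pose A := \int[mu]_(x in D) (`|Re (f x)| + `|Im (f x)|).
exists 0%N, (2 * A) => phi M phiM.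
have h x : `|Re (ev phi x)| <= M /\ `|Im (ev phi x)| <= M.
  have := phiM 0%N x isT; rewrite (_ : Complex _ _ = ev phi x) => [hM|]; last exact: complex_ext.
  split.
    by apply: le_trans hM; exact: (Re_le_normc (ev phi x)).
  by apply: le_trans hM; exact: (Im_le_normc (ev phi x)).
have iA : mu.-integrable D (EFin \o (fun x => M * (`|Re (f x)| + `|Im (f x)|))).
  by apply: integrable_scalef; exact: integrable_addf.
have b (F : R -> R) : mu.-integrable D (EFin \o F) ->
   (forall x, `|F x| <= M * (`|Re (f x)| + `|Im (f x)|)) -> `|\int[mu]_(x in D) F x| <= A * M.
  move=> iF FM; apply: (le_trans (le_normr_Rintegral mD iF)).
  have -> : A * M = \int[mu]_(x in D) (M * (`|Re (f x)| + `|Im (f x)|)).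
    by rewrite RintegralZl; [exact: mulrC|exact: mD|exact: integrable_addf].
  by apply: le_Rintegral => //; exact: integrable_norm.
have [c1 c2] := ci phi.
rewrite regular_distrE; apply: (le_trans (normc_le _)).
rewrite -[2 * A * M]mulrA [2 * (A * M)]mulr_natl [(A * M) *+ 2]mulr2n.
apply: lerD; apply: b => // x; have [h1 h2] := h x.
  rewrite cReM; apply: (le_trans (ler_normB _ _)); rewrite !normrM mulrDr.
  by apply: lerD; rewrite mulrC ler_wpM2r.
rewrite cImM; apply: (le_trans (ler_normD _ _)); rewrite !normrM mulrDr.
by apply: lerD; rewrite mulrC ler_wpM2r.
Qed.

(** Riesz-Fischer provides a function with the coefficients of v, and distr_ext identifies
    v with it. *)
Lemma L2TP v : L2T v <-> is_distr v /\ zsummable (fun k => normc2 (fcoef v k)).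
Proof.
split=> [[f /square_integrableP lf ->]|[dv sv]].
  split; first exact: is_distr_regular.
  have := zsummableZ ((2 * pi)^-1 ^+ 2) (fun_coef_zsummable lf); congr zsummable.
  by apply/funext => k; rewrite fcoef_regular normc2M normc2_real.
have [f lf fc] := riesz_fischer sv; exists f; first exact/square_integrableP.
apply: distr_ext => //; first exact: is_distr_regular.
by move=> k; rewrite fcoef_regular fc mulrA [_ * (2 * pi)%:C%C]mulrC twopiVC mul1r.
Qed.

Lemma jap_ge1 k : 1 <= jap R k.
Proof. by rewrite -[leLHS]sqrtr1 ler_wsqrtr// lerDl sqr_ge0. Qed.

Lemma jap_sqr k : jap R k ^+ 2 = 1 + k%:~R ^+ 2.
Proof. by rewrite sqr_sqrtr// addr_ge0 ?sqr_ge0. Qed.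

Lemma jap_gt0 k : 0 < jap R k.
Proof. exact: lt_le_trans ltr01 (jap_ge1 k). Qed.

Lemma intr_sqr_ge1 k : k != 0 -> 1 <= (k%:~R : R) ^+ 2.
Proof.
move=> k0; rewrite -[leLHS](expr1n _ 2) -[k%:~R ^+ 2]real_normK ?num_real//.
rewrite lerXn2r// ?nnegrE// -intr_norm ler1z.
by rewrite -gtz0_ge1 normr_gt0.
Qed.

Lemma HsTP (s : R) v : HsT s v <->
  is_distr v /\ zsummable (fun k => jap R k `^ (2 * s) * normc2 (fcoef v k)).
Proof.
rewrite /HsT /=; have -> : (fun k => (jap R k `^ (2 * s) * normc (fcoef v k) ^+ 2)%:E)
   = (fun k => (jap R k `^ (2 * s) * normc2 (fcoef v k))%:E).
  by apply/funext => k; rewrite normc_sqr.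
have := @esum_lty R (fun k => jap R k `^ (2 * s) * normc2 (fcoef v k)).
move=> /(_ (fun k => mulr_ge0 (powR_ge0 _ _) (normc2_ge0 _))) [h1 h2].
by split=> -[dv sv]; split=> //; [exact: h1|exact: h2].
Qed.

Lemma HsT_mhalf v : HsT (- 2^-1) v <->
  is_distr v /\ zsummable (fun k => (jap R k)^-1 * normc2 (fcoef v k)).
Proof.
have e : (fun k => jap R k `^ (2 * - 2^-1) * normc2 (fcoef v k)) =
    (fun k => (jap R k)^-1 * normc2 (fcoef v k)).
  by apply/funext => k; rewrite mulrN divff// powR_inv1// ltW// jap_gt0.
by have := HsTP (- 2^-1) v; rewrite e.
Qed.

Lemma HsT_half v : HsT 2^-1 v <->
  is_distr v /\ zsummable (fun k => jap R k * normc2 (fcoef v k)).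
Proof.
have e : (fun k => jap R k `^ (2 * 2^-1) * normc2 (fcoef v k)) =
    (fun k => jap R k * normc2 (fcoef v k)).
  by apply/funext => k; rewrite divff// powRr1// ltW// jap_gt0.
by have := HsTP 2^-1 v; rewrite e.
Qed.

(** Dividing the nonzero modes by i k turns the weight into a square-summable sequence,
    so c is the sequence of coefficients of a constant plus the derivative of a
    square-integrable function. *)
Lemma distr_of_coef (c : int -> R[i]) : zsummable (fun k => (jap R k)^-1 * normc2 (c k)) ->
  exists2 v, is_distr v & forall k, fcoef v k = c k.
Proof.
move=> sc; pose b k := if k == 0 then 0 else c k / ik R k.
have nik k : normc2 (ik R k) = k%:~R ^+ 2 by rewrite /normc2 /= expr0n add0r.
have ikn k : k != 0 -> ik R k != 0.
  move=> k0; apply/eqP => /(congr1 (@normc2 R)); rewrite nik normc20.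
  by have := intr_sqr_ge1 k0 => h1 h2; move: h1; rewrite h2 ler10.
have sb : zsummable (fun k => normc2 (b k)).
  apply: zsummable_le (zsummableZ 2 sc) => k; rewrite ger0_norm ?normc2_ge0// /b.
  have j0 := jap_gt0 k.
  case: ifPn => k0; first by rewrite normc20 !mulr_ge0 ?invr_ge0 ?normc2_ge0// ltW.
  have e : normc2 (c k) = normc2 (c k / ik R k) * k%:~R ^+ 2.
    by rewrite -nik -normc2M divfK// ikn.
  rewrite e; set q := normc2 (c k / _); have q0 : 0 <= q by exact: normc2_ge0.
  rewrite mulrCA ler_pdivlMl// [_ * q]mulrC [2 * (q * _)]mulrCA; apply: ler_wpM2l => //.
  have := jap_sqr k; have := jap_ge1 k; have := intr_sqr_ge1 k0; rewrite expr2.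
  by set K := k%:~R * _; set J := jap R k; nra.
have [f lf fc] := riesz_fischer sb.
have d1 := is_distr_regular lf.
have d2 : is_distr (regular_distr (ev (expi R 0))).
  by apply: is_distr_regular; exact/cbounded_meas_cLsq/cbounded_meas_test.
exists (c 0 *: regular_distr (ev (expi R 0)) + distr_derive (regular_distr f)).
  by apply: is_distr_lin => //; exact: is_distr_derive.
move=> k; rewrite fcoef_lin fcoef_derive// !fcoef_regular fc.
have -> : fun_coef (ev (expi R 0)) k = test_coef (expi R 0) k by [].
have cancel (z : R[i]) : ((2 * pi)^-1)%:C%C * ((2 * pi)%:C%C * z) = z.
  by rewrite mulrA [X in X * z]mulrC twopiVC mul1r.
rewrite test_coef_expi cancel /b eq_sym.
have [->|k0] := eqVneq k 0.
  by rewrite mulr0 addr0 [_%:C%C * _]mulrC twopiVC mulr1.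
by rewrite mulr0 mulr0 add0r mulrCA divff ?mulr1// ikn.
Qed.

End Distributions.

(** * The multiplier p *)
Section Multiplier.
Variables (R : realType) (beta : R).
Hypothesis beta_gt0 : 0 < beta.
Implicit Types (k : int) (x t : R).

Local Notation p := (p_mult beta).

Lemma tanhN x : tanh (- x) = - tanh x.
Proof. by rewrite /tanh opprK -mulNr opprB [X in _ / X]addrC. Qed.

Lemma tanh0 : tanh 0 = 0 :> R.
Proof. by rewrite /tanh oppr0 subrr mul0r. Qed.

Lemma tanh_le1 x : tanh x <= 1.
Proof.
rewrite /tanh ler_pdivrMr ?addr_gt0 ?expR_gt0// mul1r.
by have := expR_gt0 (- x); lra.
Qed.

Lemma tanh_lower a x : a <= x -> (1 - expR (- (2 * a))) / 2 <= tanh x \/ x < 0.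
Proof.
move=> ax; have [x0|] := leP 0 x; [left|by right].
have E0 := expR_gt0 x; have F0 := expR_gt0 (- x).
rewrite /tanh ler_pdivlMr ?addr_gt0//.
have FE : expR (- x) <= expR x by rewrite ler_expR; lra.
have h : expR (- x) <= expR (- (2 * a)) * expR x by rewrite -expRD ler_expR; lra.
have G0 := expR_gt0 (- (2 * a)).
have [c0|c0] := leP 0 (1 - expR (- (2 * a))).
  have : (1 - expR (- (2 * a))) * expR (- x) <= (1 - expR (- (2 * a))) * expR x.
    exact: ler_wpM2l.
  by move: h; set E := expR x; set F := expR (- x); set G := expR _; lra.
have : 0 <= (expR (- (2 * a)) - 1) * (expR x + expR (- x)).
  by apply: mulr_ge0; [lra|rewrite addr_ge0 ?expR_ge0].
by move: FE; set E := expR x; set F := expR (- x); set G := expR _; lra.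
Qed.

Lemma p_mult0 : p 0 = 1. Proof. by rewrite /p_mult eqxx. Qed.

(** The identity that ties the operator to the inner product: it makes the operator
    skew-adjoint for the weight p. *)
Lemma m_multE k : m_mult beta k = k%:~R * p k.
Proof.
rewrite /m_mult /p_mult; case: eqVneq => [->|k0].
  by rewrite mul0r mulr0 tanh0 mul0r.
have K0 : (k%:~R : R) != 0 by rewrite intr_eq0.
have b0 : beta != 0 by rewrite gt_eqF.
set T := tanh _; move: (k%:~R : R) K0 T => K K0 T.
by field; rewrite K0 b0.
Qed.

Lemma p_mult_abs k : k != 0 ->
  p k = tanh (beta * `|k%:~R|) / (beta * `|k%:~R|).
Proof.
move=> k0; rewrite /p_mult (negbTE k0).
have [h|h] := leP 0 (k%:~R : R); first by rewrite ger0_norm.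
by rewrite (ltr0_norm h) !mulrN tanhN invrN mulrNN.
Qed.

Lemma abs_intr_ge1 k : k != 0 -> 1 <= `|k%:~R : R|.
Proof.
by move=> k0; rewrite -intr_norm ler1z -gtz0_ge1 normr_gt0.
Qed.

Lemma abs_le_jap k : `|k%:~R| <= jap R k.
Proof. by rewrite -sqrtr_sqr ler_wsqrtr// lerDr. Qed.

Lemma jap_le_abs k : k != 0 -> jap R k <= 2 * `|k%:~R|.
Proof.
move=> k0; have h := intr_sqr_ge1 R k0.
have a0 : 0 <= 2 * `|k%:~R : R| by rewrite mulr_ge0.
rewrite -(ger0_norm a0) -sqrtr_sqr ler_wsqrtr//.
rewrite exprMn real_normK ?num_real// (_ : (2 : R) ^+ 2 = 4); last by ring.
by move: h; set K := k%:~R ^+ 2; move: K => K; lra.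
Qed.

(** For nonzero k, tanh (beta |k|) lies between tanh beta and 1, and the bracket of k
    between |k| and 2 |k|. The constant c0 is a lower bound for tanh beta. *)
Lemma p_mult_bounds : exists c C : R, [/\ 0 < c, 0 < C &
  forall k, c <= p k * jap R k <= C].
Proof.
pose c0 : R := (1 - expR (- (2 * beta))) / 2.
have e1 : expR (- (2 * beta)) < 1 by rewrite expR_lt1 oppr_lt0 mulr_gt0.
have c00 : 0 < c0 by rewrite /c0 divr_gt0// subr_gt0.
exists (Num.min 1 (c0 / beta)), (1 + 2 / beta); split.
- by rewrite lt_min ltr01/= divr_gt0.
- by rewrite addr_gt0// divr_gt0.
move=> k; have [->|k0] := eqVneq k 0.
  have -> : jap R 0 = 1 by rewrite /jap expr0n/= addr0 sqrtr1.
  rewrite p_mult0 mulr1 ge_min lexx/= lerDl.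
  by rewrite divr_ge0// ltW.
have a1 := abs_intr_ge1 k0; have a0 : 0 < `|k%:~R : R| by exact: lt_le_trans ltr01 a1.
have T1 := tanh_le1 (beta * `|k%:~R|).
have T2 : c0 <= tanh (beta * `|k%:~R|).
  have [] := @tanh_lower beta (beta * `|k%:~R|) => //; first by rewrite ler_peMr// ltW.
  by rewrite ltNge mulr_ge0// ltW.
have j1 := abs_le_jap k; have j2 := jap_le_abs k0.
rewrite p_mult_abs//; set T := tanh _ in T1 T2 *; set a := `|_| in a1 a0 T1 T2 j1 j2 *.
set J := jap R k in j1 j2 *.
have -> : T / (beta * a) * J = T * (J / a) / beta by field; rewrite !gt_eqF.
have r1 : 1 <= J / a by rewrite ler_pdivlMr// mul1r.
have r2 : J / a <= 2 by rewrite ler_pdivrMr.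
have T0 : 0 <= T by apply: ltW; exact: lt_le_trans c00 T2.
apply/andP; split.
  rewrite ge_min; apply/orP; right; rewrite ler_pM2r ?invr_gt0//.
  by apply: (le_trans T2); rewrite ler_peMr.
rewrite -[leLHS]add0r lerD// ler_pM2r ?invr_gt0//.
apply: (le_trans (ler_wpM2l T0 r2)); rewrite ler_piMl//.
Qed.

Lemma p_mult_gt0 k : 0 < p k.
Proof.
have [c [C [c0 C0 h]]] := p_mult_bounds; have /andP[h1 _] := h k.
by have := lt_le_trans c0 h1; rewrite pmulr_lgt0// jap_gt0.
Qed.

End Multiplier.

(** * The system of one mode *)

Section Mode.
Variables (R : realType) (p kk : R).
Hypothesis p_gt0 : 0 < p.
Implicit Types (h u : R[i]) (t s : R).

Let q := Num.sqrt p.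
(** The system h' = - i kk p u, u' = - i kk h is (h, u)' = freq J (h, u), where J (h, u) =
    (Jh u, Ju h) satisfies J^2 = -1; its flow is cos (freq t) + sin (freq t) J. *)
Definition freq : R := kk * Num.sqrt p.

Definition Jh u : R[i] := Complex 0 (- Num.sqrt p) * u.
Definition Ju h : R[i] := Complex 0 (- (Num.sqrt p)^-1) * h.
Definition rot_h t h u : R[i] := (cos (freq * t))%:C%C * h + (sin (freq * t))%:C%C * Jh u.
Definition rot_u t h u : R[i] := (cos (freq * t))%:C%C * u + (sin (freq * t))%:C%C * Ju h.
Definition mode_energy h u : R := normc2 h + p * normc2 u.

Lemma q_gt0 : 0 < q. Proof. by rewrite sqrtr_gt0. Qed.
Lemma q_sqr : p = q ^+ 2. Proof. by rewrite sqr_sqrtr// ltW. Qed.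
Let q0 : q != 0. Proof. by rewrite gt_eqF// q_gt0. Qed.

Lemma mode_energy_ge0 h u : 0 <= mode_energy h u.
Proof. by rewrite addr_ge0 ?normc2_ge0// mulr_ge0 ?normc2_ge0// ltW. Qed.

Lemma mode_energy_eq0 h u : mode_energy h u = 0 -> h = 0 /\ u = 0.
Proof.
move=> /eqP; rewrite paddr_eq0 ?normc2_ge0//; last by rewrite mulr_ge0 ?normc2_ge0// ltW.
rewrite mulf_eq0 (gt_eqF p_gt0)/= => /andP[/eqP h0 /eqP u0].
by split; exact: normc2_eq0.
Qed.

(** J is skew for the energy of the mode and J^2 = -1. Besides the conservation
    of energy, this computes the energy of a difference of two rotations and
    of the error of a difference quotient, both of which are of the form a + b J. *)
Lemma mode_energy_lin (a b : R) h u :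
  mode_energy (a%:C%C * h + b%:C%C * Jh u) (a%:C%C * u + b%:C%C * Ju h) =
  (a ^+ 2 + b ^+ 2) * mode_energy h u.
Proof.
by rewrite /mode_energy /normc2 /Jh /Ju -/q q_sqr !cpartE /=; field.
Qed.

Lemma rot_energy t h u : mode_energy (rot_h t h u) (rot_u t h u) = mode_energy h u.
Proof. by rewrite mode_energy_lin cos2Dsin2 mul1r. Qed.

Lemma rot_ip t h u h' u' :
  rot_h t h u * ((rot_h t h' u')^*)%C + p%:C%C * rot_u t h u * ((rot_u t h' u')^*)%C =
  h * (h'^*)%C + p%:C%C * u * (u'^*)%C.
Proof.
have s2 : sin (freq * t) ^+ 2 = 1 - cos (freq * t) ^+ 2 by exact: sin2cos2.
rewrite /rot_h /rot_u /Jh /Ju -/q q_sqr; move: s2; set c := cos _; set s := sin _ => s2.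
by apply: complex_ext; rewrite !cpartE /=; field: s2.
Qed.

Lemma rot0 h u : rot_h 0 h u = h /\ rot_u 0 h u = u.
Proof. by rewrite /rot_h /rot_u mulr0 cos0 sin0 !mul1r !mul0r !addr0. Qed.

Lemma rotD s t h u : rot_h (s + t) h u = rot_h s (rot_h t h u) (rot_u t h u) /\
  rot_u (s + t) h u = rot_u s (rot_h t h u) (rot_u t h u).
Proof.
rewrite /rot_h /rot_u /Jh /Ju -/q mulrDr cosD sinD.
by split; apply: complex_ext; rewrite !cpartE /=; field.
Qed.

Lemma rot_lin t (a : R[i]) h u h' u' :
  rot_h t (a * h + h') (a * u + u') = a * rot_h t h u + rot_h t h' u' /\
  rot_u t (a * h + h') (a * u + u') = a * rot_u t h u + rot_u t h' u'.
Proof. by rewrite /rot_h /rot_u /Jh /Ju; split; ring. Qed.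

End Mode.

Section RealDerivative.
Variable R : realType.
Implicit Types (f : R -> R) (s t w a b l : R).

Lemma is_derive_quotP f t l :
  is_derive t 1 f l <-> (s^-1 * (f (t + s) - f t) @[s --> 0^'] --> l).
Proof.
have E : (fun s : R => s^-1 * (f (t + s) - f t)) =
    (fun s : R => s^-1 *: ((f \o shift t) (s *: 1) - f t)).
  by apply/funext => s; rewrite /= /GRing.scale/= mulr1 [t + s]addrC.
rewrite E; split=> [[d <-]|c].
  exact: d.
by apply: DeriveDef; [apply/cvg_ex; exists l|apply: cvg_lim].
Qed.

Lemma trig_derive w a b t : is_derive t 1 (fun t => cos (w * t) * a + sin (w * t) * b)
  (w * (cos (w * t) * b - sin (w * t) * a)).
Proof. by apply: is_derive_eq; rewrite /GRing.scale/=; ring. Qed.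

Lemma cos_lip s t : `|cos s - cos t| <= `|s - t|.
Proof.
have H x y : x <= y -> `|cos y - cos x| <= `|y - x| :> R.
  move=> xy; have [c _ ->] := @mean_value R (@cos R) (fun x => - sin x) x y
    (fun x => is_derive_cos x) xy.
  by rewrite normrM normrN ler_piMl// sin_max.
by have [h|/ltW h] := leP t s; [exact: H|rewrite distrC [leRHS]distrC; exact: H].
Qed.

Lemma sin_lip s t : `|sin s - sin t| <= `|s - t|.
Proof.
have H x y : x <= y -> `|sin y - sin x| <= `|y - x| :> R.
  move=> xy; have [c _ ->] := @mean_value R (@sin R) cos x y
    (fun x => is_derive_sin x) xy.
  by rewrite normrM ler_piMl// cos_max.
by have [h|/ltW h] := leP t s; [exact: H|rewrite distrC [leRHS]distrC; exact: H].
Qed.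

(** The errors of the difference quotients of cos (w t) and sin (w t). Their bound by a
    multiple of w is uniform in s, as dominated convergence requires. *)
Definition cos_quot w t s : R := s^-1 * (cos (w * (t + s)) - cos (w * t)) + w * sin (w * t).
Definition sin_quot w t s : R := s^-1 * (sin (w * (t + s)) - sin (w * t)) - w * cos (w * t).

Lemma quot_le f w t s : (forall x y, `|f x - f y| <= `|x - y|) ->
  `|s^-1 * (f (w * (t + s)) - f (w * t))| <= `|w|.
Proof.
move=> fl; have [->|s0] := eqVneq s 0; first by rewrite invr0 mul0r normr0.
rewrite normrM normfV ler_pdivrMl ?normr_gt0//.
apply: (le_trans (fl _ _)).
have -> : w * (t + s) - w * t = s * w by ring.
by rewrite normrM.
Qed.

Lemma trig_quot_bound w t s : cos_quot w t s ^+ 2 + sin_quot w t s ^+ 2 <= 8 * w ^+ 2.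
Proof.
have h1 := quot_le w t s cos_lip; have h2 := quot_le w t s sin_lip.
have b1 : `|cos_quot w t s| <= 2 * `|w|.
  apply: (le_trans (ler_normD _ _)); rewrite mulr2n mulrDl mul1r lerD//.
  by rewrite normrM ler_piMr// sin_max.
have b2 : `|sin_quot w t s| <= 2 * `|w|.
  apply: (le_trans (ler_normB _ _)); rewrite mulr2n mulrDl mul1r lerD//.
  by rewrite normrM ler_piMr// cos_max.
have sq (x : R) : `|x| <= 2 * `|w| -> x ^+ 2 <= 4 * w ^+ 2.
  move=> h; rewrite -[x ^+ 2]real_normK ?num_real// -[w ^+ 2]real_normK ?num_real//.
  have -> : 4 * `|w| ^+ 2 = (2 * `|w|) ^+ 2 by rewrite exprMn; congr (_ * _); ring.
  by rewrite lerXn2r// nnegrE ?mulr_ge0.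
have -> : 8 * w ^+ 2 = 4 * w ^+ 2 + 4 * w ^+ 2 by ring.
by apply: lerD; apply: sq.
Qed.

Lemma cvg_addc (T : Type) (F : set_system T) {FF : Filter F} (f : T -> R) l k :
  f s @[s --> F] --> l -> l + k = 0 -> f s + k @[s --> F] --> (0 : R).
Proof. by move=> fl <-; apply: cvgD => //; exact: cvg_cst. Qed.

Lemma trig_quot_cvg w t : cos_quot w t s ^+ 2 + sin_quot w t s ^+ 2 @[s --> 0^'] --> (0 : R).
Proof.
have d1 := trig_derive w 1 0 t; have d2 := trig_derive w 0 1 t.
have c1 : cos_quot w t s @[s --> 0^'] --> (0 : R).
  move: d1 => /is_derive_quotP h.
  have -> : cos_quot w t = (fun s => s^-1 * (cos (w * (t + s)) * 1 + sin (w * (t + s)) * 0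
      - (cos (w * t) * 1 + sin (w * t) * 0)) + w * sin (w * t)).
    by apply/funext => s; rewrite /cos_quot; ring.
  by apply: (cvg_addc h); ring.
have c2 : sin_quot w t s @[s --> 0^'] --> (0 : R).
  move: d2 => /is_derive_quotP h.
  have -> : sin_quot w t = (fun s => s^-1 * (cos (w * (t + s)) * 0 + sin (w * (t + s)) * 1
      - (cos (w * t) * 0 + sin (w * t) * 1)) - w * cos (w * t)).
    by apply/funext => s; rewrite /sin_quot; ring.
  by apply: (cvg_addc h); ring.
have -> : (fun s => cos_quot w t s ^+ 2 + sin_quot w t s ^+ 2) =
    (fun s => cos_quot w t s * cos_quot w t s + sin_quot w t s * sin_quot w t s).
  by apply/funext => s; rewrite !expr2.
have c : cos_quot w t s * cos_quot w t s + sin_quot w t s * sin_quot w t s @[s --> 0^'] --> (0 * 0 + 0 * 0 : R).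
  by apply: cvgD; exact: cvgM.
by rewrite mulr0 addr0 in c.
Qed.

End RealDerivative.

Section ModeEvolution.
Variables (R : realType) (p kk : R).
Hypothesis p_gt0 : 0 < p.
Implicit Types (h u : R[i]) (t s : R).

Local Notation w := (freq p kk).
Local Notation Rh := (rot_h p kk).
Local Notation Ru := (rot_u p kk).
Local Notation m := (kk * p).

Let q := Num.sqrt p.
Let q0 : q != 0. Proof. by rewrite gt_eqF// sqrtr_gt0. Qed.
Let pq : p = q ^+ 2. Proof. by rewrite sqr_sqrtr// ltW. Qed.

(** The system a' = - i m b, b' = - i kk a, written for the real and imaginary
    parts in order to use the derivatives of real functions. *)
Definition mode_ode (a b : R -> R[i]) := forall t,
  [/\ is_derive t 1 (fun s => Re (a s)) (m * Im (b t)),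
      is_derive t 1 (fun s => Im (a s)) (- m * Re (b t)),
      is_derive t 1 (fun s => Re (b s)) (kk * Im (a t)) &
      is_derive t 1 (fun s => Im (b s)) (- kk * Re (a t))].

Lemma rot_mode_ode h u : mode_ode (fun t => Rh t h u) (fun t => Ru t h u).
Proof.
have ReRh t : Re (Rh t h u) = cos (w * t) * Re h + sin (w * t) * (q * Im u).
  by rewrite /rot_h /Jh !cpartE /= -/q; ring.
have ImRh t : Im (Rh t h u) = cos (w * t) * Im h + sin (w * t) * (- (q * Re u)).
  by rewrite /rot_h /Jh !cpartE /= -/q; ring.
have ReRu t : Re (Ru t h u) = cos (w * t) * Re u + sin (w * t) * (q^-1 * Im h).
  by rewrite /rot_u /Ju !cpartE /= -/q; ring.
have ImRu t : Im (Ru t h u) = cos (w * t) * Im u + sin (w * t) * (- (q^-1 * Re h)).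
  by rewrite /rot_u /Ju !cpartE /= -/q; ring.
have wq : w = kk * q by [].
move=> t; split.
- have -> : (fun s => Re (Rh s h u)) = _ := funext ReRh.
  by apply: (is_derive_eq (trig_derive _ _ _ _)); rewrite ImRu wq pq; field.
- have -> : (fun s => Im (Rh s h u)) = _ := funext ImRh.
  by apply: (is_derive_eq (trig_derive _ _ _ _)); rewrite ReRu wq pq; field.
- have -> : (fun s => Re (Ru s h u)) = _ := funext ReRu.
  by apply: (is_derive_eq (trig_derive _ _ _ _)); rewrite ImRh wq; field.
- have -> : (fun s => Im (Ru s h u)) = _ := funext ImRu.
  by apply: (is_derive_eq (trig_derive _ _ _ _)); rewrite ReRh wq; field.
Qed.

(** The error of the difference quotient of a rotation is of the form a + b J, which
    makes mode_energy_lin applicable. *)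
Lemma rot_quot h u t s :
  (s^-1)%:C%C * (Rh (t + s) h u - Rh t h u) - Complex 0 (- m) * Ru t h u =
    (cos_quot w t s)%:C%C * h + (sin_quot w t s)%:C%C * Jh p u /\
  (s^-1)%:C%C * (Ru (t + s) h u - Ru t h u) - Complex 0 (- kk) * Rh t h u =
    (cos_quot w t s)%:C%C * u + (sin_quot w t s)%:C%C * Ju p h.
Proof.
rewrite /rot_h /rot_u /Jh /Ju /cos_quot /sin_quot -/q.
have wq : w = kk * q by [].
set c := cos _; set d := sin _; set c' := cos _; set d' := sin _.
set i := s^-1; rewrite wq pq; move: i c d c' d' => i c d c' d'.
by split; apply: complex_ext; rewrite !cpartE /=; field.
Qed.

(** The energy of the difference of two solutions is constant. *)
Lemma mode_ode_uniq a b a' b' : mode_ode a b -> mode_ode a' b' ->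
  a 0 = a' 0 -> b 0 = b' 0 -> forall t, a t = a' t /\ b t = b' t.
Proof.
move=> ab ab' a0 b0 t.
pose x1 s := Re (a s) - Re (a' s); pose y1 s := Im (a s) - Im (a' s).
pose x2 s := Re (b s) - Re (b' s); pose y2 s := Im (b s) - Im (b' s).
pose E s := x1 s * x1 s + y1 s * y1 s + p * (x2 s * x2 s + y2 s * y2 s).
have dE s : is_derive s 1 E 0.
  have [d1 d2 d3 d4] := ab s; have [d1' d2' d3' d4'] := ab' s.
  have e1 : is_derive s 1 x1 (m * y2 s).
    by refine (is_derive_eq (is_deriveB d1 d1') _); rewrite /y2; ring.
  have e2 : is_derive s 1 y1 (- m * x2 s).
    by refine (is_derive_eq (is_deriveB d2 d2') _); rewrite /x2; ring.
  have e3 : is_derive s 1 x2 (kk * y1 s).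
    by refine (is_derive_eq (is_deriveB d3 d3') _); rewrite /y1; ring.
  have e4 : is_derive s 1 y2 (- kk * x1 s).
    by refine (is_derive_eq (is_deriveB d4 d4') _); rewrite /x1; ring.
  have g := is_deriveD (is_deriveD (is_deriveM e1 e1) (is_deriveM e2 e2))
    (is_deriveZ p (is_deriveD (is_deriveM e3 e3) (is_deriveM e4 e4))).
  refine (is_derive_eq g _); rewrite /GRing.scale /=.
  by move: (x1 s) (x2 s) (y1 s) (y2 s) => *; ring.
have E0 : E t = 0.
  rewrite (@is_derive_0_is_cst R E t 0 dE) /E /x1 /y1 /x2 /y2 a0 b0 !subrr; ring.
have : mode_energy p (a t - a' t) (b t - b' t) = 0.
  by rewrite -E0 /mode_energy /E /normc2 /x1 /y1 /x2 /y2 !cpartE; ring.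
by move=> /(mode_energy_eq0 p_gt0)[/subr0_eq e1 /subr0_eq e2].
Qed.

End ModeEvolution.

(** * States through their Fourier coefficients *)
Section States.
Variables (R : realType) (beta : R).
Hypothesis beta_gt0 : 0 < beta.
Implicit Types (k : int) (t : R) (Z W X V : state R).

Local Notation p := (p_mult beta).
Let p_gt0 k : 0 < p k. Proof. exact: p_mult_gt0. Qed.

Definition hcoef Z k : R[i] := fcoef Z.1 k.
Definition ucoef Z k : R[i] := fcoef Z.2 k.
Definition mode_freq k : R := freq (p k) k%:~R.
Definition energy_at Z k : R := mode_energy (p k) (hcoef Z k) (ucoef Z k).

Lemma mode_freq_sqr k : mode_freq k ^+ 2 = k%:~R ^+ 2 * p k.
Proof. by rewrite /mode_freq /freq exprMn sqr_sqrtr// ltW. Qed.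

Lemma hcoef_lin (a : R[i]) Z W k : hcoef (a *: Z + W) k = a * hcoef Z k + hcoef W k.
Proof. exact: (fcoef_lin a Z.1 W.1 k). Qed.
Lemma ucoef_lin (a : R[i]) Z W k : ucoef (a *: Z + W) k = a * ucoef Z k + ucoef W k.
Proof. exact: (fcoef_lin a Z.2 W.2 k). Qed.
Lemma hcoefB Z W k : hcoef (Z - W) k = hcoef Z k - hcoef W k.
Proof. exact: (fcoefB Z.1 W.1 k). Qed.
Lemma ucoefB Z W k : ucoef (Z - W) k = ucoef Z k - ucoef W k.
Proof. exact: (fcoefB Z.2 W.2 k). Qed.
Lemma hcoefZ (a : R[i]) Z k : hcoef (a *: Z) k = a * hcoef Z k.
Proof. exact: (fcoefZ a Z.1 k). Qed.
Lemma ucoefZ (a : R[i]) Z k : ucoef (a *: Z) k = a * ucoef Z k.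
Proof. exact: (fcoefZ a Z.2 k). Qed.
Lemma hcoefD Z W k : hcoef (Z + W) k = hcoef Z k + hcoef W k.
Proof. exact: (fcoefD Z.1 W.1 k). Qed.
Lemma ucoefD Z W k : ucoef (Z + W) k = ucoef Z k + ucoef W k.
Proof. exact: (fcoefD Z.2 W.2 k). Qed.

Lemma energy_at_ge0 Z k : 0 <= energy_at Z k. Proof. exact: mode_energy_ge0. Qed.

Lemma energy_at_lin_le (a : R[i]) Z W k :
  energy_at (a *: Z + W) k <= 2 * (normc2 a * energy_at Z k + energy_at W k).
Proof.
rewrite /energy_at /mode_energy hcoef_lin ucoef_lin.
have h1 := normc2D_le (a * hcoef Z k) (hcoef W k); have h2 := normc2D_le (a * ucoef Z k) (ucoef W k).
have h3 := ler_wpM2l (ltW (p_gt0 k)) h2.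
move: h1 h3; rewrite !(normc2M a).
have -> : 2 * (normc2 a * (normc2 (hcoef Z k) + p k * normc2 (ucoef Z k)) + (normc2 (hcoef W k) + p k * normc2 (ucoef W k)))
  = 2 * (normc2 a * normc2 (hcoef Z k) + normc2 (hcoef W k)) + p k * (2 * (normc2 a * normc2 (ucoef Z k) + normc2 (ucoef W k))).
  by ring.
exact: lerD.
Qed.

(** By p_mult_bounds, the weight p is equivalent to the weight of H^(-1/2). *)
Lemma energyP Z : energy_space Z <-> [/\ is_distr Z.1, is_distr Z.2 & zsummable (energy_at Z)].
Proof.
have [c [C [c0 C0 pb]]] := p_mult_bounds beta_gt0.
rewrite /energy_space /=; split=> [[/L2TP[d1 s1] /HsT_mhalf[d2 s2]]|[d1 d2 s]].
  split=> //; apply: (zsummable_le _ (zsummableD s1 (zsummableZ C s2))) => k.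
  rewrite ger0_norm ?energy_at_ge0// /energy_at /mode_energy lerD2l mulrA ler_wpM2r ?normc2_ge0//.
  by rewrite ler_pdivlMr ?jap_gt0//; have /andP[_] := pb k.
split; [apply/L2TP|apply/HsT_mhalf]; split=> //.
  apply: (zsummable_le _ s) => k; rewrite ger0_norm ?normc2_ge0// lerDl.
  by rewrite mulr_ge0 ?normc2_ge0// ltW.
apply: (zsummable_le _ (zsummableZ c^-1 s)) => k.
have j0 := jap_gt0 R k.
rewrite ger0_norm ?mulr_ge0 ?normc2_ge0 ?invr_ge0 ?(ltW j0)//.
rewrite /energy_at /mode_energy [leRHS]mulrDr -[leLHS]add0r lerD//.
  by rewrite mulr_ge0 ?normc2_ge0// invr_ge0 ltW.
rewrite mulrA ler_wpM2r ?normc2_ge0// ler_pdivlMl// ler_pdivrMr//.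
by have /andP[] := pb k.
Qed.

(** With w^2 = k^2 p, the weight of the domain on h is k^2 p, comparable for
    nonzero k with the bracket of k, and on u it is k^2 p^2, comparable with 1; adding the
    energy itself accounts for the zero mode. *)
Lemma A_domP Z : A_dom Z <->
  [/\ is_distr Z.1, is_distr Z.2, zsummable (energy_at Z) &
      zsummable (fun k => mode_freq k ^+ 2 * energy_at Z k)].
Proof.
have [c [C [c0 C0 pb]]] := p_mult_bounds beta_gt0.
have j0 k : 0 < jap R k by exact: jap_gt0.
have pC k : p k <= C.
  have /andP[_] := pb k; apply: le_trans; rewrite ler_peMr ?jap_ge1// ltW//.
rewrite /A_dom /=; split=> [[/HsT_half[d1 s1] /L2TP[d2 s2]]|[d1 d2 s1 s2]].
  split=> //.
    apply: (zsummable_le _ (zsummableD s1 (zsummableZ C s2))) => k.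
    rewrite ger0_norm ?energy_at_ge0// /energy_at /mode_energy lerD//.
      by rewrite ler_peMl ?normc2_ge0// jap_ge1.
    by rewrite ler_wpM2r ?normc2_ge0.
  apply: (zsummable_le _ (zsummableD (zsummableZ C s1) (zsummableZ (C ^+ 2) s2))) => k.
  rewrite ger0_norm; last by rewrite mulr_ge0 ?energy_at_ge0 ?sqr_ge0.
  have k2 : k%:~R ^+ 2 * p k <= C * jap R k.
    rewrite -(ler_pM2r (j0 k)) -mulrA -[C * _ * _]mulrA -expr2 jap_sqr mulrC.
    apply: ler_pM; rewrite ?sqr_ge0 ?mulr_ge0 ?(ltW (p_gt0 k)) ?(ltW (j0 k))//.
      by have /andP[] := pb k.
    by rewrite lerDr.
  have k3 : k%:~R ^+ 2 * p k * p k <= C ^+ 2.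
    rewrite -mulrA -expr2; have /andP[_ h] := pb k.
    have : (p k * jap R k) ^+ 2 <= C ^+ 2.
      by rewrite lerXn2r// nnegrE ?mulr_ge0 ?(ltW (p_gt0 k)) ?(ltW (j0 k)) ?(ltW C0).
    rewrite exprMn jap_sqr mulrDr mulr1 [_ * p k ^+ 2]mulrC; apply: le_trans.
    by rewrite lerDr sqr_ge0.
  rewrite mode_freq_sqr /energy_at /mode_energy [leLHS]mulrDr lerD//.
    by rewrite [leRHS]mulrA ler_wpM2r ?normc2_ge0.
  by rewrite mulrA ler_wpM2r ?normc2_ge0.
split; [apply/HsT_half|apply/L2TP]; split=> //.
  apply: (zsummable_le _ (zsummableZ (1 + c^-1) (zsummableD s1 s2))) => k.
  rewrite ger0_norm ?mulr_ge0 ?normc2_ge0 ?(ltW (j0 k))//.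
  have h1 : jap R k <= 1 + c^-1 * (k%:~R ^+ 2 * p k).
    rewrite -(ler_pM2r (j0 k)) -expr2 jap_sqr mulrDl mul1r lerD ?jap_ge1//.
    have /andP[h _] := pb k.
    have : c^-1 * k%:~R ^+ 2 * c <= c^-1 * k%:~R ^+ 2 * (p k * jap R k).
      by rewrite ler_wpM2l// mulr_ge0 ?sqr_ge0// invr_ge0 ltW.
    rewrite mulrAC mulVf ?mul1r ?gt_eqF//; congr (_ <= _); ring.
  have := ler_wpM2r (normc2_ge0 (hcoef Z k)) h1; rewrite -/(hcoef Z k) => h2; apply: (le_trans h2).
  rewrite mode_freq_sqr /energy_at /mode_energy.
  have n1 := normc2_ge0 (hcoef Z k); have n2 := mulr_ge0 (ltW (p_gt0 k)) (normc2_ge0 (ucoef Z k)).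
  have q0 := mulr_ge0 (sqr_ge0 (k%:~R : R)) (ltW (p_gt0 k)).
  have c1 : 0 <= c^-1 by rewrite invr_ge0 ltW.
  set H := normc2 _ in n1 h2 *; set U := p k * normc2 _ in n2 *; set q := _ * p k in q0 h1 h2 *; set d := c^-1 in c1 h1 h2 *.
  have -> : (1 + d) * (H + U + q * (H + U)) =
    (1 + d * q) * H + (d * H + q * H + U + d * U + q * U + d * q * U) by ring.
  by rewrite lerDl !addr_ge0//; do ?[apply: mulr_ge0 => //].
apply: (zsummable_le _ (zsummableZ ((1 + C) / c ^+ 2) (zsummableD s1 s2))) => k.
rewrite ger0_norm ?normc2_ge0//.
have h1 : 1 <= (1 + C) / c ^+ 2 * (p k + k%:~R ^+ 2 * p k * p k).
  rewrite mulrAC ler_pdivlMr ?exprn_gt0// mul1r.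
  have /andP[h _] := pb k.
  have : c ^+ 2 <= (p k * jap R k) ^+ 2.
    by rewrite lerXn2r// nnegrE ?mulr_ge0 ?(ltW (p_gt0 k)) ?(ltW (j0 k)) ?(ltW c0).
  rewrite exprMn jap_sqr mulrDr mulr1 => /le_trans; apply.
  have -> : (1 + C) * (p k + k%:~R ^+ 2 * p k * p k) =
    C * p k + p k ^+ 2 * k%:~R ^+ 2 + (p k + C * (k%:~R ^+ 2 * p k * p k)) by ring.
  rewrite -[leLHS]addr0 lerD//; last first.
    apply: addr_ge0; first exact: ltW.
    apply: mulr_ge0; first exact: ltW.
    by apply: mulr_ge0; [apply: mulr_ge0; [exact: sqr_ge0|exact: ltW]|exact: ltW].
  by rewrite lerD2r expr2 ler_wpM2r// ltW.
have := ler_wpM2r (normc2_ge0 (ucoef Z k)) h1; rewrite mul1r => h2; apply: (le_trans h2).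
rewrite -[leLHS]mulrA ler_wpM2l//.
  by rewrite divr_ge0 ?sqr_ge0// addr_ge0// ltW.
rewrite mode_freq_sqr /energy_at /mode_energy -/(hcoef Z k) -/(ucoef Z k).
have n1 := normc2_ge0 (hcoef Z k); have n2 := normc2_ge0 (ucoef Z k).
have q1 := mulr_ge0 (sqr_ge0 (k%:~R : R)) (ltW (p_gt0 k)).
set H := normc2 (hcoef Z k) in n1 *; set U := normc2 (ucoef Z k) in n2 *; set q := _ * p k in q1 *.
have -> : H + p k * U + q * (H + p k * U) = (p k + q * p k) * U + (H + q * H) by ring.
by rewrite lerDl addr_ge0//; apply: mulr_ge0.
Qed.

Lemma A_dom_energy Z : A_dom Z -> energy_space Z.
Proof. by move=> /A_domP[d1 d2 s _]; apply/energyP. Qed.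

Lemma energy_lin (a : R[i]) Z W : energy_space Z -> energy_space W ->
  energy_space (a *: Z + W).
Proof.
move=> /energyP[d1 d2 s] /energyP[d1' d2' s']; apply/energyP; split.
- exact: (is_distr_lin a d1 d1').
- exact: (is_distr_lin a d2 d2').
apply: (zsummable_le _ (zsummableZ 2 (zsummableD (zsummableZ (normc2 a) s) s'))) => k.
by rewrite ger0_norm ?energy_at_ge0// energy_at_lin_le.
Qed.

Lemma energyB Z W : energy_space Z -> energy_space W -> energy_space (Z - W).
Proof. by move=> eZ eW; rewrite addrC -scaleN1r; exact: energy_lin. Qed.

Lemma energyZ (a : R[i]) Z : energy_space Z -> energy_space (a *: Z).
Proof.
move=> eZ; have -> : a *: Z = (a - 1) *: Z + Z by rewrite scalerBl scale1r subrK.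
exact: energy_lin.
Qed.

Lemma A_dom_lin (a : R[i]) Z W : A_dom Z -> A_dom W -> A_dom (a *: Z + W).
Proof.
move=> /A_domP[d1 d2 s r] /A_domP[d1' d2' s' r']; apply/A_domP; split.
- exact: (is_distr_lin a d1 d1').
- exact: (is_distr_lin a d2 d2').
- apply: (zsummable_le _ (zsummableZ 2 (zsummableD (zsummableZ (normc2 a) s) s'))) => k.
  by rewrite ger0_norm ?energy_at_ge0// energy_at_lin_le.
- apply: (zsummable_le _ (zsummableZ 2 (zsummableD (zsummableZ (normc2 a) r) r'))) => k.
  rewrite ger0_norm; last by rewrite mulr_ge0 ?energy_at_ge0 ?sqr_ge0.
  have := ler_wpM2l (sqr_ge0 (mode_freq k)) (energy_at_lin_le a Z W k); congr (_ <= _); ring.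
Qed.

Lemma A_domB Z W : A_dom Z -> A_dom W -> A_dom (Z - W).
Proof. by move=> eZ eW; rewrite addrC -scaleN1r; exact: A_dom_lin. Qed.

Lemma state_ext Z W : energy_space Z -> energy_space W ->
  (forall k, hcoef Z k = hcoef W k) -> (forall k, ucoef Z k = ucoef W k) -> Z = W.
Proof.
move=> /energyP[d1 d2 _] /energyP[d1' d2' _] h u.
rewrite [Z]surjective_pairing [W]surjective_pairing; congr pair; exact: distr_ext.
Qed.

Definition dist_of (c : int -> R[i]) : functional R :=
  xget 0 [set w | is_distr w /\ forall k, fcoef w k = c k].

Definition state_of (a b : int -> R[i]) : state R := (dist_of a, dist_of b).

(** Both sequences satisfy the condition of distr_of_coef, the second one by the lower bound
    on p. *)
Lemma state_ofP (a b : int -> R[i]) : zsummable (fun k => mode_energy (p k) (a k) (b k)) ->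
  [/\ energy_space (state_of a b), forall k, hcoef (state_of a b) k = a k &
      forall k, ucoef (state_of a b) k = b k].
Proof.
have [c [C [c0 C0 pb]]] := p_mult_bounds beta_gt0.
move=> s.
have D (e : int -> R[i]) K : (forall k, (jap R k)^-1 * normc2 (e k) <= K * mode_energy (p k) (a k) (b k)) ->
    is_distr (dist_of e) /\ forall k, fcoef (dist_of e) k = e k.
  move=> eK; have [v dv ve] : exists2 v, is_distr v & forall k, fcoef v k = e k.
    apply: distr_of_coef; apply: (zsummable_le _ (zsummableZ K s)) => k.
    by rewrite ger0_norm// mulr_ge0 ?normc2_ge0// invr_ge0 ltW// jap_gt0.
  exact: (@xgetPex _ 0 [set w | is_distr w /\ forall k, fcoef w k = e k] (ex_intro _ v (conj dv ve))).
have j0 k : 0 < jap R k by exact: jap_gt0.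
have [da ha] : is_distr (dist_of a) /\ forall k, fcoef (dist_of a) k = a k.
  apply: (@D _ 1) => k; rewrite mul1r -[leLHS]addr0 lerD//.
    by rewrite ler_piMl ?normc2_ge0// invf_le1// jap_ge1.
  by rewrite mulr_ge0 ?normc2_ge0// ltW.
have [db hb] : is_distr (dist_of b) /\ forall k, fcoef (dist_of b) k = b k.
  apply: (@D _ c^-1) => k; rewrite [leRHS]mulrDr -[leLHS]add0r lerD//.
    by rewrite mulr_ge0 ?normc2_ge0// invr_ge0 ltW.
  rewrite mulrA ler_wpM2r ?normc2_ge0// ler_pdivlMl// ler_pdivrMr//.
  by have /andP[] := pb k.
split=> //; apply/energyP; split=> //.
by move: s; congr zsummable; apply/funext => k; rewrite /energy_at /hcoef /ucoef ha hb.
Qed.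

(** The energy of the image in mode k is (k p)^2 |u|^2 + p k^2 |h|^2, that is, k^2 p times
    the energy of the mode. The multiplier in A_op denotes the distribution with the
    required coefficients once one exists. *)
Lemma A_opP Z : A_dom Z -> [/\ energy_space (A_op beta Z),
  forall k, hcoef (A_op beta Z) k = Complex 0 (- (k%:~R * p k)) * ucoef Z k,
  forall k, ucoef (A_op beta Z) k = Complex 0 (- k%:~R) * hcoef Z k &
  forall k, energy_at (A_op beta Z) k = mode_freq k ^+ 2 * energy_at Z k].
Proof.
move=> AZ; have /A_domP[d1 d2 s r] := AZ.
pose e k : R[i] := Complex 0 (- (k%:~R * p k)) * ucoef Z k.
pose f k : R[i] := Complex 0 (- k%:~R) * hcoef Z k.
have ef k : mode_energy (p k) (e k) (f k) = mode_freq k ^+ 2 * energy_at Z k.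
  rewrite mode_freq_sqr /e /f /energy_at /mode_energy
    (normc2M _ (ucoef Z k)) (normc2M _ (hcoef Z k)) !normc2_imag.
  by move: (normc2 (hcoef Z k)) (normc2 (ucoef Z k)) => *; ring.
have se : zsummable (fun k => mode_energy (p k) (e k) (f k)) by move: r; congr zsummable; apply/funext.
have [E1 E2 E3] := state_ofP se.
have dT : is_distr (T_op beta Z.2) /\ forall k, fcoef (T_op beta Z.2) k = e k.
  have -> : T_op beta Z.2 = dist_of e.
    rewrite /T_op /fourier_multiplier /dist_of; congr xget.
    apply/seteqP; split=> w /= [dw wk]; split=> // k; rewrite wk /e /ucoef;
      congr (_ * _); apply: complex_ext; rewrite !cpartE /= m_multE//; ring.
  by have /energyP[] := E1; split=> // k; rewrite -[LHS]/(hcoef (state_of e f) k).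
have [dT1 dT2] := dT.
have u k : ucoef (A_op beta Z) k = f k.
  rewrite /ucoef /A_op /= fcoefN fcoef_derive// -mulNr /f; congr (_ * _).
  by apply: complex_ext; rewrite !cpartE /= ?oppr0.
have NA k : energy_at (A_op beta Z) k = mode_freq k ^+ 2 * energy_at Z k.
  by rewrite -ef /energy_at u {1}/hcoef /A_op /= dT2.
split=> //; apply/energyP; split=> //.
  by apply: is_distrN; exact: is_distr_derive.
by move: r; congr zsummable; apply/funext.
Qed.

End States.

(** * The energy product *)
Section ComplexSums.
Variable R : realType.
Implicit Types (a b : int -> R[i]).

Definition zsummablec a := zsummable (fun k => Re (a k)) /\ zsummable (fun k => Im (a k)).

Lemma zsumc_lin (c : R[i]) a b : zsummablec a -> zsummablec b ->
  zsumc (fun k => c * a k + b k) = c * zsumc a + zsumc b.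
Proof.
move=> [ra ia] [rb ib]; apply: complex_ext; rewrite ?cpartE /=.
  have -> : (fun k => Re (c * a k + b k)) =
      (fun k => (Re c * Re (a k) + (- Im c) * Im (a k)) + Re (b k)).
    by apply/funext => k; rewrite !cpartE mulNr.
  rewrite zsumD//; last by apply: zsummableD; exact: zsummableZ.
  by rewrite zsumD; [|exact: zsummableZ..]; rewrite !zsumZ// mulNr.
have -> : (fun k => Im (c * a k + b k)) =
    (fun k => (Re c * Im (a k) + Im c * Re (a k)) + Im (b k)).
  by apply/funext => k; rewrite !cpartE.
rewrite zsumD//; last by apply: zsummableD; exact: zsummableZ.
by rewrite zsumD; [|exact: zsummableZ..]; rewrite !zsumZ.
Qed.

(** Young's inequality; the parameter l will be the inverse of a norm. *)
Lemma young_Re (l : R) (z w : R[i]) : 0 < l ->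
  2 * `|Re (z * (w^*)%C)| <= l * normc2 z + l^-1 * normc2 w.
Proof.
move=> l0; have li : 0 < l^-1 by rewrite invr_gt0.
have H (s : R) : s ^+ 2 = 1 -> 2 * (s * Re (z * (w^*)%C)) <= l * normc2 z + l^-1 * normc2 w.
  move=> s1; rewrite !cpartE -subr_ge0.
  have -> : l * normc2 z + l^-1 * normc2 w - 2 * (s * (Re z * Re w - Im z * - Im w)) =
    l^-1 * ((l * Re z - s * Re w) ^+ 2 + (l * Im z - s * Im w) ^+ 2
       + (1 - s ^+ 2) * normc2 w).
    by rewrite /normc2; field; rewrite gt_eqF.
  by rewrite s1 subrr mul0r addr0 mulr_ge0 ?addr_ge0 ?sqr_ge0// ltW.
have [h|h] := ger0P (Re (z * (w^*)%C)).
  by have := H 1; rewrite mul1r expr1n; exact.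
by have := H (-1); rewrite mulN1r sqrrN expr1n; exact.
Qed.

Lemma young_Im (l : R) (z w : R[i]) : 0 < l ->
  2 * `|Im (z * (w^*)%C)| <= l * normc2 z + l^-1 * normc2 w.
Proof.
move=> l0; have := young_Re (Complex 0 (-1) * z) w l0.
have -> : normc2 (Complex 0 (-1) * z) = normc2 z by rewrite /normc2 !cpartE /=; ring.
congr (_ * `|_| <= _).
by rewrite !cpartE /=; ring.
Qed.

End ComplexSums.

Section Energy.
Variables (R : realType) (beta : R).
Hypothesis beta_gt0 : 0 < beta.
Implicit Types (k : int) (t s : R) (Z W X V : state R).

Local Notation p := (p_mult beta).
Local Notation en := (energy_at beta).
Local Notation norm := (energy_norm beta).
Local Notation ip := (energy_ip beta).
Let p_gt0 k : 0 < p k. Proof. exact: p_mult_gt0. Qed.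

Definition ip_term Z W k : R[i] :=
  hcoef Z k * ((hcoef W k)^*)%C + (p k)%:C%C * ucoef Z k * ((ucoef W k)^*)%C.

Lemma young_ip_term (l : R) Z W k : 0 < l ->
  2 * `|Re (ip_term Z W k)| <= l * en Z k + l^-1 * en W k /\
  2 * `|Im (ip_term Z W k)| <= l * en Z k + l^-1 * en W k.
Proof.
move=> l0; have p0 := ltW (p_gt0 k).
have E : l * en Z k + l^-1 * en W k =
   (l * normc2 (hcoef Z k) + l^-1 * normc2 (hcoef W k)) + p k * (l * normc2 (ucoef Z k) + l^-1 * normc2 (ucoef W k)).
  by rewrite /energy_at /mode_energy; ring.
have Rp (z : R[i]) : Re ((p k)%:C%C * z) = p k * Re z by rewrite cReM /=; ring.
have Ip (z : R[i]) : Im ((p k)%:C%C * z) = p k * Im z by rewrite cImM /=; ring.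
have h1 := young_Re (hcoef Z k) (hcoef W k) l0; have h2 := young_Re (ucoef Z k) (ucoef W k) l0.
have h3 := young_Im (hcoef Z k) (hcoef W k) l0; have h4 := young_Im (ucoef Z k) (ucoef W k) l0.
rewrite E /ip_term; split.
  rewrite cReD -mulrA Rp; apply: (le_trans (ler_wpM2l _ (ler_normD _ _))) => //.
  by rewrite mulrDr normrM (ger0_norm p0) [2 * (p k * _)]mulrCA lerD// ler_wpM2l.
rewrite cImD -mulrA Ip; apply: (le_trans (ler_wpM2l _ (ler_normD _ _))) => //.
by rewrite mulrDr normrM (ger0_norm p0) [2 * (p k * _)]mulrCA lerD// ler_wpM2l.
Qed.

Lemma energy_at_zsummable Z : energy_space Z -> zsummable (en Z).
Proof. by move=> /(energyP beta_gt0)[]. Qed.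

Lemma ip_term_zsummablec Z W : energy_space Z -> energy_space W -> zsummablec (ip_term Z W).
Proof.
move=> /energy_at_zsummable sZ /energy_at_zsummable sW.
have sum := zsummableD sZ sW.
have e (x : R) : x <= 2 * x = (0 <= x) by rewrite mulr2n mulrDl mul1r lerDl.
split; apply: (zsummable_le _ sum) => k; have [h1 h2] := young_ip_term Z W k ltr01.
  by rewrite invr1 !mul1r in h1; apply: le_trans h1; rewrite e.
by rewrite invr1 !mul1r in h2; apply: le_trans h2; rewrite e.
Qed.

(** The two sums of the energy product converge separately: they are the sums of the
    products of W with the two components of Z. *)
Lemma ipE Z W : energy_space Z -> energy_space W ->
  ip Z W = (2 * pi)%:C%C * zsumc (ip_term Z W).
Proof.
move=> eZ eW; have /(energyP beta_gt0)[_ _ sZ] := eZ; have /(energyP beta_gt0)[_ _ sW] := eW.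
have sh V : zsummable (en V) -> zsummable (fun k => mode_energy (p k) (hcoef V k) 0).
  move=> sV; apply: (zsummable_le _ sV) => k.
  rewrite ger0_norm; last exact: mode_energy_ge0.
  rewrite /mode_energy normc20 mulr0 addr0 /energy_at /mode_energy lerDl.
  by rewrite mulr_ge0 ?normc2_ge0// ltW.
have su V : zsummable (en V) -> zsummable (fun k => mode_energy (p k) 0 (ucoef V k)).
  move=> sV; apply: (zsummable_le _ sV) => k.
  rewrite ger0_norm; last exact: mode_energy_ge0.
  rewrite /mode_energy normc20 add0r /energy_at /mode_energy lerDr; exact: normc2_ge0.
have [E1 a1 b1] := state_ofP beta_gt0 (sh Z sZ).
have [E2 a2 b2] := state_ofP beta_gt0 (su Z sZ).
have c1 := ip_term_zsummablec E1 eW; have c2 := ip_term_zsummablec E2 eW.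
have f1 : ip_term (state_of (fun k => hcoef Z k) (fun=> 0)) W = (fun k => hcoef Z k * ((hcoef W k)^*)%C).
  by apply/funext => k; rewrite /ip_term a1 b1 mulr0 mul0r addr0.
have f2 : ip_term (state_of (fun=> 0) (fun k => ucoef Z k)) W =
    (fun k => (p k)%:C%C * ucoef Z k * ((ucoef W k)^*)%C).
  by apply/funext => k; rewrite /ip_term a2 b2 mul0r add0r.
rewrite f1 in c1; rewrite f2 in c2.
have := zsumc_lin 1 c1 c2; rewrite mul1r => e.
rewrite /energy_ip -mulrDr; congr (_ * _); rewrite -[LHS]e.
by congr zsumc; apply/funext => k; rewrite mul1r.
Qed.

Lemma ip_lin (a : R[i]) Z W X : energy_space Z -> energy_space W -> energy_space X ->
  ip (a *: Z + W) X = a * ip Z X + ip W X.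
Proof.
move=> eZ eW eX; rewrite !ipE//; last exact: (energy_lin beta_gt0).
rewrite mulrCA -mulrDr -zsumc_lin; [|exact: ip_term_zsummablec..].
congr (_ * zsumc _); apply/funext => k.
by rewrite /ip_term hcoef_lin ucoef_lin; ring.
Qed.

Lemma ipB Z W X : energy_space Z -> energy_space W -> energy_space X ->
  ip (Z - W) X = ip Z X - ip W X.
Proof.
move=> eZ eW eX; have := ip_lin 1 (energyB beta_gt0 eZ eW) eW eX.
by rewrite scale1r subrK mul1r => ->; rewrite addrK.
Qed.

Lemma ipZ (a : R[i]) Z X : energy_space Z -> energy_space X -> ip (a *: Z) X = a * ip Z X.
Proof.
move=> eZ eX; have -> : a *: Z = (a - 1) *: Z + Z by rewrite scalerBl scale1r subrK.
by rewrite ip_lin//; ring.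
Qed.

Lemma normE Z : energy_space Z -> norm Z = Num.sqrt (2 * pi * zsum (en Z)).
Proof.
move=> eZ; rewrite /energy_norm ipE//; congr Num.sqrt.
rewrite cReM /= mul0r subr0; congr (_ * zsum _); apply/funext => k.
rewrite /ip_term /energy_at /mode_energy /normc2 !cpartE /=; ring.
Qed.

Lemma norm_sqr Z : energy_space Z -> norm Z ^+ 2 = 2 * pi * zsum (en Z).
Proof.
move=> eZ; rewrite normE// sqr_sqrtr// mulr_ge0 ?(ltW (twopi_gt0 R))//.
by apply: zsum_ge0; [exact: energy_at_ge0|exact: energy_at_zsummable].
Qed.

Lemma norm_ge0 Z : 0 <= norm Z. Proof. exact: sqrtr_ge0. Qed.

(** Cauchy-Schwarz, without the optimal constant: Young's inequality for
    the parameter l = 1 / norm Z, and for large l if norm Z = 0. *)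
Lemma ip_bound X : energy_space X -> exists2 C, 0 <= C & forall Z, energy_space Z ->
  `|Re (ip Z X)| <= C * norm Z /\ `|Im (ip Z X)| <= C * norm Z.
Proof.
move=> eX; have sX := energy_at_zsummable eX.
pose M := norm X ^+ 2; have M0 : 0 <= M by exact: sqr_ge0.
have tp := twopi_gt0 R.
have Y (l : R) Z : 0 < l -> energy_space Z ->
    2 * `|Re (ip Z X)| <= l * norm Z ^+ 2 + l^-1 * M /\
    2 * `|Im (ip Z X)| <= l * norm Z ^+ 2 + l^-1 * M.
  move=> l0 eZ; have sZ := energy_at_zsummable eZ.
  have E : l * norm Z ^+ 2 + l^-1 * M = 2 * pi * zsum (fun k => l * en Z k + l^-1 * en X k).
    rewrite zsumD; [|exact: zsummableZ..].
    by rewrite !zsumZ// /M !norm_sqr//; move: (zsum _) (zsum _) (pi : R) => a b c; ring.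
  have s2 : zsummable (fun k => l * en Z k + l^-1 * en X k) by apply: zsummableD; exact: zsummableZ.
  have [cr ci] := ip_term_zsummablec eZ eX.
  have H (f : int -> R) : zsummable f -> (forall k, 2 * `|f k| <= l * en Z k + l^-1 * en X k) ->
      2 * `|2 * pi * zsum f| <= l * norm Z ^+ 2 + l^-1 * M.
    move=> sf fb; rewrite E normrM (gtr0_norm tp) mulrCA ler_pM2l//.
    have -> : 2 * `|zsum f| = `|zsum (fun k => 2 * f k)|.
      by rewrite zsumZ// normrM ger0_norm.
    by apply: norm_zsum => // k; rewrite normrM ger0_norm.
  rewrite ipE//; split.
    rewrite cReM /= mul0r subr0; apply: H => // k.
    by have [] := young_ip_term Z X k l0.
  rewrite cImM /= mul0r addr0; apply: H => // k.
  by have [] := young_ip_term Z X k l0.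
exists (1 + M); first by rewrite addr_ge0.
move=> Z eZ; set n := norm Z.
have n0 : 0 <= n := norm_ge0 Z.
have fin (x : R) : 0 <= x -> (forall l : R, 0 < l -> 2 * x <= l * n ^+ 2 + l^-1 * M) ->
    x <= (1 + M) * n.
  move=> x0 hx; have [nz|nn] := eqVneq n 0.
    rewrite nz mulr0; apply: contrapT => /negP; rewrite -ltNge => xp.
    have M1 : 0 < M + 1 by rewrite ltr_wpDl.
    have := hx ((M + 1) / x) (divr_gt0 M1 xp).
    rewrite nz expr0n mulr0 add0r invf_div.
    have -> : x / (M + 1) * M = x - x / (M + 1) by field; rewrite gt_eqF.
    have : 0 < x / (M + 1) by rewrite divr_gt0.
    by move: (x / _) => y; lra.
  have np : 0 < n by rewrite lt_def nn.
  have := hx n^-1; rewrite invr_gt0 => /(_ np).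
  rewrite invrK expr2 mulrA mulVf// mul1r.
  have := mulr_ge0 M0 n0; rewrite [(1 + M) * n]mulrDl mul1r [n * M]mulrC.
  by move: (M * n) => y; lra.
split; apply: fin => // l l0; by have [] := Y l Z l0 eZ.
Qed.

Lemma ip_cvg0 (T : Type) (F : set_system T) {FF : Filter F} (Z : T -> state R) X :
  energy_space X -> (forall s : T, energy_space (Z s)) -> norm (Z s) @[s --> F] --> (0 : R) ->
  Re (ip (Z s) X) @[s --> F] --> (0 : R) /\ Im (ip (Z s) X) @[s --> F] --> (0 : R).
Proof.
move=> eX eZ nZ; have [C C0 CP] := ip_bound eX.
have H (f : T -> R) : (forall s : T, `|f s| <= C * norm (Z s)) -> f s @[s --> F] --> (0 : R).
  move=> fb; apply/norm_cvg0P.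
  have c : C * norm (Z s) @[s --> F] --> (C * 0 : R) by exact: cvgMr.
  rewrite mulr0 in c; apply: (squeeze_cvgr _ (cvg_cst (0 : R)) c).
  by apply: nearW => s; rewrite normr_ge0 fb.
by split; apply: H => s; have [] := CP (Z s) (eZ s).
Qed.

Lemma cvg_from0 (T : Type) (F : set_system T) {FF : Filter F} (f g : T -> R) a :
  (forall s : T, f s - a = g s) -> g s @[s --> F] --> (0 : R) -> f s @[s --> F] --> a.
Proof. by move=> fg g0; apply/subr_cvg0; rewrite (funext fg). Qed.

Lemma ip_continuous (Z : R -> state R) X : energy_space X -> C_energy beta Z ->
  continuous (fun t => Re (ip (Z t) X)) /\ continuous (fun t => Im (ip (Z t) X)).
Proof.
move=> eX [eZ cZ]; split=> t;
  have [c1 c2] := ip_cvg0 eX (fun s => energyB beta_gt0 (eZ s) (eZ t)) (cZ t).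
  by apply: (cvg_from0 _ c1) => s; rewrite ipB// cReD cReN.
by apply: (cvg_from0 _ c2) => s; rewrite ipB// cImD cImN.
Qed.

Lemma ip_derive (Z : R -> state R) t W X : energy_space X -> (forall s, energy_space (Z s)) ->
  has_derivative beta Z t W ->
  is_derive t 1 (fun s => Re (ip (Z s) X)) (Re (ip W X)) /\
  is_derive t 1 (fun s => Im (ip (Z s) X)) (Im (ip W X)).
Proof.
move=> eX eZ [eW dZ].
pose Q s := (s^-1)%:C%C *: (Z (t + s) - Z t) - W.
have eD s : energy_space (Z (t + s) - Z t) by exact: (energyB beta_gt0).
have eD' s : energy_space ((s^-1)%:C%C *: (Z (t + s) - Z t)) by exact: (energyZ beta_gt0).
have eQ s : energy_space (Q s) by exact: (energyB beta_gt0).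
have E s : ip (Q s) X = (s^-1)%:C%C * (ip (Z (t + s)) X - ip (Z t) X) - ip W X.
  by rewrite ipB// ipZ// ipB.
have [c1 c2] := ip_cvg0 eX eQ dZ.
split; apply/is_derive_quotP.
  by apply: (cvg_from0 _ c1) => s; rewrite E;
    move: (ip _ X) (ip _ X) (ip _ X) => a b c; rewrite !cpartE /=; ring.
by apply: (cvg_from0 _ c2) => s; rewrite E;
  move: (ip _ X) (ip _ X) (ip _ X) => a b c; rewrite !cpartE /=; ring.
Qed.

Lemma zsumc_delta (a : int -> R[i]) k :
  zsumc (fun j => if j == k then a j else 0) = a k.
Proof.
have H (f : int -> R) : zsum (fun j => if j == k then f j else 0) = f k.
  pose K := `|k|%N.+1.
  have inw L : (K <= L)%N -> in_window k L.
    by rewrite /K; case: (k) => n /= nL //; exact: ltn_trans nL.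
  have pE L : (K <= L)%N -> winsum (fun j => if j == k then f j else 0) L = f k.
    by move=> KL; rewrite winsum_delta inw.
  apply: zsum_uniq; last first.
    by apply: cvg_near_cst; exists K => // L /= KL; exact: pE.
  exists `|f k| => L; rewrite (_ : (fun j => `|_|) = (fun j => if j == k then `|f j| else 0)).
    by rewrite winsum_delta; case: ifP.
  by apply/funext => j; case: ifP; rewrite ?normr0.
apply: complex_ext => /=.
  by rewrite -[RHS](H (fun j => Re (a j))); congr zsum; apply/funext => j; case: ifP.
by rewrite -[RHS](H (fun j => Im (a j))); congr zsum; apply/funext => j; case: ifP.
Qed.

(** Whatever is defined by the norm or by duality, as derivatives and integrals
    of curves are, passes to coefficients through these vectors. *)
Lemma mode_vectors k : exists X Y : state R, [/\ energy_space X, energy_space Y,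
  forall Z, energy_space Z -> ip Z X = (2 * pi)%:C%C * hcoef Z k &
  forall Z, energy_space Z -> ip Z Y = (2 * pi)%:C%C * ucoef Z k].
Proof.
have fin (f : int -> R[i]) (g : int -> R[i]) : (forall j, j != k -> f j = 0 /\ g j = 0) ->
    zsummable (fun j => mode_energy (p j) (f j) (g j)).
  move=> fg; exists `|mode_energy (p k) (f k) (g k)| => L.
  rewrite (_ : (fun j => `|_|) = (fun j => if j == k then `|mode_energy (p j) (f j) (g j)| else 0)).
    by rewrite winsum_delta; case: ifP.
  apply/funext => j; case: ifPn => // jk; have [-> ->] := fg j jk.
  by rewrite /mode_energy !normc20 mulr0 addr0 normr0.
pose d j : R[i] := if j == k then 1 else 0.
pose e j : R[i] := if j == k then ((p k)^-1)%:C%C else 0.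
have s1 : zsummable (fun j => mode_energy (p j) (d j) 0).
  by apply: fin => j jk; rewrite /d (negbTE jk).
have s2 : zsummable (fun j => mode_energy (p j) 0 (e j)).
  by apply: fin => j jk; rewrite /e (negbTE jk).
have [E1 a1 b1] := state_ofP beta_gt0 s1; have [E2 a2 b2] := state_ofP beta_gt0 s2.
exists (state_of d (fun=> 0)), (state_of (fun=> 0) e); split=> // Z eZ.
  rewrite ipE//; congr (_ * _); rewrite -[RHS](zsumc_delta (hcoef Z) k).
  congr zsumc; apply/funext => j; rewrite /ip_term a1 b1 /d conjc0 mulr0 addr0.
  by case: ifP => _; rewrite ?conjc0 ?mulr0// conjc1 mulr1.
rewrite ipE//; congr (_ * _); rewrite -[RHS](zsumc_delta (ucoef Z) k).
congr zsumc; apply/funext => j; rewrite /ip_term a2 b2 /e conjc0 mulr0 add0r.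
case: eqVneq => [->|_]; last by rewrite conjc0 mulr0.
rewrite conjc_real mulrAC -rmorphM /= divff ?mul1r// gt_eqF//.
Qed.

(** * The unitary group *)

Definition wave_group t Z : state R :=
  state_of (fun k => rot_h (p k) k%:~R t (hcoef Z k) (ucoef Z k))
           (fun k => rot_u (p k) k%:~R t (hcoef Z k) (ucoef Z k)).

Lemma wave_groupP t Z : energy_space Z -> [/\ energy_space (wave_group t Z),
  forall k, hcoef (wave_group t Z) k = rot_h (p k) k%:~R t (hcoef Z k) (ucoef Z k),
  forall k, ucoef (wave_group t Z) k = rot_u (p k) k%:~R t (hcoef Z k) (ucoef Z k) &
  forall k, en (wave_group t Z) k = en Z k].
Proof.
move=> eZ; have sZ := energy_at_zsummable eZ.
have s : zsummable (fun k => mode_energy (p k) (rot_h (p k) k%:~R t (hcoef Z k) (ucoef Z k))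
    (rot_u (p k) k%:~R t (hcoef Z k) (ucoef Z k))).
  by move: sZ; congr zsummable; apply/funext => k; rewrite rot_energy.
have [E a b] := state_ofP beta_gt0 s; split=> // k.
by rewrite /energy_at /wave_group a b rot_energy.
Qed.

Lemma wave_group_energy t Z : energy_space Z -> energy_space (wave_group t Z).
Proof. by move=> /(wave_groupP t)[]. Qed.

Lemma wave_group0 Z : energy_space Z -> wave_group 0 Z = Z.
Proof.
move=> eZ; have [E a b _] := wave_groupP 0 eZ; apply: (state_ext beta_gt0) => // k;
  have [e1 e2] := @rot0 R (p k) k%:~R (hcoef Z k) (ucoef Z k).
  by rewrite a e1.
by rewrite b e2.
Qed.

Lemma wave_groupD s t Z : energy_space Z -> wave_group (s + t) Z = wave_group s (wave_group t Z).
Proof.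
move=> eZ; have [E a b _] := wave_groupP (s + t) eZ; have [E' a' b' _] := wave_groupP t eZ.
have [E2 a2 b2 _] := wave_groupP s E'.
apply: (state_ext beta_gt0) => // k;
  have [e1 e2] := rotD k%:~R (p_gt0 k) s t (hcoef Z k) (ucoef Z k).
  by rewrite a a2 a' b' e1.
by rewrite b b2 a' b' e2.
Qed.

Lemma wave_group_lin t (a : R[i]) Z W : energy_space Z -> energy_space W ->
  wave_group t (a *: Z + W) = a *: wave_group t Z + wave_group t W.
Proof.
move=> eZ eW; have eL := energy_lin beta_gt0 a eZ eW.
have [E h u _] := wave_groupP t eL; have [E1 h1 u1 _] := wave_groupP t eZ.
have [E2 h2 u2 _] := wave_groupP t eW.
apply: (state_ext beta_gt0) => // [|k|k]; first exact: (energy_lin beta_gt0).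
  rewrite h !hcoef_lin ucoef_lin h1 h2.
  by have [-> _] := rot_lin (p k) k%:~R t a (hcoef Z k) (ucoef Z k) (hcoef W k) (ucoef W k).
rewrite u hcoef_lin !ucoef_lin u1 u2.
by have [_ ->] := rot_lin (p k) k%:~R t a (hcoef Z k) (ucoef Z k) (hcoef W k) (ucoef W k).
Qed.

Lemma wave_group_norm t Z : energy_space Z -> norm (wave_group t Z) = norm Z.
Proof.
move=> eZ; have [E _ _ n] := wave_groupP t eZ; rewrite !normE//.
by congr (Num.sqrt (_ * zsum _)); apply/funext.
Qed.

Lemma wave_group_ip t Z W : energy_space Z -> energy_space W ->
  ip (wave_group t Z) (wave_group t W) = ip Z W.
Proof.
move=> eZ eW; have [E h u _] := wave_groupP t eZ; have [E' h' u' _] := wave_groupP t eW.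
rewrite !ipE//; congr (_ * zsumc _); apply/funext => k.
by rewrite /ip_term h u h' u' rot_ip.
Qed.

(** The common form of the limits below: V has in each mode the energy of Z
    multiplied by a factor that tends to 0 and is dominated by g. *)
Lemma norm_cvg0_dominated (F : set_system R) {FF : Filter F} (V : R -> state R) Z
    (r : R -> int -> R) (g : int -> R) :
  (forall s, energy_space (V s)) -> (forall s k, en (V s) k = r s k * en Z k) ->
  (forall s k, 0 <= r s k <= g k) -> zsummable (fun k => g k * en Z k) ->
  (forall k, r s k @[s --> F] --> (0 : R)) -> norm (V s) @[s --> F] --> (0 : R).
Proof.
move=> eV VE rg sg rc.
have c : zsum (en (V s)) @[s --> F] --> (0 : R).
  apply: (@zsum_dominated R R F _ (fun s => en (V s)) (fun k => g k * en Z k)) => //.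
  - by move=> s k; exact: energy_at_ge0.
  - by move=> s k; rewrite VE ler_wpM2r ?energy_at_ge0//; have /andP[] := rg s k.
  - move=> k; rewrite (funext (VE^~ k)).
    have h : r s k * en Z k @[s --> F] --> (0 * en Z k : R) by apply: cvgMl; exact: rc.
    by rewrite mul0r in h.
have c2 : 2 * pi * zsum (en (V s)) @[s --> F] --> (2 * pi * 0 : R) by exact: cvgMr.
rewrite mulr0 in c2; rewrite (funext (fun s => normE (eV s))) -(sqrtr0 R).
exact: (cvg_comp _ _ c2 (@sqrt_continuous R 0)).
Qed.

End Energy.

(** * Integrals between 0 and t *)
Section OrientedIntegral.
Variable R : realType.
Implicit Types (f : R -> R) (t s : R).
Local Notation mu := (@lebesgue_measure R).

Definition oriented_int f t : R :=
  if 0 <= t then \int[mu]_(x in `[0, t]) f x else - \int[mu]_(x in `[t, 0]) f x.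

Lemma oriented_int0 f : oriented_int f 0 = 0.
Proof. by rewrite /oriented_int lexx set_itv1 Rintegral_set1. Qed.

Lemma oriented_int_shift f a u t : continuous f -> a < 0 -> 0 < u -> a <= t <= u ->
  oriented_int f t = \int[mu]_(x in `[a, t]) f x - \int[mu]_(x in `[a, 0]) f x.
Proof.
move=> cf a0 u0 /andP[at' tu].
have ii x y : mu.-integrable `[x, y] (EFin \o f).
  apply: continuous_compact_integrable; first exact: segment_compact.
  exact: continuous_subspaceT.
have io x y : mu.-integrable `]x, y] (EFin \o f).
  apply: (integrableS _ _ _ (ii x y)) => //; apply: subset_itvr.
  by rewrite bnd_simp.
rewrite /oriented_int; case: ifPn => [t0|]; last first.
  rewrite -ltNge => t0.
  rewrite -[RHS]opprB; congr (- _).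
  rewrite (@Rintegral_itvB _ f (BLeft a) (BRight 0) t)//.
  - by rewrite Rintegral_itv_obnd_cbnd.
  - by rewrite bnd_simp ltW.
rewrite (@Rintegral_itvB _ f (BLeft a) (BRight t) 0)//.
- by rewrite Rintegral_itv_obnd_cbnd.
- by rewrite bnd_simp ltW.
Qed.

(** Near t, the integral from 0 differs by a constant from the integral from a fixed
    point a to the left of 0 and t, which the fundamental theorem of calculus differentiates. *)
Lemma oriented_int_derive f t : continuous f -> is_derive t 1 (oriented_int f) (f t).
Proof.
move=> cf.
have n0 : 0 <= `|t| by [].
pose a := - `|t| - 1; pose u := `|t| + 1.
have a0 : a < 0 by rewrite /a; lra.
have u0 : 0 < u by rewrite /u; lra.
have /andP[at' tu] : a < t < u.
  by have := lerNnormlW (lexx `|t|); have := ler_norm t; rewrite /a /u => *; apply/andP; split; lra.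
have ii : mu.-integrable `[a, u] (EFin \o f).
  apply: continuous_compact_integrable; first exact: segment_compact.
  exact: continuous_subspaceT.
have [d1 d2] := continuous_FTC1_closed tu ii at' (cf t).
have d : is_derive t 1 (fun x => \int[mu]_(y in `[a, x]) f y) (f t).
  by apply: DeriveDef; [exact: d1|exact: etrans (esym (derive1E _ _)) d2].
apply/is_derive_quotP; move/is_derive_quotP : d; apply: cvg_trans.
apply: near_eq_cvg.
have e0 : 0 < Num.min (t - a) (u - t) by rewrite lt_min !subr_gt0 at' tu.
have := @dnbhs0_lt R R _ e0.
apply: filterS => s; rewrite lt_min => /andP[s1 s2].
have := ler_norm s; have := ler_norm (- s); rewrite normrN => h1 h2.
rewrite (oriented_int_shift cf a0 u0); last by apply/andP; split; lra.
rewrite (oriented_int_shift cf a0 u0); last by rewrite !ltW.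
by rewrite opprB addrA subrK.
Qed.

Lemma oriented_int_antiderivative f F t : continuous f -> (forall s, is_derive s 1 F (f s)) ->
  oriented_int f t = F t - F 0.
Proof.
move=> cf dF.
have d s : is_derive s 1 (fun x => oriented_int f x - F x) (0 : R).
  by refine (is_derive_eq (is_deriveB (oriented_int_derive s cf) (dF s)) _); exact: subrr.
have := @is_derive_0_is_cst R _ t 0 d; rewrite oriented_int0 sub0r => H.
by rewrite -[LHS](subrK (F t)) H addrC.
Qed.

Lemma oriented_Re (f : R -> R[i]) t :
  Re (oriented_cintegral 0 t f) = oriented_int (fun s => Re (f s)) t.
Proof. by rewrite /oriented_cintegral /oriented_int; case: ifP => _ //; rewrite cReN. Qed.

Lemma oriented_Im (f : R -> R[i]) t :
  Im (oriented_cintegral 0 t f) = oriented_int (fun s => Im (f s)) t.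
Proof. by rewrite /oriented_cintegral /oriented_int; case: ifP => _ //; rewrite cImN. Qed.

End OrientedIntegral.

(** * Orbits of the group *)
Section Evolution.
Variables (R : realType) (beta : R).
Hypothesis beta_gt0 : 0 < beta.
Implicit Types (k : int) (t s : R) (Z W X V : state R).

Local Notation p := (p_mult beta).
Local Notation w := (mode_freq beta).
Local Notation en := (energy_at beta).
Local Notation norm := (energy_norm beta).
Local Notation ip := (energy_ip beta).
Local Notation group := (wave_group beta).
Local Notation Aop := (A_op beta).
Let p_gt0 k : 0 < p k. Proof. exact: p_mult_gt0. Qed.

(** The factor by which S(t) - S(s) multiplies the energy of mode k. *)
Definition trig_dist k t s : R :=
  (cos (w k * t) - cos (w k * s)) ^+ 2 + (sin (w k * t) - sin (w k * s)) ^+ 2.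

Lemma trig_dist_bound k t s : 0 <= trig_dist k t s <= 8.
Proof.
rewrite /trig_dist addr_ge0 ?sqr_ge0//=.
have h (x y : R) : `|x| <= 1 -> `|y| <= 1 -> (x - y) ^+ 2 <= 4.
  move=> x1 y1; have : `|x - y| <= 2 by apply: (le_trans (ler_normB _ _)); lra.
  rewrite -[_ ^+ 2]real_normK ?num_real// => h; have -> : 4 = 2 ^+ 2 :> R by ring.
  by rewrite lerXn2r// nnegrE.
have := h _ _ (cos_max (w k * t)) (cos_max (w k * s)).
have := h _ _ (sin_max (w k * t)) (sin_max (w k * s)); lra.
Qed.

Lemma trig_dist_cvg k s : trig_dist k t s @[t --> s] --> (0 : R).
Proof.
have H (f : R -> R) : continuous f -> f (w k * t) - f (w k * s) @[t --> s] --> (0 : R).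
  move=> cf; have c : f (w k * t) @[t --> s] --> f (w k * s).
    exact: (@continuous_comp R R R (fun t => w k * t) f s (@mulrl_continuous R (w k) s) (cf _)).
  have c' : f (w k * t) - f (w k * s) @[t --> s] --> f (w k * s) - f (w k * s).
    by apply: cvgB => //; exact: cvg_cst.
  by rewrite subrr in c'.
have c1 := H (@cos R) (@continuous_cos R); have c2 := H (@sin R) (@continuous_sin R).
have c : (cos (w k * t) - cos (w k * s)) * (cos (w k * t) - cos (w k * s)) +
  (sin (w k * t) - sin (w k * s)) * (sin (w k * t) - sin (w k * s)) @[t --> s] --> (0 * 0 + 0 * 0 : R).
  by apply: cvgD; exact: cvgM.
by rewrite mulr0 addr0 in c.
Qed.

Lemma energy_at_groupB t s Z k : energy_space Z ->
  en (group t Z - group s Z) k = trig_dist k t s * en Z k.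
Proof.
move=> eZ; have [_ h u _] := wave_groupP beta_gt0 t eZ.
have [_ h' u' _] := wave_groupP beta_gt0 s eZ.
rewrite /trig_dist -mode_energy_lin// /energy_at hcoefB ucoefB h u h' u'.
by congr mode_energy; rewrite /rot_h /rot_u !rmorphB /=; ring.
Qed.

Lemma wave_group_continuous Z : energy_space Z -> C_energy beta (fun t => group t Z).
Proof.
move=> eZ; split=> [t|t0]; first exact: wave_group_energy.
apply: (@norm_cvg0_dominated R beta beta_gt0 _ _ _ Z (fun t k => trig_dist k t t0) (fun=> 8)).
- by move=> t; apply: (energyB beta_gt0); exact: wave_group_energy.
- by move=> t k; exact: energy_at_groupB.
- by move=> t k; exact: trig_dist_bound.
- by apply: zsummableZ; exact: (energy_at_zsummable beta_gt0).
- by move=> k; exact: trig_dist_cvg.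
Qed.

Lemma wave_group_A_dom t Z : A_dom Z -> A_dom (group t Z).
Proof.
move=> AZ; have /(A_domP beta_gt0)[_ _ s1 s2] := AZ.
have [/(energyP beta_gt0)[d1 d2 s] _ _ n] := wave_groupP beta_gt0 t (A_dom_energy beta_gt0 AZ).
apply/(A_domP beta_gt0); split=> //.
by move: s2; congr zsummable; apply/funext => k; rewrite n.
Qed.

Lemma A_opB Z W : A_dom Z -> A_dom W -> Aop Z - Aop W = Aop (Z - W).
Proof.
move=> AZ AW; have [e1 h1 u1 _] := A_opP beta_gt0 AZ; have [e2 h2 u2 _] := A_opP beta_gt0 AW.
have [e3 h3 u3 _] := A_opP beta_gt0 (A_domB beta_gt0 AZ AW).
apply: (state_ext beta_gt0) => // [|k|k]; first exact: (energyB beta_gt0).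
  by rewrite hcoefB h1 h2 h3 ucoefB; ring.
by rewrite ucoefB u1 u2 u3 hcoefB; ring.
Qed.

Lemma A_dom_zsummable Z : A_dom Z -> zsummable (fun k => w k ^+ 2 * en Z k).
Proof. by move=> /(A_domP beta_gt0)[]. Qed.

Lemma A_op_group_cvg Z t0 : A_dom Z ->
  norm (Aop (group t Z - group t0 Z)) @[t --> t0] --> (0 : R).
Proof.
move=> AZ; have eZ := A_dom_energy beta_gt0 AZ.
have AD t : A_dom (group t Z - group t0 Z).
  by apply: (A_domB beta_gt0); exact: wave_group_A_dom.
apply: (@norm_cvg0_dominated R beta beta_gt0 _ _ _ Z
  (fun t k => w k ^+ 2 * trig_dist k t t0) (fun k => w k ^+ 2 * 8)).
- by move=> t; have [] := A_opP beta_gt0 (AD t).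
- by move=> t k; have [_ _ _ ->] := A_opP beta_gt0 (AD t); rewrite energy_at_groupB// mulrA.
- move=> t k; have /andP[h1 h2] := trig_dist_bound k t t0.
  by rewrite mulr_ge0 ?sqr_ge0//= ler_wpM2l ?sqr_ge0.
- have := zsummableZ 8 (A_dom_zsummable AZ); congr zsummable; apply/funext => k.
  by rewrite mulrA [_ * 8]mulrC.
- move=> k; have c : w k ^+ 2 * trig_dist k t t0 @[t --> t0] --> (w k ^+ 2 * 0 : R).
    by apply: cvgMr; exact: trig_dist_cvg.
  by rewrite mulr0 in c.
Qed.

(** In mode k the error of the difference quotient has the energy of Z multiplied by a factor
    that tends to 0 and is at most 8 w_k^2; on the domain these bounds are summable. *)
Lemma wave_group_derive Z t : A_dom Z ->
  has_derivative beta (fun s => group s Z) t (Aop (group t Z)).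
Proof.
move=> AZ; have eZ := A_dom_energy beta_gt0 AZ.
have [eA hA uA _] := A_opP beta_gt0 (wave_group_A_dom t AZ).
split=> //.
have [_ h u _] := wave_groupP beta_gt0 t eZ.
apply: (@norm_cvg0_dominated R beta beta_gt0 _ _ _ Z
  (fun s k => cos_quot (w k) t s ^+ 2 + sin_quot (w k) t s ^+ 2) (fun k => 8 * w k ^+ 2)).
- move=> s; apply: (energyB beta_gt0) => //; apply: (energyZ beta_gt0).
  by apply: (energyB beta_gt0); exact: wave_group_energy.
- move=> s k; have [_ h' u' _] := wave_groupP beta_gt0 (t + s) eZ.
  have [e1 e2] := rot_quot k%:~R (p_gt0 k) (hcoef Z k) (ucoef Z k) t s.
  rewrite -mode_energy_lin// /energy_at !hcoefB !ucoefB hcoefZ ucoefZ hcoefB ucoefB h' u' hA uA h u.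
  by rewrite e1 e2.
- by move=> s k; rewrite addr_ge0 ?sqr_ge0//= trig_quot_bound.
- by have := zsummableZ 8 (A_dom_zsummable AZ); congr zsummable; apply/funext => k; rewrite mulrA.
- by move=> k; exact: trig_quot_cvg.
Qed.

(** * Uniqueness of solutions *)

Definition state_ode (Y : R -> state R) := (forall t, energy_space (Y t)) /\
  forall k, mode_ode (p k) k%:~R (fun t => hcoef (Y t) k) (fun t => ucoef (Y t) k).

Lemma state_ode_uniq Z Y : energy_space Z -> state_ode Y -> Y 0 = Z ->
  forall t, Y t = group t Z.
Proof.
move=> eZ [eY oY] Y0 t; have [eG h u _] := wave_groupP beta_gt0 t eZ.
have [e1 e2] : (forall k, hcoef (Y t) k = hcoef (group t Z) k) /\
    (forall k, ucoef (Y t) k = ucoef (group t Z) k).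
  split=> k; have [e1 e2] := @rot0 R (p k) k%:~R (hcoef Z k) (ucoef Z k);
    have [] := @mode_ode_uniq R (p k) k%:~R (p_gt0 k) _ _ _ _ (oY k)
      (@rot_mode_ode R (p k) k%:~R (p_gt0 k) (hcoef Z k) (ucoef Z k)) _ _ t;
    rewrite ?Y0 ?e1 ?e2// => r1 r2; [by rewrite h|by rewrite u].
exact: (state_ext beta_gt0).
Qed.

Let tp0 : 2 * pi != 0 :> R. Proof. by rewrite gt_eqF// twopi_gt0. Qed.

(** Derivatives of coefficients are obtained from derivatives of energy products with the
    vectors of mode_vectors. *)
Lemma mode_derive (Y : R -> state R) k t (fr fi gr gi : R) : (forall t, energy_space (Y t)) ->
  (forall X, energy_space X -> (forall Z, energy_space Z -> ip Z X = (2 * pi)%:C%C * hcoef Z k) ->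
     is_derive t 1 (fun s => Re (ip (Y s) X)) (2 * pi * fr) /\
     is_derive t 1 (fun s => Im (ip (Y s) X)) (2 * pi * fi)) ->
  (forall X, energy_space X -> (forall Z, energy_space Z -> ip Z X = (2 * pi)%:C%C * ucoef Z k) ->
     is_derive t 1 (fun s => Re (ip (Y s) X)) (2 * pi * gr) /\
     is_derive t 1 (fun s => Im (ip (Y s) X)) (2 * pi * gi)) ->
  [/\ is_derive t 1 (fun s => Re (hcoef (Y s) k)) fr,
      is_derive t 1 (fun s => Im (hcoef (Y s) k)) fi,
      is_derive t 1 (fun s => Re (ucoef (Y s) k)) gr &
      is_derive t 1 (fun s => Im (ucoef (Y s) k)) gi].
Proof.
move=> eY H1 H2; have [X [X' [eX eX' iX iX']]] := mode_vectors beta_gt0 k.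
have [d1 d2] := H1 X eX iX; have [d3 d4] := H2 X' eX' iX'.
have H (f g : R -> R) (l : R) : (forall s, f s = 2 * pi * g s) ->
    is_derive t 1 f (2 * pi * l) -> is_derive t 1 g l.
  move=> fg df; have -> : g = (2 * pi)^-1 \*: f.
    by apply/funext => s /=; rewrite fg /GRing.scale /= mulrA mulVf// mul1r.
  by refine (is_derive_eq (is_deriveZ _ df) _); rewrite /GRing.scale /= mulrA mulVf// mul1r.
split.
- by apply: (H _ _ _ _ d1) => s; rewrite iX// cRe_scale.
- by apply: (H _ _ _ _ d2) => s; rewrite iX// cIm_scale.
- by apply: (H _ _ _ _ d3) => s; rewrite iX'// cRe_scale.
- by apply: (H _ _ _ _ d4) => s; rewrite iX'// cIm_scale.
Qed.

Lemma classical_ode (Y : R -> state R) : (forall t, A_dom (Y t)) ->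
  (forall t, has_derivative beta Y t (Aop (Y t))) -> state_ode Y.
Proof.
move=> AY dY; have eY t : energy_space (Y t) := A_dom_energy beta_gt0 (AY t).
split=> // k t; have [eA hA uA _] := A_opP beta_gt0 (AY t).
have [d1 d2 d3 d4] : [/\ is_derive t 1 (fun s => Re (hcoef (Y s) k)) (Re (hcoef (Aop (Y t)) k)),
    is_derive t 1 (fun s => Im (hcoef (Y s) k)) (Im (hcoef (Aop (Y t)) k)),
    is_derive t 1 (fun s => Re (ucoef (Y s) k)) (Re (ucoef (Aop (Y t)) k)) &
    is_derive t 1 (fun s => Im (ucoef (Y s) k)) (Im (ucoef (Aop (Y t)) k))].
  apply: (mode_derive eY) => X eX iX; have [d1 d2] := ip_derive beta_gt0 eX eY (dY t);
    have e := iX _ eA;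
    (split; [apply: (is_derive_eq d1)|apply: (is_derive_eq d2)]); rewrite e;
    first [exact: cRe_scale|exact: cIm_scale].
by rewrite hA uA !cRe_imag !cIm_imag in d1 d2 d3 d4.
Qed.

(** Let W t be the integral of Y from 0 to t. Its coefficients are primitives of those of Y,
    so the coefficients of Y = Z0 + A W are differentiable with the derivatives that the
    operator, applied to Y, prescribes. *)
Lemma mild_ode Z0 (Y : R -> state R) : energy_space Z0 -> mild_solution beta Z0 Y ->
  state_ode Y /\ Y 0 = Z0.
Proof.
move=> e0 [CY mY]; have eY t : energy_space (Y t) by case: CY.
pose W t := projT1 (cid (mY t)).
have WP t : [/\ is_curve_integral beta 0 t Y (W t), A_dom (W t) & Y t = Z0 + Aop (W t)].
  exact: projT2 (cid (mY t)).
have AW t : A_dom (W t) by case: (WP t).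
have WI X t : energy_space X -> Re (ip (W t) X) = oriented_int (fun s => Re (ip (Y s) X)) t /\
    Im (ip (W t) X) = oriented_int (fun s => Im (ip (Y s) X)) t.
  by move=> eX; have [[_ h] _ _] := WP t; rewrite h// oriented_Re oriented_Im.
have eW t : energy_space (W t) := A_dom_energy beta_gt0 (AW t).
have dW k t : [/\ is_derive t 1 (fun s => Re (hcoef (W s) k)) (Re (hcoef (Y t) k)),
    is_derive t 1 (fun s => Im (hcoef (W s) k)) (Im (hcoef (Y t) k)),
    is_derive t 1 (fun s => Re (ucoef (W s) k)) (Re (ucoef (Y t) k)) &
    is_derive t 1 (fun s => Im (ucoef (W s) k)) (Im (ucoef (Y t) k))].
  apply: (mode_derive eW) => X eX iX; have [cr ci] := ip_continuous beta_gt0 eX CY;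
    have e := iX _ (eY t);
    rewrite (funext (fun s => proj1 (WI X s eX))) (funext (fun s => proj2 (WI X s eX)));
    (split; [apply: (is_derive_eq (oriented_int_derive t cr))|apply: (is_derive_eq (oriented_int_derive t ci))]);
    rewrite e; first [exact: cRe_scale|exact: cIm_scale].
have YE t k : hcoef (Y t) k = hcoef Z0 k + Complex 0 (- (k%:~R * p k)) * ucoef (W t) k /\
    ucoef (Y t) k = ucoef Z0 k + Complex 0 (- k%:~R) * hcoef (W t) k.
  by have [_ _ ->] := WP t; have [_ hA uA _] := A_opP beta_gt0 (AW t); rewrite hcoefD ucoefD hA uA.
split; last first.
  have [W0h W0u] : (forall k, hcoef (W 0) k = 0) /\ (forall k, ucoef (W 0) k = 0).
    have Z0' X : energy_space X -> ip (W 0) X = 0.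
      move=> eX; have [e1 e2] := WI X 0 eX.
      by apply: complex_ext; [rewrite e1 oriented_int0|rewrite e2 oriented_int0].
    have c0 : (2 * pi : R)%:C%C != 0 by rewrite eq_complex /= (negbTE tp0).
    split=> k; have [X [X' [eX eX' iX iX']]] := mode_vectors beta_gt0 k.
      by have /eqP := iX (W 0) (eW 0); rewrite Z0'// eq_sym mulf_eq0 (negbTE c0) => /eqP.
    by have /eqP := iX' (W 0) (eW 0); rewrite Z0'// eq_sym mulf_eq0 (negbTE c0) => /eqP.
  by apply: (state_ext beta_gt0) => // k; have [e1 e2] := YE 0 k; rewrite ?e1 ?e2 ?W0h ?W0u mulr0 addr0.
split=> // k t; have [d1 d2 d3 d4] := dW k t.
have S (c a l : R) (f g : R -> R) : is_derive t 1 g l -> (forall s, f s = c + a * g s) ->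
    is_derive t 1 f (a * l).
  move=> dg fg; rewrite (funext fg).
  by refine (is_derive_eq (is_deriveD (is_derive_cst c t 1) (is_deriveZ a dg)) _); rewrite add0r.
split.
- by apply: (S (Re (hcoef Z0 k)) _ _ _ _ d4) => s; have [-> _] := YE s k; rewrite cReD cRe_imag.
- by apply: (S (Im (hcoef Z0 k)) _ _ _ _ d3) => s; have [-> _] := YE s k; rewrite cImD cIm_imag.
- by apply: (S (Re (ucoef Z0 k)) _ _ _ _ d2) => s; have [_ ->] := YE s k; rewrite cReD cRe_imag.
- by apply: (S (Im (ucoef Z0 k)) _ _ _ _ d1) => s; have [_ ->] := YE s k; rewrite cImD cIm_imag.
Qed.

(** * Mild solutions *)

(** Away from the zero mode the frequencies are bounded below, so that
    the inverse of the operator is bounded there. *)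
Lemma mode_freq_lower : exists2 c : R, 0 < c & forall k, k != 0 -> c <= w k ^+ 2.
Proof.
have [c [C [c0 C0 pb]]] := p_mult_bounds beta_gt0.
exists (c / 2); first by rewrite divr_gt0.
move=> k k0; rewrite mode_freq_sqr//; have /andP[h _] := pb k.
have k1 := intr_sqr_ge1 R k0.
have j0 := jap_gt0 R k; have j1 := jap_ge1 R k; have j2 := jap_sqr R k.
have jk : jap R k <= 2 * k%:~R ^+ 2.
  have : jap R k <= jap R k ^+ 2 by rewrite expr2 ler_peMr// ltW.
  by rewrite j2; move: (_ ^+ 2) k1 => K; lra.
rewrite -(ler_pM2r j0); apply: (@le_trans _ _ (c / 2 * (2 * k%:~R ^+ 2))).
  by rewrite ler_wpM2l// divr_ge0// ltW.
rewrite mulrA divfK ?pnatr_eq0// -[leRHS]mulrA [c * _]mulrC.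
by rewrite ler_wpM2l ?sqr_ge0.
Qed.

(** On a nonzero mode the matrix of the operator is invertible and commutes with the
    rotations. *)
Lemma mode_inverse (r kk : R) t (h u : R[i]) : 0 < r -> kk != 0 ->
  rot_h r kk t h u = Complex 0 (- (kk * r)) *
    rot_u r kk t (Complex 0 kk^-1 * u) (Complex 0 (kk * r)^-1 * h) /\
  rot_u r kk t h u = Complex 0 (- kk) *
    rot_h r kk t (Complex 0 kk^-1 * u) (Complex 0 (kk * r)^-1 * h).
Proof.
move=> r0 k0; have q0 : Num.sqrt r != 0 by rewrite gt_eqF// sqrtr_gt0.
have rq : r = Num.sqrt r ^+ 2 by rewrite sqr_sqrtr// ltW.
rewrite /rot_h /rot_u /Jh /Ju; set c := cos _; set d := sin _; move: c d => c d.
move: rq q0; set q := Num.sqrt r => rq q0; rewrite rq; move: q q0 {rq} => q q0.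
by split; apply: complex_ext; rewrite !cpartE /=; field; rewrite k0 q0.
Qed.

(** Write Z = P + A V, where P is the zero mode, on which the orbit is constant, and V is the
    preimage of the other modes. Then S(t) Z = P + A S(t) V, where the last term is the
    derivative of S(t) V, so the integral of the orbit is t P + S(t) V - V. *)
Lemma wave_group_mild Z : energy_space Z -> mild_solution beta Z (fun t => group t Z).
Proof.
move=> eZ; split; first exact: wave_group_continuous.
have sZ := energy_at_zsummable beta_gt0 eZ.
have [c c0 wc] := mode_freq_lower.
pose a0 k : R[i] := if k == 0 then hcoef Z k else 0.
pose b0 k : R[i] := if k == 0 then ucoef Z k else 0.
pose a1 k : R[i] := if k == 0 then 0 else Complex 0 (k%:~R^-1) * ucoef Z k.
pose b1 k : R[i] := if k == 0 then 0 else Complex 0 ((k%:~R * p k)^-1) * hcoef Z k.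
have N1 k : k != 0 -> w k ^+ 2 * mode_energy (p k) (a1 k) (b1 k) = en Z k.
  move=> k0; have K0 : (k%:~R : R) != 0 by rewrite intr_eq0.
  have P0 : p k != 0 by rewrite gt_eqF.
  rewrite mode_freq_sqr// /a1 /b1 (negbTE k0) /energy_at /mode_energy
    (normc2M _ (ucoef Z k)) (normc2M _ (hcoef Z k)) !normc2_imag.
  move: (normc2 (hcoef Z k)) (normc2 (ucoef Z k)) (k%:~R : R) (p k) K0 P0 => H U K P K0 P0.
  by field; rewrite K0 P0.
have N10 k : k == 0 -> mode_energy (p k) (a1 k) (b1 k) = 0.
  by rewrite /mode_energy /a1 /b1 => ->; rewrite normc20 mulr0 addr0.
have s0 : zsummable (fun k => mode_energy (p k) (a0 k) (b0 k)).
  apply: (zsummable_le _ sZ) => k; rewrite ger0_norm ?mode_energy_ge0// /a0 /b0.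
  case: ifP => _ //; rewrite /mode_energy normc20 mulr0 addr0; exact: energy_at_ge0.
have s1 : zsummable (fun k => mode_energy (p k) (a1 k) (b1 k)).
  apply: (zsummable_le _ (zsummableZ c^-1 sZ)) => k; rewrite ger0_norm ?mode_energy_ge0//.
  case: (eqVneq k 0) => [k0|k0].
    by rewrite N10 ?k0// mulr_ge0 ?energy_at_ge0// invr_ge0 ltW.
  rewrite ler_pdivlMl// -(N1 k k0) ler_wpM2r ?mode_energy_ge0//; exact: wc.
have [e0 h0 u0] := state_ofP beta_gt0 s0; have [e1 h1 u1] := state_ofP beta_gt0 s1.
set P := state_of a0 b0 in e0 h0 u0; set V := state_of a1 b1 in e1 h1 u1.
have wP k : w k ^+ 2 * en P k = 0.
  rewrite /energy_at h0 u0 /a0 /b0; case: (eqVneq k 0) => [->|_].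
    by rewrite mode_freq_sqr// expr0n /= !mul0r.
  by rewrite /mode_energy normc20 mulr0 addr0 mulr0.
have AP : A_dom P.
  have /(energyP beta_gt0)[? ? ?] := e0; apply/(A_domP beta_gt0); split=> //.
  exists 0 => L; rewrite (_ : (fun k => _) = fun=> 0); last by apply/funext => k; rewrite wP normr0.
  by rewrite /winsum big1// => i _; rewrite addr0.
have AV : A_dom V.
  have /(energyP beta_gt0)[? ? ?] := e1; apply/(A_domP beta_gt0); split=> //.
  apply: (zsummable_le _ sZ) => k; rewrite ger0_norm; last by rewrite mulr_ge0 ?sqr_ge0 ?energy_at_ge0.
  rewrite /energy_at h1 u1; case: (eqVneq k 0) => [k0|k0].
    by rewrite N10 ?k0// mulr0; exact: energy_at_ge0.
  by rewrite N1.
have AVt t := wave_group_A_dom t AV.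
(* the operator inverts V on the nonzero modes and commutes with the group *)
have split_group t : group t Z = P + Aop (group t V).
  have [_ hA uA _] := A_opP beta_gt0 (AVt t); have [_ hV uV _] := wave_groupP beta_gt0 t e1.
  have [eG hG uG _] := wave_groupP beta_gt0 t eZ.
  have [eA _ _ _] := A_opP beta_gt0 (AVt t).
  have eS : energy_space (P + Aop (group t V)) by rewrite -[P]scale1r; exact: (energy_lin beta_gt0).
  have i0 (z : R[i]) : Complex (0 : R) 0 * z = 0 by rewrite (_ : Complex _ _ = 0)// mul0r.
  apply: (state_ext beta_gt0) => // k.
    rewrite hcoefD hA hG uV h0 h1 u1 /a0 /a1 /b1; case: (eqVneq k 0) => [->|k0].
      by rewrite /rot_h /freq !mul0r oppr0 i0 cos0 sin0 mul1r mul0r.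
    have K0 : (k%:~R : R) != 0 by rewrite intr_eq0.
    by have [-> _] := mode_inverse t (hcoef Z k) (ucoef Z k) (p_gt0 k) K0; rewrite add0r.
  rewrite ucoefD uA uG hV u0 h1 u1 /b0 /a1 /b1; case: (eqVneq k 0) => [->|k0].
    by rewrite /rot_u /freq !mul0r oppr0 i0 cos0 sin0 mul1r mul0r.
  have K0 : (k%:~R : R) != 0 by rewrite intr_eq0.
  by have [_ ->] := mode_inverse t (hcoef Z k) (ucoef Z k) (p_gt0 k) K0; rewrite add0r.
have eGV s : energy_space (group s V) := A_dom_energy beta_gt0 (AVt s).
have ZE : Z = P + Aop V.
  by rewrite -[LHS](wave_group0 beta_gt0 eZ) split_group (wave_group0 beta_gt0 e1).
move=> t; exists (t%:C%C *: P + (group t V - V)).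
have AD : A_dom (group t V - V) by exact: (A_domB beta_gt0).
have AW : A_dom (t%:C%C *: P + (group t V - V)) by exact: (A_dom_lin beta_gt0).
have eW := A_dom_energy beta_gt0 AW.
have eA s : energy_space (Aop (group s V)) by have [] := A_opP beta_gt0 (AVt s).
split=> //; first split=> // X eX.
  have [cr ci] := ip_continuous beta_gt0 eX (wave_group_continuous eZ).
  have D s := ip_derive beta_gt0 eX eGV (wave_group_derive s AV).
  have E s : ip (group s Z) X = ip P X + ip (Aop (group s V)) X.
    by rewrite split_group -[P in LHS]scale1r (ip_lin beta_gt0)// mul1r.
  have G0 : ip (group 0 V) X = ip V X by rewrite wave_group0.
  have WE : ip (t%:C%C *: P + (group t V - V)) X =
      t%:C%C * ip P X + (ip (group t V) X - ip V X).
    have eD : energy_space (group t V - V) by exact: (energyB beta_gt0).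
    by rewrite (ip_lin beta_gt0 _ e0 eD eX) (ipB beta_gt0 (eGV t) e1 eX).
  have H (a : R) (f g g' : R -> R) : continuous f -> (forall s, f s = a + g' s) ->
      (forall s, is_derive s 1 g (g' s)) -> oriented_int f t = t * a + (g t - g 0).
    move=> cf fE dg; have dF s : is_derive s 1 (fun s => s * a + g s) (f s).
      have d1 := is_deriveM (is_derive_id s 1) (is_derive_cst a s 1).
      refine (is_derive_eq (is_deriveD d1 (dg s)) _).
      by rewrite fE /GRing.scale /= mulr0 add0r mulr1.
    by rewrite (oriented_int_antiderivative t cf dF); ring.
  rewrite WE; apply: complex_ext.
    have r := H (Re (ip P X)) _ (fun s => Re (ip (group s V) X))
      (fun s => Re (ip (Aop (group s V)) X)) cr
      (fun s => etrans (congr1 _ (E s)) (cReD _ _)) (fun s => proj1 (D s)).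
    rewrite oriented_Re r G0.
    by move: (ip _ _) (ip _ _) (ip _ _) => x y z; rewrite !cpartE /=; ring.
  have r := H (Im (ip P X)) _ (fun s => Im (ip (group s V) X))
    (fun s => Im (ip (Aop (group s V)) X)) ci
    (fun s => etrans (congr1 _ (E s)) (cImD _ _)) (fun s => proj2 (D s)).
  rewrite oriented_Im r G0.
  by move: (ip _ _) (ip _ _) (ip _ _) => x y z; rewrite !cpartE /=; ring.
have [eAW hAW uAW _] := A_opP beta_gt0 AW.
have [eAV hAV uAV _] := A_opP beta_gt0 AV.
have [_ hAG uAG _] := A_opP beta_gt0 (AVt t).
have i0 (z : R[i]) : Complex (0 : R) 0 * z = 0 by rewrite (_ : Complex _ _ = 0)// mul0r.
have Ph k : Complex 0 (- (k%:~R * p k)) * ucoef P k = 0.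
  by rewrite u0 /b0; case: (eqVneq k 0) => [->|_]; rewrite ?mulr0// mul0r oppr0 i0.
have Pu k : Complex 0 (- k%:~R) * hcoef P k = 0.
  by rewrite h0 /a0; case: (eqVneq k 0) => [->|_]; rewrite ?mulr0// oppr0 i0.
have energyD Z1 Z2 : energy_space Z1 -> energy_space Z2 -> energy_space (Z1 + Z2).
  by move=> f1 f2; rewrite -[Z1]scale1r; exact: (energy_lin beta_gt0).
rewrite split_group [in RHS]ZE; apply: (state_ext beta_gt0).
- exact: energyD.
- exact: (energyD _ _ (energyD _ _ e0 eAV) eAW).
- move=> k; rewrite !hcoefD hAG hAV hAW ucoef_lin ucoefB.
  by apply: subr0_eq; rewrite -[RHS](mulr0 (- t%:C%C)) -(Ph k); ring.
- move=> k; rewrite !ucoefD uAG uAV uAW hcoef_lin hcoefB.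
  by apply: subr0_eq; rewrite -[RHS](mulr0 (- t%:C%C)) -(Pu k); ring.
Qed.

End Evolution.

(** * The generator *)
Section Generation.
Variables (R : realType) (beta : R).
Hypothesis beta_gt0 : 0 < beta.
Implicit Types (k : int) (t s : R) (Z W : state R).

Local Notation p := (p_mult beta).
Local Notation group := (wave_group beta).
Let p_gt0 k : 0 < p k. Proof. exact: p_mult_gt0. Qed.

Lemma is_derive_unique (f : R -> R) t a b :
  is_derive t 1 f a -> is_derive t 1 f b -> a = b.
Proof. by move=> [_ <-] [_ <-]. Qed.

(** A derivative of the orbit at 0 is, mode by mode, the image under the
    operator; being in the energy space, it makes the image summable. *)
Lemma generator_dom Z W : energy_space Z ->
  has_derivative beta (fun t => group t Z) 0 W -> A_dom Z.
Proof.
move=> eZ dW; have [eW _] := dW.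
have eG t : energy_space (group t Z) by exact: wave_group_energy.
have WE k : hcoef W k = Complex 0 (- (k%:~R * p k)) * ucoef Z k /\
    ucoef W k = Complex 0 (- k%:~R) * hcoef Z k.
  have [d1 d2 d3 d4] : [/\ is_derive (0 : R) 1 (fun s => Re (hcoef (group s Z) k)) (Re (hcoef W k)),
      is_derive (0 : R) 1 (fun s => Im (hcoef (group s Z) k)) (Im (hcoef W k)),
      is_derive (0 : R) 1 (fun s => Re (ucoef (group s Z) k)) (Re (ucoef W k)) &
      is_derive (0 : R) 1 (fun s => Im (ucoef (group s Z) k)) (Im (ucoef W k))].
    apply: (mode_derive beta_gt0 eG) => X eX iX; have [d1 d2] := ip_derive beta_gt0 eX eG dW;
      have e := iX _ eW;
      (split; [apply: (is_derive_eq d1)|apply: (is_derive_eq d2)]); rewrite e;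
      first [exact: cRe_scale|exact: cIm_scale].
  have [c1 c2 c3 c4] := @rot_mode_ode R (p k) k%:~R (p_gt0 k) (hcoef Z k) (ucoef Z k) 0.
  have H t := wave_groupP beta_gt0 t eZ.
  have hE : (fun t => hcoef (group t Z) k) = (fun t => rot_h (p k) k%:~R t (hcoef Z k) (ucoef Z k)).
    by apply/funext => t; have [_ h _ _] := H t.
  have uE : (fun t => ucoef (group t Z) k) = (fun t => rot_u (p k) k%:~R t (hcoef Z k) (ucoef Z k)).
    by apply/funext => t; have [_ _ u _] := H t.
  have C (P : R[i] -> R) (f g : R -> R[i]) : f = g -> (fun t => P (f t)) = (fun t => P (g t)).
    by move=> ->.
  rewrite (C (@complex.Re R) _ _ hE) in d1; rewrite (C (@complex.Im R) _ _ hE) in d2.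
  rewrite (C (@complex.Re R) _ _ uE) in d3; rewrite (C (@complex.Im R) _ _ uE) in d4.
  have [r1 r2] := @rot0 R (p k) k%:~R (hcoef Z k) (ucoef Z k).
  rewrite r2 in c1 c2; rewrite r1 in c3 c4.
  split; apply: complex_ext; rewrite ?cRe_imag ?cIm_imag.
  - exact: is_derive_unique d1 c1.
  - by rewrite (is_derive_unique d2 c2) mulNr.
  - exact: is_derive_unique d3 c3.
  - exact: is_derive_unique d4 c4.
have /(energyP beta_gt0)[d1 d2 sZ] := eZ; apply/(A_domP beta_gt0); split=> //.
have := energy_at_zsummable beta_gt0 eW; congr zsummable; apply/funext => k.
have [h u] := WE k.
rewrite mode_freq_sqr// /energy_at /mode_energy h u
  (normc2M _ (ucoef Z k)) (normc2M _ (hcoef Z k)) !normc2_imag.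
by move: (normc2 (hcoef Z k)) (normc2 (ucoef Z k)) => *; ring.
Qed.

Lemma wave_group_generates : generates beta group.
Proof.
have E Z W : energy_space Z ->
    (fun t => energy_norm beta ((t^-1)%:C%C *: (group t Z - Z) - W)) =
    (fun t => energy_norm beta ((t^-1)%:C%C *: (group (0 + t) Z - group 0 Z) - W)).
  by move=> eZ; apply/funext => t; rewrite add0r (wave_group0 beta_gt0 eZ).
have rel Z : A_dom Z -> energy_space (A_op beta Z) /\
    energy_norm beta ((t^-1)%:C%C *: (group t Z - Z) - A_op beta Z) @[t --> 0^'] --> (0 : R).
  move=> AZ; have eZ := A_dom_energy beta_gt0 AZ.
  have [eA c] := wave_group_derive beta_gt0 0 AZ.
  have {}c : energy_norm beta ((t^-1)%:C%C *: (group (0 + t) Z - group 0 Z) - A_op beta Z)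
      @[t --> 0^'] --> (0 : R) by move: c; rewrite {2}(wave_group0 beta_gt0 eZ).
  by rewrite (E Z (A_op beta Z) eZ); split=> //; have [] := A_opP beta_gt0 AZ.
split=> // Z; split=> [AZ|[eZ [W [eW c]]]].
  by split; [exact: (A_dom_energy beta_gt0 AZ)|exists (A_op beta Z); exact: rel].
have dW : has_derivative beta (fun t => group t Z) 0 W.
  by rewrite (E Z W eZ) in c; exact: conj eW c.
exact: generator_dom eZ dW.
Qed.

Lemma wave_group_C0 : C0_group beta group.
Proof.
split.
- by move=> t Z; exact: wave_group_energy.
- by move=> t a Z W; exact: wave_group_lin.
- by move=> t; exists 1 => Z eZ; rewrite wave_group_norm// mul1r.
- by move=> Z; exact: wave_group0.
- by move=> s t Z; exact: wave_groupD.
- by move=> Z; exact: wave_group_continuous.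
Qed.

Lemma wave_group_unitary t : unitary_on_energy beta (group t).
Proof.
split=> [Z|W eW|Z W eZ eW]; first exact: wave_group_energy.
  exists (group (- t) W); first exact: wave_group_energy.
  by rewrite -wave_groupD// subrr wave_group0.
exact: wave_group_ip.
Qed.

Lemma wave_group_classical Z : A_dom Z -> [/\ C_dom beta (fun t => group t Z),
  C1_energy beta (fun t => group t Z) & classical_solution beta Z (fun t => group t Z)].
Proof.
move=> AZ; have eZ := A_dom_energy beta_gt0 AZ.
have AG t := wave_group_A_dom beta_gt0 t AZ.
have C1 : C1_energy beta (fun t => group t Z).
  split=> [t|]; first exact: wave_group_energy.
  exists (fun t => A_op beta (group t Z)); last by move=> t; exact: wave_group_derive.
  split=> [t|t0]; first by have [] := A_opP beta_gt0 (AG t).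
  rewrite (funext (fun t => congr1 (energy_norm beta) (A_opB beta_gt0 (AG t) (AG t0)))).
  exact: A_op_group_cvg.
split=> //.
  split=> // t0; have c1 : energy_norm beta (group t Z - group t0 Z) @[t --> t0] --> (0 : R).
    by have [_ c] := wave_group_continuous beta_gt0 eZ; exact: c.
  have c : energy_norm beta (group t Z - group t0 Z) +
      energy_norm beta (A_op beta (group t Z - group t0 Z)) @[t --> t0] --> (0 + 0 : R).
    by apply: cvgD => //; exact: A_op_group_cvg.
  by rewrite addr0 in c.
split=> //; last exact: wave_group0.
by move=> t; exact: wave_group_derive.
Qed.

End Generation.

Unset Implicit Arguments.
Set Strict Implicit.

Theorem theorem2p6 (R : realType) (beta : R) (hbeta : 0 < beta) :
  exists S : R -> state R -> state R,
    [/\ C0_group beta S,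
        forall t, unitary_on_energy beta (S t),
        generates beta S &
        forall Z0 : state R, energy_space Z0 ->
          [/\ mild_solution beta Z0 (fun t => S t Z0),
              forall Y : R -> state R, mild_solution beta Z0 Y ->
                forall t, Y t = S t Z0,
              forall t, energy_norm beta (S t Z0) = energy_norm beta Z0 &
              A_dom Z0 ->
                [/\ C_dom beta (fun t => S t Z0),
                    C1_energy beta (fun t => S t Z0),
                    classical_solution beta Z0 (fun t => S t Z0) &
                    forall Y : R -> state R, classical_solution beta Z0 Y ->
                      forall t, Y t = S t Z0]]].
Proof.
exists (wave_group beta); split.
- exact: wave_group_C0.
- exact: wave_group_unitary.
- exact: wave_group_generates.
move=> Z0 e0; split.
- exact: wave_group_mild.
- move=> Y mY; have [oY Y0] := mild_ode hbeta e0 mY; exact: state_ode_uniq.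
- by move=> t; exact: wave_group_norm.
move=> A0; have [c1 c2 c3] := wave_group_classical hbeta A0; split=> //.
move=> Y [_ AY dY Y0]; exact: (state_ode_uniq hbeta e0 (classical_ode hbeta AY dY) Y0).
Qed.
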